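(* Let $F$ be a field of characteristic two, let $K/F$ be a separable field extension, and let $(A,\sigma)$ be a central simple $F$-algebra of degree $2^n$ (for some integer $n$) with anisotropic orthogonal involution $\sigma$. Then $(A,\sigma)$ is totally decomposable if and only if $(A,\sigma)_K$ is totally decomposable.
   Context: An involution on a central simple $F$-algebra $A$ is an anti-automorphism $\sigma$ of $A$ of order two. It is of the first kind if $\sigma|_F=\mathrm{id}$. An involution of the first kind is symplectic if it becomes adjoint to an alternating bilinear form over a splitting field of $A$, and orthogonal otherwise. Put $\mathrm{Alt}(A,\sigma)=\{x-\sigma(x)\mid x\in A\}$; an involution $\sigma$ of the first kind is orthogonal (in characteristic two) if and only if $\mathrm{Alt}(A,\sigma)\cap F=\{0\}$. The involution $\sigma$ is isotropic if there is a nonzero $x\in A$ with $\sigma(x)x=0$, and anisotropic otherwise. The degree of $A$ is $\deg_F A=\sqrt{\dim_F A}$; a quaternion algebra is a central simple algebra of degree two. An algebra with involution $(A,\sigma)$ over $F$ (of the first kind) is totally decomposable if it is isomorphic, as an $F$-algebra with involution, to a tensor product over $F$ of quaternion $F$-algebras with involution (of the first kind). For a field extension $K/F$, $(A,\sigma)_K=(A_K,\sigma_K)$ with $A_K=A\otimes_F K$ and $\sigma_K=\sigma\otimes\mathrm{id}_K$. A separable extension means a (not necessarily finite) algebraic extension in which every element has a separable minimal polynomial over the ground field. *)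

(* Defs.v *)
From HB Require Import structures.
From mathcomp Require Import all_boot all_order all_algebra all_field.

Set Implicit Arguments.
Unset Strict Implicit.
Unset Printing Implicit Defensive.

Import GRing.Theory.
Local Open Scope ring_scope.

(* The tensor product A (x)_F B of a finite-dimensional F-algebra A and an    *)
(* F-algebra B.  With (e_i) the basis [vbasis {:A}] of A, the F-space         *)
(* A (x)_F B is the direct sum of the e_i (x) B, so that an element is a      *)
(* family x of elements of B and stands for \sum_i e_i (x) x_i.  The lemmas   *)
(* [tpureDl], ..., [tens_sum_pure] and [tpureM] below describe the result in  *)
(* terms of pure tensors only.                                                *)
Definition tens (F : fieldType) (A : falgType F) (B : algType F) : Type :=
  {ffun 'I_(\dim {:A}) -> B}.

Section TensorProduct.
Variables (F : fieldType) (A : falgType F) (B : algType F).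

HB.instance Definition _ :=
  GRing.Lmodule.copy (tens A B) {ffun 'I_(\dim {:A}) -> B}.

Local Notation e := (vbasis {:A}).

Definition tpure (a : A) (b : B) : tens A B := [ffun i => coord e i a *: b].

Definition tens_one : tens A B := tpure 1 1.

Definition tens_mul (x y : tens A B) : tens A B :=
  \sum_(i < \dim {:A}) \sum_(j < \dim {:A}) tpure (e`_i * e`_j) (x i * y j).

Lemma tpureDl a1 a2 b : tpure (a1 + a2) b = tpure a1 b + tpure a2 b.
Proof. by apply/ffunP => i; rewrite !ffunE linearD scalerDl. Qed.

Lemma tpureDr a b1 b2 : tpure a (b1 + b2) = tpure a b1 + tpure a b2.
Proof. by apply/ffunP => i; rewrite !ffunE scalerDr. Qed.

Lemma tpureZl c a b : tpure (c *: a) b = c *: tpure a b.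
Proof. by apply/ffunP => i; rewrite !ffunE linearZ scalerA. Qed.

Lemma tpureZr c a b : tpure a (c *: b) = c *: tpure a b.
Proof. by apply/ffunP => i; rewrite !ffunE !scalerA mulrC. Qed.

Lemma tpure_suml (I : finType) (f : I -> A) b :
  tpure (\sum_i f i) b = \sum_i tpure (f i) b.
Proof.
apply: (big_morph (fun a => tpure a b)) => [x y|]; first exact: tpureDl.
by apply/ffunP => i; rewrite !ffunE linear0 scale0r.
Qed.

Lemma tpure_sumr (I : finType) a (f : I -> B) :
  tpure a (\sum_i f i) = \sum_i tpure a (f i).
Proof.
apply: (big_morph (tpure a)) => [x y|]; first exact: tpureDr.
by apply/ffunP => i; rewrite !ffunE scaler0.
Qed.

Lemma tens_sum_pure (x : tens A B) : x = \sum_(i < \dim {:A}) tpure e`_i (x i).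
Proof.
apply/ffunP => j; rewrite sum_ffunE (bigD1 j) //= big1 => [|i ij]; last first.
  by rewrite ffunE coord_free ?(basis_free (vbasisP _)) // (negPf ij) scale0r.
by rewrite ffunE coord_free ?(basis_free (vbasisP _)) // eqxx scale1r addr0.
Qed.

Lemma tens_mulDl : left_distributive tens_mul +%R.
Proof.
move=> x y z; rewrite /tens_mul -big_split /=; apply: eq_bigr => i _.
rewrite -big_split /=; apply: eq_bigr => j _.
by rewrite ffunE mulrDl tpureDr.
Qed.

Lemma tens_mulDr : right_distributive tens_mul +%R.
Proof.
move=> x y z; rewrite /tens_mul -big_split /=; apply: eq_bigr => i _.
rewrite -big_split /=; apply: eq_bigr => j _.
by rewrite ffunE mulrDr tpureDr.
Qed.

Lemma tens_mul_pure a b c d :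
  tens_mul (tpure a b) (tpure c d) = tpure (a * c) (b * d).
Proof.
have aE := coord_vbasis (memvf a); have cE := coord_vbasis (memvf c).
rewrite [in RHS]aE [in RHS]cE mulr_suml tpure_suml /tens_mul.
apply: eq_bigr => i _; rewrite mulr_sumr tpure_suml; apply: eq_bigr => j _.
rewrite !ffunE -scalerAl -scalerAr -scalerAl -scalerAr.
by rewrite !tpureZr !tpureZl.
Qed.

Let mul_suml (I : finType) (f : I -> tens A B) y :
  tens_mul (\sum_i f i) y = \sum_i tens_mul (f i) y.
Proof.
apply: (big_morph (tens_mul^~ y)) => [u v|]; first exact: tens_mulDl.
by apply: (addrI (tens_mul 0 y)); rewrite -tens_mulDl !addr0.
Qed.

Let mul_sumr (I : finType) x (f : I -> tens A B) :
  tens_mul x (\sum_i f i) = \sum_i tens_mul x (f i).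
Proof.
apply: (big_morph (tens_mul x)) => [u v|]; first exact: tens_mulDr.
by apply: (addrI (tens_mul x 0)); rewrite -tens_mulDr !addr0.
Qed.

Fact tens_mulA : associative tens_mul.
Proof.
have expand x : exists f : 'I_(\dim {:A}) -> B,
    x = \sum_(i < \dim {:A}) tpure e`_i (f i).
  by exists x; apply: tens_sum_pure.
move: tens_mul mul_suml mul_sumr tens_mul_pure => m ml mr mpure x y z.
have [f ->] := expand x; have [g ->] := expand y; have [h ->] := expand z.
rewrite !ml; apply: eq_bigr => i _.
rewrite [X in _ = m X _]mr [RHS]ml [LHS]mr; apply: eq_bigr => j _.
by rewrite !mr; apply: eq_bigr => k _; rewrite !mpure !mulrA.
Qed.

Fact tens_mul1r : left_id tens_one tens_mul.
Proof.
move=> x; rewrite [RHS]tens_sum_pure [X in tens_mul _ X]tens_sum_pure mul_sumr;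
 apply: eq_bigr => i _.
by rewrite tens_mul_pure !mul1r.
Qed.

Fact tens_mulr1 : right_id tens_one tens_mul.
Proof.
move=> x; rewrite [RHS]tens_sum_pure [X in tens_mul X _]tens_sum_pure mul_suml;
 apply: eq_bigr => i _.
by rewrite tens_mul_pure !mulr1.
Qed.

Fact tens_oner_neq0 : tens_one != 0.
Proof.
apply/eqP => /ffunP one0; have /eqP[] := oner_neq0 A.
rewrite (coord_vbasis (memvf (1 : A))) big1 // => i _.
have /eqP := one0 i; rewrite !ffunE scaler_eq0 oner_eq0 orbF => /eqP->.
by rewrite scale0r.
Qed.

HB.instance Definition _ := GRing.Zmodule_isNzRing.Build (tens A B)
  tens_mulA tens_mul1r tens_mulr1 tens_mulDl tens_mulDr tens_oner_neq0.

Lemma tpureM a b c d :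
  (tpure a b : tens A B) * tpure c d = tpure (a * c) (b * d).
Proof. exact: tens_mul_pure. Qed.

Fact tens_scalerAl (c : F) (x y : tens A B) : c *: (x * y) = (c *: x) * y.
Proof.
rewrite [x * y]/(tens_mul x y) [RHS]/(tens_mul _ _) /tens_mul scaler_sumr.
apply: eq_bigr => i _; rewrite scaler_sumr; apply: eq_bigr => j _.
by rewrite ffunE -scalerAl tpureZr.
Qed.

HB.instance Definition _ :=
  GRing.Lmodule_isLalgebra.Build F (tens A B) tens_scalerAl.

Fact tens_scalerAr (c : F) (x y : tens A B) : c *: (x * y) = x * (c *: y).
Proof.
rewrite [x * y]/(tens_mul x y) [RHS]/(tens_mul _ _) /tens_mul scaler_sumr.
apply: eq_bigr => i _; rewrite scaler_sumr; apply: eq_bigr => j _.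
by rewrite ffunE -scalerAr tpureZr.
Qed.

HB.instance Definition _ :=
  GRing.Lalgebra_isAlgebra.Build F (tens A B) tens_scalerAr.

(* The map f (x) g, for f F-linear and g F-linear. *)
Definition tens_map (f : A -> A) (g : B -> B) (x : tens A B) : tens A B :=
  \sum_(i < \dim {:A}) tpure (f e`_i) (g (x i)).

Lemma tens_map_pure (f : {linear A -> A}) (g : {linear B -> B}) a b :
  tens_map f g (tpure a b) = tpure (f a) (g b).
Proof.
rewrite [in RHS](coord_vbasis (memvf a)) linear_sum tpure_suml.
by apply: eq_bigr => i _; rewrite ffunE !linearZ /= tpureZr tpureZl.
Qed.

End TensorProduct.

Section TensorFalgebra.
Variables (F : fieldType) (A B : falgType F).

HB.instance Definition _ := Vector.copy (tens A B) {ffun 'I_(\dim {:A}) -> B}.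
HB.instance Definition _ := Algebra_isFalgebra.Build F (tens A B).

End TensorFalgebra.

(* K seen as an F-algebra through iota. *)
Definition ext_alg (F K : fieldType) (iota : {rmorphism F -> K}) : Type := K.

Section ExtAlgebra.
Variables (F K : fieldType) (iota : {rmorphism F -> K}).
Local Notation Kalg := (ext_alg iota).

HB.instance Definition _ := GRing.Field.copy Kalg K.

Definition ext_scale (a : F) (x : Kalg) : Kalg := iota a * x.

Fact ext_scalerA a b x : ext_scale a (ext_scale b x) = ext_scale (a * b) x.
Proof. by rewrite /ext_scale rmorphM mulrA. Qed.
Fact ext_scale1r : left_id 1 ext_scale.
Proof. by move=> x; rewrite /ext_scale rmorph1 mul1r. Qed.
Fact ext_scalerDr : right_distributive ext_scale +%R.
Proof. by move=> a x y; rewrite /ext_scale mulrDr. Qed.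
Fact ext_scalerDl x : {morph ext_scale^~ x : a b / a + b}.
Proof. by move=> a b; rewrite /ext_scale rmorphD mulrDl. Qed.

HB.instance Definition _ := GRing.Zmodule_isLmodule.Build F Kalg
  ext_scalerA ext_scale1r ext_scalerDr ext_scalerDl.

Fact ext_scalerAl (a : F) (x y : Kalg) : a *: (x * y) = (a *: x) * y.
Proof. exact: mulrA. Qed.
HB.instance Definition _ := GRing.Lmodule_isLalgebra.Build F Kalg ext_scalerAl.

Fact ext_scalerAr (a : F) (x y : Kalg) : a *: (x * y) = x * (a *: y).
Proof. exact: mulrCA. Qed.
HB.instance Definition _ := GRing.Lalgebra_isAlgebra.Build F Kalg ext_scalerAr.

End ExtAlgebra.

(* A_K = A (x)_F K as a K-algebra.  The carrier and the ring structure are    *)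
(* those of [tens A (ext_alg iota)]; the scalars are those of K.              *)
Definition scalar_ext (F K : fieldType) (iota : {rmorphism F -> K})
  (A : falgType F) : Type := tens A (ext_alg iota).

Section ScalarExtension.
Variables (F K : fieldType) (iota : {rmorphism F -> K}) (A : falgType F).
Local Notation AK := (scalar_ext iota A).

HB.instance Definition _ :=
  GRing.NzRing.copy AK (tens A (ext_alg iota)).

Local Notation coords := {ffun 'I_(\dim {:A}) -> K^o}.

Definition scalar_ext_scale (c : K) (x : AK) : AK := (c *: (x : coords)).

Fact scalar_ext_scalerA a b x :
  scalar_ext_scale a (scalar_ext_scale b x) = scalar_ext_scale (a * b) x.
Proof. exact: (@scalerA K coords). Qed.
Fact scalar_ext_scale1r : left_id 1 scalar_ext_scale.
Proof. exact: (@scale1r K coords). Qed.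
Fact scalar_ext_scalerDr : right_distributive scalar_ext_scale +%R.
Proof. exact: (@scalerDr K coords). Qed.
Fact scalar_ext_scalerDl x : {morph scalar_ext_scale^~ x : a b / a + b}.
Proof. move=> a b; exact: (@scalerDl K coords). Qed.

HB.instance Definition _ := GRing.Zmodule_isLmodule.Build K AK
  scalar_ext_scalerA scalar_ext_scale1r scalar_ext_scalerDr
  scalar_ext_scalerDl.

Lemma scale_tpure (c : K) (a : A) (x : ext_alg iota) :
  c *: (tpure a x : AK) = tpure a ((c : ext_alg iota) * x).
Proof. by apply/ffunP => i; rewrite !ffunE; apply: mulrCA. Qed.

Fact scalar_ext_scalerAl (c : K) (x y : AK) : c *: (x * y) = (c *: x) * y.
Proof.
rewrite [x * y]/(tens_mul x y) [RHS]/(tens_mul _ _) /tens_mul scaler_sumr.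
apply: eq_bigr => i _; rewrite scaler_sumr; apply: eq_bigr => j _.
by rewrite scale_tpure ffunE mulrA.
Qed.
HB.instance Definition _ :=
  GRing.Lmodule_isLalgebra.Build K AK scalar_ext_scalerAl.

Fact scalar_ext_scalerAr (c : K) (x y : AK) : c *: (x * y) = x * (c *: y).
Proof.
rewrite [x * y]/(tens_mul x y) [RHS]/(tens_mul _ _) /tens_mul scaler_sumr.
apply: eq_bigr => i _; rewrite scaler_sumr; apply: eq_bigr => j _.
by rewrite scale_tpure ffunE; congr tpure; apply: mulrCA.
Qed.
HB.instance Definition _ :=
  GRing.Lalgebra_isAlgebra.Build K AK scalar_ext_scalerAr.

Fact scalar_ext_vect_iso : Vector.axiom (\dim {:A}) AK.
Proof.
exists (fun x : AK => \row_i (x i : K)) => [c x y|].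
  by apply/rowP => i; rewrite !mxE !ffunE.
exists (fun r : 'rV[K]_(\dim {:A}) => [ffun i => r 0 i] : AK) => [x|r].
  by apply/ffunP => i; rewrite ffunE mxE.
by apply/rowP => i; rewrite mxE ffunE.
Qed.
HB.instance Definition _ :=
  Lmodule_hasFinDim.Build K AK scalar_ext_vect_iso.
HB.instance Definition _ := Algebra_isFalgebra.Build K AK.

(* sigma_K = sigma (x) id_K *)
Definition invol_ext (sigma : A -> A) : AK -> AK :=
  @tens_map F A (ext_alg iota) sigma id.

End ScalarExtension.

Definition central_simple (F : fieldType) (A : falgType F) : Prop :=
  (forall x : A, (forall y, x * y = y * x) -> exists a : F, x = a%:A) /\
  (forall I : {vspace A},
      (forall x y, y \in I -> x * y \in I /\ y * x \in I) ->
      I = 0%VS \/ I = fullv).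

Definition has_degree (F : fieldType) (A : falgType F) (d : nat) : Prop :=
  \dim {:A} = (d ^ 2)%N.

Definition quaternion_algebra (F : fieldType) (A : falgType F) : Prop :=
  central_simple A /\ has_degree A 2.

(* "Order two" is read as sigma \o sigma = id, which makes sigma bijective.   *)
(* The only difference with order exactly two is that the identity of F is an *)
(* involution of the central simple F-algebra F.                              *)
Definition involution_first_kind (F : fieldType) (A : falgType F)
    (sigma : A -> A) : Prop :=
  [/\ forall x y, sigma (x + y) = sigma x + sigma y,
      forall x y, sigma (x * y) = sigma y * sigma x,
      forall x, sigma (sigma x) = x &
      forall a : F, sigma a%:A = a%:A].

(* Over some extension L of F that splits A, say phi : A_L ~ End_L(V) with V  *)
(* the space of column vectors of size m.+1, the involution sigma_L is        *)
(* adjoint to the nondegenerate alternating form (u, v) |-> u^T b v.          *)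
Definition symplectic_invol (F : fieldType) (A : falgType F) (sigma : A -> A) :
    Prop :=
  exists (L : fieldType) (iota : {rmorphism F -> L}) (m : nat)
         (phi : {lrmorphism scalar_ext iota A -> 'M[L]_m.+1})
         (b : 'M[L]_m.+1),
    [/\ bijective phi,
        b \in unitmx,
        forall u : 'cV[L]_m.+1, u^T *m b *m u = 0 &
        forall x (u v : 'cV[L]_m.+1),
          (phi x *m u)^T *m b *m v =
          u^T *m b *m (phi (invol_ext sigma x) *m v)].

Definition orthogonal_invol (F : fieldType) (A : falgType F) (sigma : A -> A) :
    Prop :=
  involution_first_kind sigma /\ ~ symplectic_invol sigma.

Definition isotropic_invol (F : fieldType) (A : falgType F) (sigma : A -> A) :
    Prop :=
  exists x : A, x != 0 /\ sigma x * x = 0.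

Definition anisotropic_invol (F : fieldType) (A : falgType F) (sigma : A -> A) :
    Prop :=
  ~ isotropic_invol sigma.

Record alg_invol (F : fieldType) :=
  AlgInvol { alg_of : falgType F; invol_of : alg_of -> alg_of }.

Definition alg_invol_iso (F : fieldType) (X Y : alg_invol F) : Prop :=
  exists f : {lrmorphism alg_of X -> alg_of Y},
    bijective f /\ forall x, f (invol_of x) = invol_of (f x).

Definition alg_invol_tens (F : fieldType) (X Y : alg_invol F) : alg_invol F :=
  @AlgInvol F (tens (alg_of X) (alg_of Y))
    (tens_map (@invol_of F X) (@invol_of F Y)).

(* (F, id), the neutral element of the tensor product *)
Definition alg_invol_one (F : fieldType) : alg_invol F :=
  @AlgInvol F F^o id.

Record quaternion_invol (F : fieldType) := QuaternionInvol {
  quat_of :> alg_invol F;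
  quat_alg : quaternion_algebra (alg_of quat_of);
  quat_invol : involution_first_kind (@invol_of F quat_of) }.

Definition quaternion_tensor (F : fieldType) (Qs : seq (quaternion_invol F)) :
    alg_invol F :=
  foldr (fun (Q : quaternion_invol F) X => alg_invol_tens Q X)
    (alg_invol_one F) Qs.

Definition totally_decomposable (F : fieldType) (A : falgType F)
    (sigma : A -> A) : Prop :=
  exists Qs : seq (quaternion_invol F),
    alg_invol_iso (AlgInvol sigma) (quaternion_tensor Qs).

Definition is_min_poly (F K : fieldType) (iota : {rmorphism F -> K})
    (x : K) (p : {poly F}) : Prop :=
  [/\ p \is monic, root (map_poly iota p) x &
      forall q : {poly F}, root (map_poly iota q) x -> p %| q].

Definition separable_extension (F K : fieldType) (iota : {rmorphism F -> K}) :
    Prop :=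
  forall x : K, exists p : {poly F}, is_min_poly iota x p /\ separable_poly p.

(* Main.v *)
Require Import Defs.
From HB Require Import structures.
From mathcomp Require Import all_boot all_order all_algebra all_field.
From mathcomp Require Import zify ring.
From Stdlib Require Import Classical.

Set Implicit Arguments.
Unset Strict Implicit.
Unset Printing Implicit Defensive.

Import GRing.Theory.
Local Open Scope ring_scope.

(* Call (u, w) a quaternion pair if u^2 = b is a nonzero scalar, w^2 = w + a
   and wu = uw + u.  In characteristic two an algebra with involution without
   symplectic factors is totally decomposable if and only if it is generated by
   commuting quaternion pairs fixed by the involution; this property obviously
   extends to A_K.

   Conversely, suppose that A_K is generated by fixed pairs (u_i, w_i), and let
   Phi = K[u_1, ..., u_n], which is its own centralizer and consists of
   symmetric elements with square in K.  The map x |-> sigma(x) x is additive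
   modulo Alt and semilinear for the Frobenius map; since K/F is separable,
   squaring preserves linear independence over F, so that the conditions
   sigma(x) x in Alt and sigma(x) x in F + Alt commute with the extension.  The
   first one defines a right ideal N, and if Phi had nonzero nilpotent elements,
   then some 0 <> z in Phi with zN = 0 would lie in N, whose components z_k in A
   would satisfy sigma(z_k) z_k = 0.  By anisotropy Phi is thus a field and
   N = 0, hence every x with sigma(x) x in K + Alt commutes with Phi, i.e. lies
   in Phi.  It follows that Phi is defined over F, by a purely inseparable field
   S in A.

   Modulo Alt, multiplication on S is an anisotropic bilinear form with values
   in F, so that an orthogonal choice gives generators v_1, ..., v_n of S whose
   nontrivial products are all in Alt.  The inner derivations of A stabilizing S
   separate the subfields of S, as over K they contain those of the w_i; this
   provides w_i with [w_i, v_j] = v_j if i = j and 0 otherwise, and these are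
   corrected to commute and to satisfy w_i^2 + w_i in F.  The choice of the v_i
   forces them to be symmetric. *)

(** * Identities in noncommutative algebras of characteristic two *)

(** Orthogonality enters only as: 1 is not in Alt. Since symplectic involutions are defined through
    splitting fields, this has to be derived, and the generators themselves provide it: over a field
    where all t^2 = t + a_i are solvable the pairs yield matrix units, and an involution of a matrix
    algebra with 1 in Alt is adjoint to an alternating form. Hence generators are extracted from a
    decomposition before it is known that they can be taken fixed.

    The obstacle to descent is that the pairs over K are far from unique, and a given choice need
    not come from A. Phi, in contrast, turns out to be intrinsic: once N = 0, it is the set of all x
    with sigma(x) x in K + Alt, a condition that passes to the components of x. Only Phi is
    descended, and new pairs are built inside A from S, the inner derivations being the only trace
    left of the w_i.

    For nilpotent elements, z is taken in the socle of Phi because it must satisfy two conditions at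
    once: z^2 = 0 puts its components into N, and zN = 0 then makes z annihilate its own
    components. *)

Inductive sexpr := SVar of nat | S0 | S1 | SAdd of sexpr & sexpr | SMul of sexpr & sexpr.

Inductive nexpr := NVar of nat | N0 | N1 | NAdd of nexpr & nexpr
  | NMul of nexpr & nexpr | NScale of sexpr & nexpr.

(* A polynomial is the list, without repetition, of its monomials; a monomial
   is a sorted word of scalars together with a word of noncommuting variables. *)
Definition mono := (seq nat * seq nat)%type.

(** Adds a monomial to a polynomial with coefficients in the field of two elements: a monomial
    already present cancels. *)
Definition toggle (m : mono) (p : seq mono) :=
  if m \in p then rem m p else m :: p.

Definition padd (p q : seq mono) := foldr toggle q p.

Definition mmul (m m' : mono) : mono := (merge leq m.1 m'.1, m.2 ++ m'.2).

Definition pmul (p q : seq mono) :=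
  foldr (fun m acc => padd (map (mmul m) q) acc) [::] p.

Fixpoint snorm (s : sexpr) : seq mono :=
  match s with
  | SVar i => [:: ([:: i], [::])]
  | S0 => [::]
  | S1 => [:: ([::], [::])]
  | SAdd s t => padd (snorm s) (snorm t)
  | SMul s t => pmul (snorm s) (snorm t)
  end.

Fixpoint nnorm (e : nexpr) : seq mono :=
  match e with
  | NVar i => [:: ([::], [:: i])]
  | N0 => [::]
  | N1 => [:: ([::], [::])]
  | NAdd e f => padd (nnorm e) (nnorm f)
  | NMul e f => pmul (nnorm e) (nnorm f)
  | NScale s e => pmul (snorm s) (nnorm e)
  end.

Section Reflection.
Variables (F : fieldType) (A : algType F).
Hypothesis char2 : 2%N \in [pchar F].
Variables (sv : seq F) (av : seq A).

Fixpoint seval (s : sexpr) : F :=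
  match s with
  | SVar i => nth 0 sv i
  | S0 => 0
  | S1 => 1
  | SAdd s t => seval s + seval t
  | SMul s t => seval s * seval t
  end.

Fixpoint neval (e : nexpr) : A :=
  match e with
  | NVar i => nth 0 av i
  | N0 => 0
  | N1 => 1
  | NAdd e f => neval e + neval f
  | NMul e f => neval e * neval f
  | NScale s e => seval s *: neval e
  end.

Definition meval (m : mono) : A :=
  (\prod_(i <- m.1) nth 0 sv i) *: \prod_(i <- m.2) nth 0 av i.

Definition peval (p : seq mono) : A := \sum_(m <- p) meval m.

Lemma addxx (V : lmodType F) (x : V) : x + x = 0.
Proof. by rewrite -[x]scale1r -scalerDl (addrr_pchar2 char2) scale0r. Qed.

Lemma peval_toggle m p : peval (toggle m p) = meval m + peval p.
Proof.
rewrite /toggle; case: ifP => [mp|_]; last by rewrite /peval big_cons.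
rewrite /peval [in RHS](perm_big _ (perm_to_rem mp)) /= big_cons addrA.
by rewrite addxx add0r.
Qed.

Lemma peval_add p q : peval (padd p q) = peval p + peval q.
Proof.
elim: p => [|m p IH] /=; first by rewrite /peval big_nil add0r.
by rewrite peval_toggle IH addrA /peval big_cons.
Qed.

Lemma meval_mul m m' : meval (mmul m m') = meval m * meval m'.
Proof.
rewrite /meval /= (perm_big _ (permEl (perm_merge _ _ _))) /= !big_cat /=.
by rewrite -scalerAl -scalerAr scalerA.
Qed.

Lemma peval_mul p q : peval (pmul p q) = peval p * peval q.
Proof.
elim: p => [|m p IH] /=; first by rewrite /peval big_nil mul0r.
rewrite peval_add IH [peval (m :: p)]big_cons mulrDl; congr (_ + _).
by rewrite /peval big_map mulr_sumr; apply: eq_bigr => i _; apply: meval_mul.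
Qed.

Lemma snormP s : peval (snorm s) = (seval s)%:A.
Proof.
elim: s => [i|||s IHs t IHt|s IHs t IHt] /=.
- by rewrite /peval big_seq1 /meval /= big_nil big_seq1.
- by rewrite /peval big_nil scale0r.
- by rewrite /peval big_seq1 /meval !big_nil.
- by rewrite peval_add IHs IHt scalerDl.
- by rewrite peval_mul IHs IHt -scalerAl mul1r scalerA.
Qed.

Lemma nnormP e : peval (nnorm e) = neval e.
Proof.
elim: e => [i|||e IHe f IHf|e IHe f IHf|s e IHe] /=.
- by rewrite /peval big_seq1 /meval /= big_nil big_seq1 scale1r.
- by rewrite /peval big_nil.
- by rewrite /peval big_seq1 /meval !big_nil scale1r.
- by rewrite peval_add IHe IHf.
- by rewrite peval_mul IHe IHf.
- by rewrite peval_mul IHe snormP -scalerAl mul1r.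
Qed.

Lemma nc2_correct e f : nilp (nnorm (NAdd e f)) -> neval e = neval f.
Proof.
move/nilP=> ef0; have := nnormP (NAdd e f); rewrite ef0 /peval big_nil /= => ef.
by apply: (addIr (neval f)); rewrite -ef addxx.
Qed.

End Reflection.

Lemma sc2_correct (F : fieldType) (char2 : 2%N \in [pchar F]) (sv : seq F) s t :
  nilp (snorm (SAdd s t)) -> seval sv s = seval sv t.
Proof.
move/nilP=> st0; have := @snormP F F^o char2 sv [::] (SAdd s t).
rewrite st0 /peval big_nil /= => /eqP.
rewrite eq_sym scaler_eq0 oner_eq0 orbF addr_eq0 => /eqP->.
by rewrite (oppr_pchar2 char2).
Qed.

(** * Reification of identities in characteristic two *)

Ltac list_add x l :=
  match l with
  | context [cons x _] => l
  | _ => constr:(cons x l)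
  end.

Ltac list_index x l :=
  match l with
  | cons x _ => constr:(O)
  | cons _ ?l' => let n := list_index x l' in constr:(S n)
  end.

Ltac satoms s l :=
  lazymatch s with
  | GRing.add ?a ?b => let l := satoms a l in satoms b l
  | GRing.mul ?a ?b => let l := satoms a l in satoms b l
  | @GRing.zero _ => l
  | @GRing.one _ => l
  | _ => list_add s l
  end.

Ltac natoms e l :=
  lazymatch e with
  | GRing.add ?a ?b => let l := natoms a l in natoms b l
  | GRing.mul ?a ?b => let l := natoms a l in natoms b l
  | @GRing.zero _ => l
  | @GRing.one _ => l
  | GRing.scale _ ?a => natoms a l
  | _ => list_add e l
  end.

Ltac scalars e l :=
  lazymatch e with
  | GRing.add ?a ?b => let l := scalars a l in scalars b l
  | GRing.mul ?a ?b => let l := scalars a l in scalars b l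
  | GRing.scale ?s ?a => let l := scalars a l in satoms s l
  | _ => l
  end.

Ltac sreify s l :=
  lazymatch s with
  | GRing.add ?a ?b => let x := sreify a l in let y := sreify b l in constr:(SAdd x y)
  | GRing.mul ?a ?b => let x := sreify a l in let y := sreify b l in constr:(SMul x y)
  | @GRing.zero _ => constr:(S0)
  | @GRing.one _ => constr:(S1)
  | _ => let n := list_index s l in constr:(SVar n)
  end.

Ltac nreify e sl l :=
  lazymatch e with
  | GRing.add ?a ?b => let x := nreify a sl l in let y := nreify b sl l in constr:(NAdd x y)
  | GRing.mul ?a ?b => let x := nreify a sl l in let y := nreify b sl l in constr:(NMul x y)
  | @GRing.zero _ => constr:(N0)
  | @GRing.one _ => constr:(N1)
  | GRing.scale ?s ?a => let x := sreify s sl in let y := nreify a sl l in constr:(NScale x y)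
  | _ => let n := list_index e l in constr:(NVar n)
  end.

Ltac nc2 :=
  match goal with
  | char2 : is_true (2%N \in GRing.pchar ?R) |- @eq ?T ?x ?y =>
    let S := constr:(GRing.PzSemiRing.sort R) in
    let sl := scalars x (@nil S) in let sl := scalars y sl in
    let al := natoms x (@nil T) in let al := natoms y al in
    let ex := nreify x sl al in let ey := nreify y sl al in
    exact (@nc2_correct _ _ char2 sl al ex ey isT)
  end.

Ltac sc2 :=
  match goal with
  | char2 : is_true (2%N \in GRing.pchar ?R) |- @eq ?T ?x ?y =>
    let S := constr:(GRing.PzSemiRing.sort R) in
    let sl := satoms x (@nil S) in let sl := satoms y sl in
    let ex := sreify x sl in let ey := sreify y sl in
    exact (@sc2_correct _ char2 sl ex ey isT)
  end.

Section LinearCombination.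
Variable R : nzRingType.

Lemma eq_comb (x y p q : R) : p = q -> x + p = y + q -> x = y.
Proof. by move=> ->; apply: addIr. Qed.

(** With [eqL], [eqR] and [eqD] this builds two-sided linear combinations of known equations. Such a
    combination is the certificate given to [nc2_by], which leaves a formal polynomial identity to
    check. *)
Lemma eqM (l p q r : R) : p = q -> l * p * r = l * q * r. Proof. by move=> ->. Qed.
Lemma eqL (l p q : R) : p = q -> l * p = l * q. Proof. by move=> ->. Qed.
Lemma eqR (r p q : R) : p = q -> p * r = q * r. Proof. by move=> ->. Qed.
Lemma eqD (p q p' q' : R) : p = q -> p' = q' -> p + p' = q + q'.
Proof. by move=> -> ->. Qed.
End LinearCombination.

(* Proves x = y when x + y is the sum of the two sides of the equation h. *)
Ltac nc2_by h := apply: (eq_comb h); nc2.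

(** * Families of commuting quaternion generators *)

Section Generators.
Variables (F : fieldType) (A : algType F).

Definition comm (x y : A) := x * y = y * x.

Definition qpair (p : A * A) :=
  [/\ exists2 b : F, b != 0 & p.1 * p.1 = b%:A,
      exists a : F, p.2 * p.2 = p.2 + a%:A &
      p.2 * p.1 = p.1 * p.2 + p.1].

Definition cpair (p q : A * A) :=
  [/\ comm p.1 q.1, comm p.1 q.2, comm p.2 q.1 & comm p.2 q.2].

Fixpoint good (ps : seq (A * A)) : Prop :=
  if ps is p :: ps' then
    [/\ qpair p, forall q : A * A, q \in ps' -> cpair p q & good ps']
  else True.

(* When ps is good, this is the subalgebra generated by ps, in normal form. *)
Fixpoint gen (ps : seq (A * A)) (x : A) : Prop :=
  if ps is p :: ps' then
    exists x0 x1 x2 x3, [/\ gen ps' x0, gen ps' x1, gen ps' x2, gen ps' x3 &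
      x = x0 + x1 * p.1 + x2 * p.2 + x3 * (p.1 * p.2)]
  else exists c : F, x = c%:A.

(** For commuting [us] with scalar squares this is the subalgebra F[us]; for the first components of
    a good family it is the algebra Phi. *)
Fixpoint phi (us : seq A) (x : A) : Prop :=
  if us is u :: us' then
    exists x0 x1, [/\ phi us' x0, phi us' x1 & x = x0 + u * x1]
  else exists c : F, x = c%:A.

Lemma comm0 x : comm x 0. Proof. by rewrite /comm mulr0 mul0r. Qed.
Lemma comm1 x : comm x 1. Proof. by rewrite /comm mulr1 mul1r. Qed.
Lemma commD x y z : comm x y -> comm x z -> comm x (y + z).
Proof. by rewrite /comm => xy xz; rewrite mulrDl mulrDr xy xz. Qed.
Lemma commM x y z : comm x y -> comm x z -> comm x (y * z).
Proof. by rewrite /comm => xy xz; rewrite mulrA xy -mulrA xz mulrA. Qed.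
Lemma commZ c x y : comm x y -> comm x (c *: y).
Proof. by rewrite /comm => xy; rewrite -scalerAl -scalerAr xy. Qed.
Lemma commA c x : comm x c%:A. Proof. by apply/commZ/comm1. Qed.
Lemma commS x y : comm x y -> comm y x. Proof. exact: esym. Qed.

Lemma gen_comm ps x y :
  (forall p : A * A, p \in ps -> comm y p.1 /\ comm y p.2) -> gen ps x -> comm y x.
Proof.
elim: ps x => [|p ps IH] x cy /=; first by case=> c ->; apply: commA.
case=> [x0 [x1 [x2 [x3 [g0 g1 g2 g3 ->]]]]].
have [cp1 cp2] := cy p (mem_head _ _).
have cps x' : gen ps x' -> comm y x'.
  by apply: IH => q qs; apply: cy; rewrite in_cons qs orbT.
by do 3?[apply: commD]; rewrite ?cps //; do ?apply: commM; rewrite ?cps //; apply: cps.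
Qed.

Lemma phi_comm us x y : (forall u, u \in us -> comm y u) -> phi us x -> comm y x.
Proof.
elim: us x => [|u us IH] x cy /=; first by case=> c ->; apply: commA.
case=> [x0 [x1 [p0 p1 ->]]].
have cus x' : phi us x' -> comm y x'.
  by apply: IH => v vs; apply: cy; rewrite in_cons vs orbT.
apply: commD; first exact: cus.
by apply: commM; [apply: cy; rewrite mem_head | apply: cus].
Qed.

Lemma genD ps x y : gen ps x -> gen ps y -> gen ps (x + y).
Proof.
elim: ps x y => [|p ps IH] x y /=.
  by case=> c -> [d ->]; exists (c + d); rewrite scalerDl.
case=> [x0 [x1 [x2 [x3 [g0 g1 g2 g3 ->]]]]] [y0 [y1 [y2 [y3 [h0 h1 h2 h3 ->]]]]].
exists (x0 + y0), (x1 + y1), (x2 + y2), (x3 + y3); split; try exact: IH.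
rewrite !mulrDl [LHS]addrACA; congr (_ + _); rewrite [LHS]addrACA.
by congr (_ + _); rewrite [LHS]addrACA.
Qed.

Lemma genZ ps c x : gen ps x -> gen ps (c *: x).
Proof.
elim: ps x => [|p ps IH] x /=; first by case=> d ->; exists (c * d); rewrite scalerA.
case=> [x0 [x1 [x2 [x3 [g0 g1 g2 g3 ->]]]]].
exists (c *: x0), (c *: x1), (c *: x2), (c *: x3); split; try exact: IH.
by rewrite !scalerDr -!scalerAl.
Qed.

Lemma gen_scalar ps c : gen ps c%:A.
Proof.
elim: ps c => [|p ps IH] c /=; first by exists c.
have g0 : gen ps 0 by rewrite -[0](scale0r 1); apply: IH.
by exists c%:A, 0, 0, 0; split=> //; rewrite !mul0r !addr0.
Qed.

Lemma gen0 ps : gen ps 0.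
Proof. by rewrite -[0](scale0r 1); apply: gen_scalar. Qed.

Lemma phi_scalar us c : phi us c%:A.
Proof.
elim: us c => [|u us IH] c /=; first by exists c.
by exists c%:A, (0%:A); split=> //; rewrite scale0r mulr0 addr0.
Qed.

Lemma phi0 us : phi us 0.
Proof. by rewrite -[0](scale0r 1); apply: phi_scalar. Qed.

Lemma phiD us x y : phi us x -> phi us y -> phi us (x + y).
Proof.
elim: us x y => [|u us IH] x y /=.
  by case=> c -> [d ->]; exists (c + d); rewrite scalerDl.
case=> [x0 [x1 [p0 p1 ->]]] [y0 [y1 [q0 q1 ->]]].
by exists (x0 + y0), (x1 + y1); split; [exact: IH..|rewrite addrACA -mulrDr].
Qed.

Lemma phiZ us c x : phi us x -> phi us (c *: x).
Proof.
elim: us x => [|u us IH] x /=; first by case=> d ->; exists (c * d); rewrite scalerA.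
case=> [x0 [x1 [p0 p1 ->]]].
by exists (c *: x0), (c *: x1); split; [exact: IH..|rewrite scalerDr scalerAr].
Qed.

Lemma phi_cons us u x : phi us x -> phi (u :: us) x.
Proof. by move=> px; exists x, 0; split=> //; [apply: phi0|rewrite mulr0 addr0]. Qed.

Lemma phi_mem us u : u \in us -> phi us u.
Proof.
elim: us => [|v us IH] //; rewrite in_cons => /orP[/eqP->|/IH]; last exact: phi_cons.
exists 0, (1%:A); split; [exact: phi0|exact: phi_scalar|].
by rewrite scale1r mulr1 add0r.
Qed.

Lemma phi_gen ps x :
  good ps -> phi (map fst ps) x -> gen ps x.
Proof.
elim: ps x => [|p ps IH] x //= [_ cp gps] [x0 [x1 [p0 p1 ->]]].
have [g0 g1] := (IH _ gps p0, IH _ gps p1).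
exists x0, x1, 0, 0; split=> //; try exact: gen0.
rewrite !mul0r !addr0; congr (_ + _); apply: gen_comm g1 => q /cp.
by case.
Qed.

Hypothesis char2 : 2%N \in [pchar F].

(** Bracketing with u kills 1 and u and sends w to u and uw to b, which leaves x2 u + b x3 = 0;
    bracketing this with w isolates x2 u. Since u^2 = b is nonzero, u can be cancelled. Thus 1, u,
    w, uw are independent over the centralizer of the pair. *)
Lemma quat_free (p : A * A) x0 x1 x2 x3 : qpair p ->
  comm x0 p.1 -> comm x1 p.1 -> comm x2 p.1 -> comm x3 p.1 ->
  comm x0 p.2 -> comm x1 p.2 -> comm x2 p.2 -> comm x3 p.2 ->
  x0 + x1 * p.1 + x2 * p.2 + x3 * (p.1 * p.2) = 0 ->
  [/\ x0 = 0, x1 = 0, x2 = 0 & x3 = 0].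
Proof.
case: p => u w [[b /= b0 hb] [a hw] hwu] c0 c1 c2 c3 d0 d1 d2 d3 e.
have e1 : x2 * u + b *: x3 = 0.
  nc2_by (eqD (eqD (eqD (eqD (eqR u e) (eqL u e)) (eqD c0 (eqR u c1)))
           (eqD (eqR w c2) (eqR (u * w) c3)))
           (eqD (eqD (eqL x2 hwu) (eqL (x3 * u) hwu)) (eqL x3 hb))).
have e2 : x2 * u = 0.
  nc2_by (eqD (eqD (eqD (eqR w e1) (eqL w e1)) (eqR u d2))
            (eqD (eqL b%:A d3) (eqL x2 hwu))).
have x20 : x2 = 0.
  have /eqP : b *: x2 = 0 by nc2_by (eqD (eqR u e2) (eqL x2 hb)).
  by rewrite scaler_eq0 (negPf b0) => /eqP.
have x30 : x3 = 0.
  by move/eqP: e1; rewrite e2 add0r scaler_eq0 (negPf b0) => /eqP.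
move: e; rewrite x20 x30 !mul0r !addr0 => e.
have e3 : x1 * u = 0.
  nc2_by (eqD (eqD (eqD (eqR w e) (eqL w e)) (eqD d0 (eqR u d1))) (eqL x1 hwu)).
have x10 : x1 = 0.
  have /eqP : b *: x1 = 0 by nc2_by (eqD (eqR u e3) (eqL x1 hb)).
  by rewrite scaler_eq0 (negPf b0) => /eqP.
by move: e; rewrite x10 mul0r addr0.
Qed.

Lemma gen_mulr ps x : good ps -> gen ps x ->
  forall p : A * A, p \in ps -> gen ps (x * p.2).
Proof.
elim: ps x => [|p ps IH] x //= [[[b b0 hb] [a ha] hwu] cp gps].
case=> [x0 [x1 [x2 [x3 [g0 g1 g2 g3 ->]]]]] q; rewrite in_cons.
case/orP=> [/eqP->|qs].
  exists (a *: x2), (a *: x3), (x0 + x2), (x1 + x3).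
  split; try exact: genZ; try exact: genD.
  by nc2_by (eqD (eqL x2 ha) (eqL (x3 * p.1) ha)).
exists (x0 * q.2), (x1 * q.2), (x2 * q.2), (x3 * q.2).
split; try exact: IH.
have [_ c12 _ c22] := cp q qs.
by nc2_by (eqD (eqD (eqL x1 c12) (eqL x2 c22))
   (eqD (eqL (x3 * p.1) c22) (eqM x3 p.2 c12))).
Qed.

(* With d = [p.1, -] p.1^-1, which maps p.2 to 1 and kills C(p.1), every x is
   (x - d(x) p.2) + d(x) p.2 with both coefficients in C(p.1).  So a property of
   the elements of N needs to be checked only on those that commute with all
   p.1. *)
Lemma gen_reduce ps (N Z : A -> Prop) : good ps ->
  (forall x y, N x -> N y -> N (x + y)) ->
  (forall c x, N x -> N (c *: x)) ->
  (forall (p : A * A) x, p \in ps -> N x -> [/\ N (p.1 * x), N (x * p.1) & N (x * p.2)]) ->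
  (forall x y, Z x -> Z y -> Z (x + y)) ->
  (forall c x, Z x -> Z (c *: x)) ->
  (forall (p : A * A) x, p \in ps -> Z x -> Z (x * p.2)) ->
  (forall x, N x -> (forall p : A * A, p \in ps -> comm x p.1) -> Z x) ->
  forall x, N x -> Z x.
Proof.
elim: ps N => [|p ps IH] N.
  by move=> _ _ _ _ _ _ _ NZ x Nx; apply: NZ.
move=> [[[b b0 hb] [a ha] hwu] cp gps] ND NZs NM ZD ZZ ZM NZ.
have ps_in q : q \in ps -> q \in p :: ps by rewrite in_cons => ->; rewrite orbT.
have NZ' x : N x -> comm x p.1 -> Z x.
  move=> Nx cx; apply: (IH (fun x => N x /\ comm x p.1)) => //.
  - move=> y z [Ny cy] [Nz cz]; split; first exact: ND.
    by apply: commS; apply: commD; apply: commS.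
  - by move=> c y [Ny cy]; split; [apply: NZs|apply: commS; apply: commZ; apply: commS].
  - move=> q y qs [Ny cy]; have [c1 c2 _ _] := cp q qs.
    have [N1 N2 N3] := NM q y (ps_in _ qs) Ny.
    by split; split=> //; apply: commS; apply: commM=> //; apply: commS.
  - by move=> q y /ps_in; apply: ZM.
  - move=> y [Ny cy] cys; apply: NZ => // q; rewrite in_cons => /orP[/eqP-> //|].
    exact: cys.
move=> x Nx; have [N1 N2 _] := NM p x (mem_head _ _) Nx.
pose x1 := p.1 * x * p.1 + b *: x.
have Nx1 : N x1.
  by apply: ND; [have [_ ? _] := NM p _ (mem_head _ _) N1|apply: NZs].
have cx1 : comm x1 p.1.
  by rewrite /comm /x1; nc2_by (eqD (eqL (p.1 * x) hb) (eqR (x * p.1) hb)).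
have [_ _ Nx1w] := NM p _ (mem_head _ _) Nx1.
have Nx0 : N (b *: x + x1 * p.2) by apply: ND => //; apply: NZs.
have cx0 : comm (b *: x + x1 * p.2) p.1.
  have h : x1 * p.1 = b *: (p.1 * x) + b *: (x * p.1).
    by rewrite /x1; nc2_by (eqL (p.1 * x) hb).
  by rewrite /comm; nc2_by (eqD (eqD (eqL x1 hwu) (eqR p.2 cx1)) h).
suff: Z (b *: x) by move/(ZZ b^-1); rewrite scalerA mulVf // scale1r.
have -> : b *: x = (b *: x + x1 * p.2) + x1 * p.2 by nc2.
by apply: ZD; [apply: NZ'|apply: ZM; [exact: mem_head|apply: NZ']].
Qed.

(** Phi is its own centralizer. The bracket of x with u is b x3 + x2 u, so [quat_free] removes the
    terms in w and uw; brackets with the remaining [q.1] act on x0 and x1 separately, again by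
    [quat_free], and the induction applies to both. *)
Lemma cent_phi ps x : good ps -> gen ps x ->
  (forall p : A * A, p \in ps -> comm x p.1) -> phi (map fst ps) x.
Proof.
elim: ps x => [|p ps IH] x //= [qp cp gps].
case=> [x0 [x1 [x2 [x3 [g0 g1 g2 g3 ->]]]]] cx.
have cu y : gen ps y -> comm y p.1.
  by move=> gy; apply: commS; apply: gen_comm gy => q /cp[].
have cw y : gen ps y -> comm y p.2.
  by move=> gy; apply: commS; apply: gen_comm gy => q /cp[].
have [[b b0 hb] [a ha] hwu] := qp.
have [b30 x20 _ _] : [/\ b *: x3 = 0, x2 = 0, 0 = 0 :> A & 0 = 0 :> A].
  apply: (quat_free qp); try exact/commS/comm0; try exact: cu; try exact: cw.
  - by apply/commS/commZ/commS/cu.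
  - by apply/commS/commZ/commS/cw.
  - have := cx p (mem_head _ _); rewrite /comm => h.
    rewrite !mul0r !addr0.
    by nc2_by (eqD (eqD (eqD h (eqD (cu _ g0) (eqR p.1 (cu _ g1))))
       (eqD (eqR p.2 (cu _ g2)) (eqR (p.1 * p.2) (cu _ g3))))
       (eqD (eqD (eqL x2 hwu) (eqL (x3 * p.1) hwu)) (eqL x3 hb))).
have x30 : x3 = 0 by move/eqP: b30; rewrite scaler_eq0 (negPf b0) => /eqP.
move: cx; rewrite x20 x30 !mul0r !addr0 => cx.
have cx01 (q : A * A) : q \in ps -> comm x0 q.1 /\ comm x1 q.1.
  move=> qs; have [c11 c12 c21 c22] := cp q qs.
  have h := cx q (mem_behead (s := p :: ps) qs); rewrite /comm in h.
  have cq y : gen ps y -> comm p.1 (y * q.1 + q.1 * y).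
    by move=> gy; apply: commD; apply: commM => //; apply/commS/cu.
  have cq' y : gen ps y -> comm p.2 (y * q.1 + q.1 * y).
    by move=> gy; apply: commD; apply: commM => //; apply/commS/cw.
  have [y0 y1 _ _] : [/\ x0 * q.1 + q.1 * x0 = 0, x1 * q.1 + q.1 * x1 = 0,
      0 = 0 :> A & 0 = 0 :> A].
    apply: (quat_free qp); try exact/commS/comm0; try exact/commS/cq;
      try exact/commS/cq'.
    by rewrite !mul0r !addr0; nc2_by (eqD h (eqL x1 c11)).
  by split; rewrite /comm; [nc2_by y0|nc2_by y1].
exists x0, x1; split; [apply: IH => // q /cx01[]//..|].
by rewrite (cu _ g1).
Qed.

(** This is [gen_reduce] with N the whole algebra: a good family generates A as soon as it generates
    the centralizer of its first components. *)
Lemma gen_full_mul ps : good ps ->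
  (forall x, (forall p : A * A, p \in ps -> comm x p.1) -> gen ps x) -> forall x, gen ps x.
Proof.
move=> gps cg x; apply: (@gen_reduce ps (fun=> True) (gen ps)) => //.
- exact: genD.
- by move=> c y; apply: genZ.
- by move=> p y pps gy; apply: gen_mulr.
- by move=> y _; apply: cg.
Qed.

End Generators.

Section SemilinearMap.
Variables (F K : fieldType) (iota : {rmorphism F -> K}).
Variables (A : algType F) (B : algType K) (f : A -> B).

Definition semihom :=
  [/\ forall x y, f (x + y) = f x + f y, forall x y, f (x * y) = f x * f y,
      f 1 = 1 & forall c x, f (c *: x) = iota c *: f x].

Hypothesis hf : semihom.

Definition map_pair (p : A * A) : B * B := (f p.1, f p.2).

Lemma good_map ps : good ps -> good (map map_pair ps).
Proof.
have [fD fM f1 fZ] := hf.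
elim: ps => [|p ps IH] //= [[[b b0 hb] [a ha] hwu] cp gps]; split.
- split=> /=; first by exists (iota b); rewrite ?fmorph_eq0 // -fM hb fZ f1.
    by exists (iota a); rewrite -fM ha fD fZ f1.
  by rewrite -!fM hwu fD.
- move=> q /mapP[q' /cp[c1 c2 c3 c4] ->].
  by split; rewrite /comm /= -!fM ?c1 ?c2 ?c3 ?c4.
- exact: IH.
Qed.

Lemma gen_map ps x : gen ps x -> gen (map map_pair ps) (f x).
Proof.
have [fD fM f1 fZ] := hf.
elim: ps x => [|p ps IH] x /=; first by case=> c ->; exists (iota c); rewrite fZ f1.
case=> [x0 [x1 [x2 [x3 [g0 g1 g2 g3 ->]]]]].
exists (f x0), (f x1), (f x2), (f x3); split; try exact: IH.
by rewrite !fD !fM.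
Qed.

End SemilinearMap.

(** * Quaternion algebras in characteristic two *)

Lemma ltv_dimv (F : fieldType) (V : vectType F) (U : {vspace V}) x :
  x \notin U -> (\dim U < \dim (U + <[x]>))%N.
Proof.
move=> xU; rewrite ltn_neqAle (dimvS (addvSl _ _)) andbT.
rewrite (dimv_leqif_sup (addvSl U <[x]>)); apply: contra xU => /subvP; apply.
by apply: (subvP (addvSr U <[x]>)); apply: memv_line.
Qed.

(** Vectors satisfying P are added to a subspace until none is left outside it; n bounds the
    codimension, hence the number of steps. *)
Lemma vspace_of_pred (F : fieldType) (V : vectType F) (P : V -> Prop) :
  P 0 -> (forall x y, P x -> P y -> P (x + y)) -> (forall c x, P x -> P (c *: x)) ->
  exists U : {vspace V}, forall x, x \in U <-> P x.
Proof.
move=> P0 PD PZ.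
have grow n (U : {vspace V}) : (\dim {:V} <= \dim U + n)%N -> (forall x, x \in U -> P x) ->
    exists W : {vspace V}, forall x, x \in W <-> P x.
  elim: n U => [|n IH] U dU UP.
    exists U => x; split; first exact: UP.
    have -> : U = fullv by apply/eqP; rewrite eqEdim subvf -[X in (_ <= X)%N]addn0.
    by rewrite memvf.
  case: (classic (exists x, P x /\ x \notin U)) => [[x [Px xU]]|nx].
    apply: (IH (U + <[x]>)%VS) => [|y /memv_addP[u uU [v /vlineP[c ->] ->]]].
      by apply: leq_trans dU _; rewrite -addSnnS leq_add2r ltv_dimv.
    by apply: PD; [apply: UP|apply: PZ].
  exists U => x; split; first exact: UP.
  by move=> Px; apply/negPn/negP => xU; case: nx; exists x.
apply: (grow (\dim {:V}) 0%VS); first by rewrite dimv0.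
by move=> x; rewrite memv0 => /eqP->.
Qed.

Section CentralSimple.
Variables (F : fieldType) (A : falgType F).
Hypothesis csa : central_simple A.

Lemma csa_ideal (P : A -> Prop) x :
  (forall y z, P y -> P z -> P (y + z)) ->
  (forall y z, P y -> P (z * y) /\ P (y * z)) -> P x -> x != 0 -> P 1.
Proof.
move=> PD PM Px x0.
have P0 : P 0 by have [] := PM x 0 Px; rewrite mul0r.
have PZ c y : P y -> P (c *: y).
  by move=> Py; have [] := PM y c%:A Py; rewrite -scalerAl mul1r.
have [U UP] := vspace_of_pred P0 PD PZ.
have [|U0|UT] := csa.2 U.
- by move=> z y /UP /(PM _ z)[h1 h2]; split; apply/UP.
- by move/UP: Px; rewrite U0 memv0 (negPf x0).
- by apply/UP; rewrite UT memvf.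
Qed.

Hypothesis char2 : 2%N \in [pchar F].

(* A u is a two-sided ideal that u annihilates. *)
Lemma csa_no_nilpotent_normal (u : A) : u != 0 -> u * u = 0 ->
  ~ (forall x, exists g : F, u * x + x * u = g *: u).
Proof.
move=> u0 uu un.
have [q q1] : exists q, 1 = q * u.
  apply: (@csa_ideal (fun z => exists q, z = q * u) u) => //.
  - by move=> _ _ [y ->] [z ->]; exists (y + z); rewrite mulrDl.
  - move=> _ z [y ->]; split; first by exists (z * y); rewrite mulrA.
    by have [g hg] := un z; exists (y * z + g *: y); nc2_by (eqL y hg).
  - by exists 1; rewrite mul1r.
by move/eqP: u0; apply; rewrite -[u]mul1r q1 -mulrA uu mulr0.
Qed.

Hypothesis dimA : has_degree A 2.

Lemma quat_noncomm : ~ (forall x y : A, x * y = y * x).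
Proof.
move=> c; have : (\dim {:A} <= \dim <[1 : A]>)%N.
  apply/dimvS/subvP => x _; have [a ->] := csa.1 x (c x).
  by apply/vlineP; exists a.
by rewrite dimA dim_vline oner_eq0.
Qed.

(** Otherwise U = F + Fx + Fx^2 is a commutative hyperplane, stable under left multiplication by x.
    This multiplication acts on the line A/U by a scalar l, so p = x + l satisfies pA inside U, and
    elements of pA commute. It follows that pA annihilates every sp + ps; by simplicity p is
    central, and x is a scalar. *)
Lemma quat_quadratic (x : A) : exists t n : F, x * x = t *: x + n%:A.
Proof.
apply: NNPP => nq.
have x1 : x \notin <[1]>%VS.
  by apply/negP => /vlineP[c xc]; case: nq; exists c, 0; rewrite xc; nc2.
have x2 : x * x \notin (<[1]> + <[x]>)%VS.
  apply/negP => /memv_addP[_ /vlineP[n ->] [_ /vlineP[t ->] xx]].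
  by case: nq; exists t, n; rewrite xx addrC.
set U := (<[1]> + <[x]> + <[x * x]>)%VS.
have UP z : z \in U <-> exists a b c, z = c%:A + b *: x + a *: (x * x).
  split=> [/memv_addP[_ /memv_addP[_ /vlineP[c ->] [_ /vlineP[b ->] ->]]
           [_ /vlineP[a ->] ->]]|[a [b [c ->]]]]; first by exists a, b, c.
  by do !apply: memv_add; apply: memvZ; apply: memv_line.
have dU : (3 <= \dim U)%N.
  apply: leq_ltn_trans (ltv_dimv x2); apply: leq_ltn_trans (ltv_dimv x1).
  by rewrite dim_vline oner_eq0.
have full y : y \notin U -> forall q, exists2 u, u \in U & exists l, q = u + l *: y.
  move=> yU q; have /memv_addP[u uU [_ /vlineP[l ->] ->]] : q \in (U + <[y]>)%VS.
    suff -> : (U + <[y]>)%VS = fullv by rewrite memvf.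
    apply/eqP; rewrite eqEdim subvf dimA.
    by apply: leq_ltn_trans dU (ltv_dimv yU).
  by exists u => //; exists l.
have Uc z z' : comm z x -> z' \in U -> comm z z'.
  move=> zx /UP[a [b [c ->]]].
  by do ?apply: commD; [apply: commA|apply: commZ|apply/commZ/commM].
have UU z z' : z \in U -> z' \in U -> comm z z'.
  by move=> zU; apply: (Uc); apply: commS; apply: Uc.
(* If y outside U commuted with x, then x would be central in A = U + Fy, and A would be generated
   by x and y, hence commutative. *)
have nfull y : y \notin U -> ~ comm x y.
  move=> yU cy; apply: quat_noncomm => q r.
  have cx z : comm z x.
    have [u uU [l ->]] := full y yU z; apply/commS/commD; first exact: Uc.
    exact: commZ.
  have [u uU [l ->]] := full y yU r.
  apply: commD; first exact: Uc.
  apply: commZ; have [v vU [m ->]] := full y yU q.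
  apply/commS/commD; last by apply: commZ.
  exact: Uc.
have xxxU : x * (x * x) \in U.
  by apply/negPn/negP => /nfull; apply; rewrite /comm !mulrA.
have xU z : z \in U -> x * z \in U.
  move=> /UP[a [b [c ->]]]; rewrite !mulrDr -!scalerAr mulr1.
  by do 2?[apply: memvD]; apply: memvZ => //; apply/UP; [exists 0, 1, 0|exists 1, 0, 0]; nc2.
have [y yU] : exists y, y \notin U.
  apply: NNPP => ny; apply: quat_noncomm => q r.
  by apply: UU; apply/negPn/negP => nU; apply: ny; [exists q|exists r].
have [u uU [l xy]] := full y yU (x * y).
pose p := x + l%:A; have pE : p = x + l%:A by [].
have pU q : p * q \in U.
  have [v vU [m ->]] := full y yU q.
  have -> : p * (v + m *: y) = x * v + l *: v + m *: u.
    by rewrite /p; nc2_by (eqL m%:A xy).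
  by do ?apply: memvD; rewrite ?memvZ ?xU.
have p0 : p <> 0.
  move=> p0; case/negP: x1; apply/vlineP; exists l.
  by nc2_by (eqD p0 pE).
(* The elements z with pAz = 0 form a two-sided ideal; if it is nonzero it contains 1, and then p =
   0. *)
have Pz z : (forall r, p * r * z = 0) -> z = 0.
  move=> Pz; apply/eqP/negPn/negP => z0; apply: p0.
  rewrite -[p]mulr1 -[p * 1]mulr1.
  apply: (@csa_ideal (fun z => forall r, p * r * z = 0) z) => //.
    by move=> s t s0 t0 r; rewrite mulrDr s0 t0 addr0.
  by move=> s t s0; split=> r; rewrite mulrA -?[p * r * t]mulrA ?s0 ?mul0r.
have [s|a pa] := csa.1 p.
  suff : s * (p * 1) + (p * 1) * s = 0 by rewrite mulr1 => h; nc2_by h.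
  apply: Pz => r.
  have h1 := UU _ _ (pU (r * s)) (pU 1); have h2 := UU _ _ (pU r) (pU 1).
  by nc2_by (eqD h1 (eqR s h2)).
case/negP: x1; apply/vlineP; exists (a + l).
by nc2_by (eqD pa pE).
Qed.

Lemma csa_noncentral (x : A) : (forall c, x <> c%:A) -> exists y, x * y + y * x <> 0.
Proof.
move=> xc; apply: NNPP => ny.
have [y|c /xc] := csa.1 x; last by [].
have /NNPP h : ~ (x * y + y * x <> 0) by move=> h; apply: ny; exists y.
by nc2_by h.
Qed.

(** By rescaling a relation x^2 = tx + n with t nonzero, failure would make every square a scalar.
    By polarization xy + yx is then a scalar c, and the same for x and xy makes cx a scalar; if c is
    nonzero, x itself is a scalar and commutes with y. *)
Lemma quat_separable : exists w : A,
  (forall c, w <> c%:A) /\ exists a : F, w * w = w + a%:A.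
Proof.
apply: NNPP => nw.
have sq (x : A) : exists c : F, x * x = c%:A.
  case: (classic (exists c, x = c%:A)) => [[c ->]|nx].
    by exists (c * c); nc2.
  have [t [n h]] := quat_quadratic x.
  have [t0|t0] := eqVneq t 0; first by exists n; rewrite h t0 scale0r add0r.
  case: nw; exists (t^-1 *: x); split.
    move=> c xc; apply: nx; exists (t * c).
    by rewrite -[x]scale1r -(divff t0) -scalerA xc scalerA.
  exists (t^-1 * t^-1 * n); rewrite -scalerAl -scalerAr h scalerDr.
  by rewrite !scalerDr !scalerA mulfVK.
apply: quat_noncomm => x y; apply: NNPP => xy.
have [c hc] : exists c : F, x * y + y * x = c%:A.
  have [[[a ha] [b hb]] [d hd]] := (sq x, sq y, sq (x + y)).
  by exists (d + a + b); nc2_by (eqD hd (eqD ha hb)).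
have c0 : c != 0.
  apply/eqP => c0; apply: xy; move: hc; rewrite c0 scale0r => hc; nc2_by hc.
have [d hd] : exists d : F, x * (x * y) + (x * y) * x = d%:A.
  have [[[a ha] [b hb]] [e he]] := (sq x, sq (x * y), sq (x + x * y)).
  by exists (e + a + b); nc2_by (eqD he (eqD ha hb)).
apply: xy; have xd : x = (c^-1 * d)%:A.
  have cx : c *: x = d%:A by nc2_by (eqD hd (eqL x hc)).
  by rewrite -scalerA -cx scalerA mulVf // scale1r.
by rewrite xd; nc2.
Qed.

(** Since w^2 = w + a, the derivation [w, -] is idempotent, so its image V is its fixed space.
    Elements of V have scalar squares, and one with a nonzero square completes w to a pair. If all
    these squares vanished, V would have zero multiplication and be a nonzero two-sided ideal, so
    that 1 = [w, 1] = 0. *)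
Lemma quat_pair : exists p : A * A, qpair p.
Proof.
have [w [wc [a ha]]] := quat_separable.
have [x wx] := csa_noncentral wc.
pose u := w * x + x * w.
have hu : w * u + u * w = u by rewrite /u; nc2_by (eqD (eqR x ha) (eqL x ha)).
have sq v : w * v + v * w = v -> exists n : F, v * v = n%:A.
  move=> hv; have [t [n h]] := quat_quadratic v.
  exists n; suff tv : t *: v = 0 by rewrite h tv add0r.
  by nc2_by (eqD (eqD (eqD (eqL w h) (eqR w h)) (eqD (eqR v hv) (eqL v hv)))
     (eqL t%:A hv)).
apply: NNPP => np.
have sq0 v : w * v + v * w = v -> v * v = 0.
  move=> hv; have [b hb] := sq v hv.
  have [b0|b0] := eqVneq b 0; first by rewrite hb b0 scale0r.
  case: np; exists (v, w); split; [by exists b|by exists a|by rewrite /=; nc2_by hv].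
have h1 : w * 1 + 1 * w = 1.
  apply: (@csa_ideal (fun v => w * v + v * w = v) u) => //; last exact/eqP.
    by move=> y z hy hz; nc2_by (eqD hy hz).
  have mul0 y z : w * y + y * w = y -> w * z + z * w = z -> y * z = 0.
    move=> hy hz; have hwz : w * (w * z) + (w * z) * w = w * z.
      by nc2_by (eqL w hz).
    have hyz : w * (y + z) + (y + z) * w = y + z by nc2_by (eqD hy hz).
    have hywz : w * (y + w * z) + (y + w * z) * w = y + w * z by nc2_by (eqD hy hwz).
    have e1 : y * z = z * y.
      by nc2_by (eqD (sq0 _ hyz) (eqD (sq0 _ hy) (sq0 _ hz))).
    have e2 : y * (w * z) = (w * z) * y.
      by nc2_by (eqD (sq0 _ hywz) (eqD (sq0 _ hy) (sq0 _ hwz))).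
    by nc2_by (eqD (eqD (eqR z hy) e2) (eqL w e1)).
  move=> y z hy; pose z1 := w * z + z * w.
  have hz1 : w * z1 + z1 * w = z1 by rewrite /z1; nc2_by (eqD (eqR z ha) (eqL z ha)).
  have e1 := mul0 _ _ hy hz1; have e2 := mul0 _ _ hz1 hy.
  split.
    by rewrite /z1 in e2; nc2_by (eqD e2 (eqL z hy)).
  have e3 : y * (w * z + z * w) = 0 by [].
  by nc2_by (eqD (eqR z hy) e3).
have /eqP[] := oner_neq0 A.
by rewrite -h1; nc2.
Qed.

Lemma qpair_free (p : A * A) (c0 c1 c2 c3 : F) : qpair p ->
  c0%:A + c1 *: p.1 + c2 *: p.2 + c3 *: (p.1 * p.2) = 0 ->
  [/\ c0 = 0, c1 = 0, c2 = 0 & c3 = 0].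
Proof.
move=> qp e.
have inj (c : F) : c%:A = 0 :> A -> c = 0.
  by move/eqP; rewrite scaler_eq0 oner_eq0 orbF => /eqP.
have := @quat_free F A char2 p c0%:A c1%:A c2%:A c3%:A qp.
rewrite !mulr_algl => -[]; try exact/commS/commA; try exact: e.
by move=> /inj-> /inj-> /inj-> /inj->.
Qed.

Lemma qpair_span (p : A * A) : qpair p -> forall x : A, exists c0 c1 c2 c3 : F,
  x = c0%:A + c1 *: p.1 + c2 *: p.2 + c3 *: (p.1 * p.2).
Proof.
move=> qp x.
have u1 : p.1 \notin <[1]>%VS.
  apply/negP => /vlineP[c h].
  have [|_ /eqP] := @qpair_free p c 1 0 0 qp; last by rewrite oner_eq0.
  by rewrite h; nc2.
have w1 : p.2 \notin (<[1]> + <[p.1]>)%VS.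
  apply/negP => /memv_addP[_ /vlineP[c ->] [_ /vlineP[d ->] h]].
  have [|_ _ /eqP] := @qpair_free p c d 1 0 qp; last by rewrite oner_eq0.
  by rewrite h; nc2.
have uw1 : p.1 * p.2 \notin (<[1]> + <[p.1]> + <[p.2]>)%VS.
  apply/negP => /memv_addP[z /memv_addP[_ /vlineP[c ->] [_ /vlineP[d ->] ->]]].
  case=> _ /vlineP[e ->] h.
  have [|_ _ _ /eqP] := @qpair_free p c d e 1 qp; last by rewrite oner_eq0.
  by rewrite h; nc2.
have : x \in (<[1]> + <[p.1]> + <[p.2]> + <[p.1 * p.2]>)%VS.
  suff -> : (<[1]> + <[p.1]> + <[p.2]> + <[p.1 * p.2]>)%VS = fullv by rewrite memvf.
  apply/eqP; rewrite eqEdim subvf dimA.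
  apply: leq_ltn_trans (ltv_dimv uw1); apply: leq_ltn_trans (ltv_dimv w1).
  by apply: leq_ltn_trans (ltv_dimv u1); rewrite dim_vline oner_eq0.
case/memv_addP=> y /memv_addP[z /memv_addP[_ /vlineP[c ->] [_ /vlineP[d ->] ->]]].
by case=> _ /vlineP[e ->] -> [_ /vlineP[f ->] ->]; exists c, d, e, f.
Qed.

End CentralSimple.

(** * Symmetric quaternion pairs for orthogonal involutions *)

Section Involution.
Variables (F : fieldType) (A : falgType F) (tau : A -> A).
Hypothesis inv : involution_first_kind tau.

Definition alt (x : A) := exists y, x = y + tau y.

Lemma involZ c x : tau (c *: x) = c *: tau x.
Proof.
have [_ tM _ tF] := inv.
by rewrite -mulr_algl tM tF -scalerAr mulr1.
Qed.

Lemma invol1 : tau 1 = 1.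
Proof. by have [_ _ _ tF] := inv; have := tF 1; rewrite scale1r. Qed.

Lemma invol0 : tau 0 = 0.
Proof. by have := involZ 0 0; rewrite !scale0r. Qed.

Lemma altZ c x : alt x -> alt (c *: x).
Proof. by case=> y ->; exists (c *: y); rewrite involZ scalerDr. Qed.

Lemma alt0 : alt 0.
Proof. by exists 0; rewrite invol0 addr0. Qed.

Lemma altD x y : alt x -> alt y -> alt (x + y).
Proof.
have [tD _ _ _] := inv.
by case=> s -> [t ->]; exists (s + t); rewrite tD addrACA.
Qed.

Lemma alt_scalar c : ~ alt 1 -> alt c%:A -> c = 0.
Proof.
move=> a1 ac; apply/eqP/negPn/negP => c0; apply: a1.
by rewrite -[1]scale1r -(mulVf c0) -scalerA; apply: altZ.
Qed.

Lemma alt_conj x y : alt x -> alt (tau y * x * y).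
Proof.
have [tD tM tK _] := inv; case=> z ->; exists (tau y * z * y).
by rewrite !tM tK mulrDr mulrDl mulrA.
Qed.

Hypothesis char2 : 2%N \in [pchar F].

Lemma alt_sym x : alt x -> tau x = x.
Proof. by have [tD _ tK _] := inv; case=> y ->; rewrite tD tK addrC. Qed.

Fact alt_map_linear : linear (fun x => x + tau x).
Proof.
by have [tD _ _ _] := inv => c x y; rewrite tD involZ scalerDr addrACA.
Qed.

Hypothesis csa : central_simple A.
Hypothesis dimA : has_degree A 2.
Hypothesis ort : ~ alt 1.

(** The map f = 1 + tau has f^2 = 0, so its image lies in its kernel, and properly, since 1 is in
    the kernel but not in Alt. In dimension 4 the image has dimension at most 1. It is nonzero
    because tau = id would make A commutative. *)
Lemma quat_alt_line :
  exists u, [/\ alt u, forall c, u <> c%:A & forall x, exists c, x + tau x = c *: u].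
Proof.
pose f : {linear A -> A} := HB.pack (fun x => x + tau x)
  (GRing.isLinear.Build F A A *:%R _ alt_map_linear).
have fE x : linfun f x = x + tau x by rewrite lfunE.
have altP x : reflect (alt x) (x \in limg (linfun f)).
  apply: (iffP memv_imgP) => [[y _ ->]|[y ->]]; first by exists y; rewrite fE.
  by exists y; rewrite ?memvf ?fE.
have d1 : (\dim (limg (linfun f)) <= 1)%N.
  have := limg_ker_dim (linfun f) fullv; rewrite capfv dimA.
  suff : (\dim (limg (linfun f)) < \dim (lker (linfun f)))%N by lia.
  have sub : (limg (linfun f) <= lker (linfun f))%VS.
    apply/subvP => x /altP/alt_sym tx.
    by rewrite memv_ker fE tx (addxx char2).
  rewrite ltn_neqAle (dimvS sub) andbT (dimv_leqif_sup sub).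
  apply/negP => /subvP sub'; apply: ort; apply/altP/sub'.
  by rewrite memv_ker fE invol1 (addxx char2).
have [tD tM tK _] := inv.
have [y hy] : exists y, y + tau y <> 0.
  apply: NNPP => ny.
  have tid x : tau x = x.
    apply: NNPP => tx; apply: ny; exists x => h; apply: tx.
    by nc2_by h.
  by apply: (quat_noncomm csa dimA) => x z; rewrite -[LHS]tid tM !tid.
have au : alt (y + tau y) by exists y.
exists (y + tau y); split=> //.
  move=> c uc; apply: hy; rewrite uc (@alt_scalar c) ?scale0r //.
  by rewrite -uc.
have line : limg (linfun f) = <[y + tau y]>%VS.
  apply/eqP; rewrite eq_sym eqEdim -memvE dim_vline; apply/andP; split; first exact/altP.
  by rewrite (introF eqP hy).
by move=> x; apply/vlineP; rewrite -line; apply/altP; exists x.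
Qed.

(** Let u span Alt and u^2 = al u + be. Applying x + tau(x) in Fu both to x and to ux shows that
    [u, x] lies in Fu + F. Hence [u, [u, x]] = 0, which forces al = 0, and be = 0 would make u a
    normal element of square zero. A symmetric x that does not commute with u then yields w after
    rescaling. *)
Lemma quat_fixed_pair : exists p : A * A, [/\ qpair p, tau p.1 = p.1 & tau p.2 = p.2].
Proof.
have [u [au uF ux]] := quat_alt_line.
have [tD tM tK _] := inv.
have tu := alt_sym au.
have u0 : u != 0 by apply/eqP => u0; apply: (uF 0); rewrite u0 scale0r.
have [al [be uu]] := quat_quadratic csa char2 dimA u.
have com x : exists c g, x + tau x = c *: u /\ u * x + x * u = g *: u + (c * be)%:A.
  have [c hc] := ux x; have [c' hc'] := ux (u * x).
  exists c, (c' + c * al); split=> //.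
  rewrite tM tu in hc'.
  by nc2_by (eqD (eqD hc' (eqR u hc)) (eqL c%:A uu)).
have al0 : al = 0.
  apply/eqP/negPn/negP => al0.
  have [x] := csa_noncentral csa char2 uF; apply.
  have [c [g [_ h]]] := com x.
  have /eqP : al *: (u * x + x * u) = 0.
    by nc2_by (eqD (eqD (eqD (eqL u h) (eqR u h)) (eqR x uu)) (eqL x uu)).
  by rewrite scaler_eq0 (negPf al0) => /eqP.
rewrite al0 scale0r add0r in uu.
have be0 : be != 0.
  apply/eqP => be0; rewrite be0 scale0r in uu.
  apply: (csa_no_nilpotent_normal csa char2 u0 uu) => x.
  by have [c [g [_ ->]]] := com x; exists g; rewrite be0 mulr0 scale0r addr0.
(* Otherwise [u, x] depends only on x + tau(x) = du, namely [u, x] = d(gu + be). For x = uy this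
   forces be = g^2, and u + g is a nonzero normal element of square zero. *)
have [x [tx xu]] : exists x, tau x = x /\ u * x + x * u <> 0.
  apply: NNPP => ns.
  have symC x : tau x = x -> u * x + x * u = 0.
    by move=> tx; apply: NNPP => h; apply: ns; exists x.
  have [y hy] := au.
  have [c [g [e1 e2]]] := com y.
  have c1 : c = 1.
    have /eqP : (c + 1) *: u = 0 by nc2_by (eqD e1 hy).
    rewrite scaler_eq0 (negPf u0) orbF addr_eq0 => /eqP->.
    by rewrite (oppr_pchar2 char2).
  rewrite c1 mul1r in e2.
  have gen_com x d : x + tau x = d *: u -> u * x + x * u = d *: (g *: u + be%:A).
    move=> hd; have h : u * (x + d *: y) + (x + d *: y) * u = 0.
      by apply: symC; rewrite tD involZ; nc2_by (eqD hd (eqL d%:A hy)).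
    by nc2_by (eqD h (eqL d%:A e2)).
  have [d [_ [hd _]]] := com (u * y).
  have e3 := gen_com _ _ hd.
  have e4 : (g * be + d * be)%:A + (be + d * g) *: u = 0.
    by nc2_by (eqD (eqD e3 (eqL u e2)) (eqL g%:A uu)).
  have bdg : be = d * g.
    apply/eqP; rewrite -subr_eq0 (oppr_pchar2 char2); apply/negPn/negP => k0.
    apply: (uF ((be + d * g)^-1 * (g * be + d * be))).
    rewrite -scalerA; have -> : (g * be + d * be)%:A = (be + d * g) *: u by nc2_by e4.
    by rewrite scalerA mulVf // scale1r.
  have dg : d = g.
    have k0 : be + d * g = 0 by rewrite {1}bdg (addrr_pchar2 char2).
    move: e4; rewrite k0 scale0r addr0 -mulrDl => /eqP.
    rewrite scaler_eq0 oner_eq0 orbF mulf_eq0 (negPf be0) orbF addr_eq0 => /eqP->.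
    by rewrite (oppr_pchar2 char2).
  rewrite dg in bdg.
  have v0 : u + g%:A != 0.
    by apply/eqP => h; apply: (uF g); nc2_by h.
  apply: (csa_no_nilpotent_normal csa char2 v0).
    by rewrite bdg in uu; nc2_by uu.
  move=> x; have [k hk] := ux x; exists (k * g).
  by have := gen_com _ _ hk; rewrite bdg => h; nc2_by h.
have [c [g [e1 e2]]] := com x.
have c0 : c = 0.
  have /eqP : c *: u = 0 by rewrite -e1 tx (addxx char2).
  by rewrite scaler_eq0 (negPf u0) orbF => /eqP.
rewrite c0 mul0r scale0r addr0 in e2.
have g0 : g != 0 by apply/eqP => g0; apply: xu; rewrite e2 g0 scale0r.
pose w := g^-1 *: x.
have hw : u * w + w * u = u.
  by rewrite /w -scalerAl -scalerAr -scalerDr e2 scalerA mulVf // scale1r.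
(* Bracketing w^2 = tw + n with u gives u = tu, so t = 1. *)
have [t [n ww]] := quat_quadratic csa char2 dimA w.
have t1 : t = 1.
  have /eqP : (t + 1) *: u = 0.
    by nc2_by (eqD (eqD (eqD (eqL u ww) (eqR u ww)) (eqD (eqL w hw) (eqR w hw)))
         (eqD hw (eqL t%:A hw))).
  rewrite scaler_eq0 (negPf u0) orbF addr_eq0 => /eqP->.
  by rewrite (oppr_pchar2 char2).
exists (u, w); split=> //=; last by rewrite /w involZ tx.
split=> /=; first by exists be.
  by exists n; rewrite ww t1 scale1r.
by nc2_by hw.
Qed.

End Involution.

(** * Tensor products *)

Section TensorGenerators.
Variables (F : fieldType).

Definition linear1 (A : algType F) (f : A -> A) :=
  [/\ forall x y, f (x + y) = f x + f y, forall c x, f (c *: x) = c *: f x & f 1 = 1].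

Lemma invol_linear1 (A : falgType F) (tau : A -> A) :
  involution_first_kind tau -> linear1 tau.
Proof. by move=> i; have [tD _ _ _] := i; split=> // *; rewrite ?involZ ?invol1. Qed.

Section TensMap.
Variables (A : falgType F) (B : algType F) (f : A -> A) (g : B -> B).
Hypotheses (lf : linear1 f) (lg : linear1 g).

Lemma tens_map_tpure a b : tens_map f g (tpure a b) = tpure (f a) (g b).
Proof.
have [fD fZ f1] := lf; have [gD gZ g1] := lg.
pose f' : {linear A -> A} := HB.pack f (GRing.isLinear.Build F A A *:%R f
  (fun c x y => etrans (fD _ _) (congr1 (fun z => z + _) (fZ c x)))).
pose g' : {linear B -> B} := HB.pack g (GRing.isLinear.Build F B B *:%R g
  (fun c x y => etrans (gD _ _) (congr1 (fun z => z + _) (gZ c x)))).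
exact: (tens_map_pure f' g').
Qed.

Lemma tens_map_linear1 : linear1 (tens_map f g).
Proof.
have [fD fZ f1] := lf; have [gD gZ g1] := lg.
split=> [x y|c x|]; last by rewrite [LHS]tens_map_tpure f1 g1.
  rewrite /tens_map -big_split; apply: eq_bigr => i _ /=.
  by rewrite ffunE gD tpureDr.
rewrite /tens_map scaler_sumr; apply: eq_bigr => i _ /=.
by rewrite ffunE gZ tpureZr.
Qed.

End TensMap.

Section TensHom.
Variables (A : falgType F) (B C : algType F) (f : A -> C) (g : B -> C).
Hypotheses (hf : semihom idfun f) (hg : semihom idfun g).
Hypothesis fgC : forall a b, comm (f a) (g b).

Definition tens_hom (x : tens A B) : C :=
  \sum_(i < \dim {:A}) f (vbasis {:A})`_i * g (x i).

Lemma semihom_sum (I : finType) (D : algType F) (h : D -> C) (F0 : I -> D) :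
  semihom idfun h -> h (\sum_i F0 i) = \sum_i h (F0 i).
Proof.
move=> [hD hM h1 hZ]; apply: (big_morph h hD).
by rewrite -(scale0r (1 : D)) hZ scale0r.
Qed.

Lemma tens_hom_tpure a b : tens_hom (tpure a b) = f a * g b.
Proof.
have [_ _ _ fZ] := hf; have [_ _ _ gZ] := hg.
rewrite [in RHS](coord_vbasis (memvf a)) semihom_sum // mulr_suml.
by apply: eq_bigr => i _; rewrite ffunE gZ fZ -scalerAr -scalerAl.
Qed.

Lemma tens_homD x y : tens_hom (x + y) = tens_hom x + tens_hom y.
Proof.
have [gD _ _ _] := hg.
by rewrite -big_split; apply: eq_bigr => i _; rewrite ffunE gD mulrDr.
Qed.

Lemma tens_hom_semihom : semihom idfun tens_hom.
Proof.
have [fD fM f1 fZ] := hf; have [gD gM g1 gZ] := hg.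
split=> [|x y||c x]; first exact: tens_homD.
- have tsum (I : finType) (F0 : I -> tens A B) :
      tens_hom (\sum_i F0 i) = \sum_i tens_hom (F0 i).
    apply: (big_morph _ tens_homD); rewrite /tens_hom big1 // => i _.
    by rewrite ffunE -(scale0r (1 : B)) gZ scale0r mulr0.
  rewrite {1}(tens_sum_pure x) mulr_suml tsum [in RHS]/tens_hom mulr_suml.
  apply: eq_bigr => i _; rewrite {1}(tens_sum_pure y) mulr_sumr tsum mulr_sumr.
  apply: eq_bigr => j _; rewrite tpureM tens_hom_tpure fM gM.
  by rewrite !mulrA -[f _ * f _ * g _]mulrA fgC !mulrA.
- by rewrite tens_hom_tpure f1 g1 mulr1.
- by rewrite /tens_hom scaler_sumr; apply: eq_bigr => i _; rewrite ffunE gZ -scalerAr.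
Qed.

End TensHom.

Lemma tpure_semihom (A : falgType F) (B : algType F) :
  semihom idfun (fun b => tpure 1 b : tens A B).
Proof.
split=> [x y|x y||c x]; rewrite ?tpureDr ?tpureZr //.
by rewrite tpureM mulr1.
Qed.

Lemma tpure_semihoml (A : falgType F) (B : algType F) :
  semihom idfun (fun a => tpure a 1 : tens A B).
Proof.
split=> [x y|x y||c x]; rewrite ?tpureDl ?tpureZl //.
by rewrite tpureM mulr1.
Qed.

Lemma tpure0 (A : falgType F) (B : algType F) (a : A) : tpure a 0 = 0 :> tens A B.
Proof. by apply/ffunP => i; rewrite !ffunE scaler0. Qed.

Lemma tens_quat (A : falgType F) (B : algType F) (p : A * A) (x : tens A B) :
  (forall a : A, exists c0 c1 c2 c3 : F,
     a = c0%:A + c1 *: p.1 + c2 *: p.2 + c3 *: (p.1 * p.2)) ->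
  exists y0 y1 y2 y3 : B,
    x = tpure 1 y0 + tpure p.1 y1 + tpure p.2 y2 + tpure (p.1 * p.2) y3.
Proof.
move=> sp; rewrite (tens_sum_pure x).
apply: (big_ind (fun x => exists y0 y1 y2 y3,
  x = tpure 1 y0 + tpure p.1 y1 + tpure p.2 y2 + tpure (p.1 * p.2) y3)).
- by exists 0, 0, 0, 0; rewrite !tpure0 !addr0.
- move=> _ _ [y0 [y1 [y2 [y3 ->]]]] [z0 [z1 [z2 [z3 ->]]]].
  exists (y0 + z0), (y1 + z1), (y2 + z2), (y3 + z3); rewrite !tpureDr.
  rewrite [LHS]addrACA; congr (_ + _); rewrite [LHS]addrACA.
  by congr (_ + _); rewrite [LHS]addrACA.
- move=> i _; have [c0 [c1 [c2 [c3 ->]]]] := sp (vbasis {:A})`_i.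
  exists (c0 *: x i), (c1 *: x i), (c2 *: x i), (c3 *: x i).
  by rewrite !tpureDl !tpureZl !tpureZr.
Qed.

Hypothesis char2 : 2%N \in [pchar F].

(** If 1 = y + tau(y) in one factor, the same holds for the image of y in the tensor product. So
    when 1 is not in Alt, every factor has a fixed pair by [quat_fixed_pair]. The generators are
    provided without this condition as well, because they are what will show that 1 is not in
    Alt. *)
Lemma tensor_generators (Qs : seq (quaternion_invol F)) :
  let X := quaternion_tensor Qs in let tau := @invol_of F X in
  linear1 tau /\ exists ps : seq (alg_of X * alg_of X),
    [/\ good ps, forall x, gen ps x &
        ~ alt tau 1 -> forall p : alg_of X * alg_of X, p \in ps -> tau p.1 = p.1 /\ tau p.2 = p.2].
Proof.
elim: Qs => [|Q Qs [lX [ps [gps fps sps]]]] /=.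
  split; first by split.
  by exists [::]; split=> // x; exists x; rewrite /GRing.scale /= mulr1.
set X := quaternion_tensor Qs in lX ps gps fps sps *.
have iQ := quat_invol Q; have [cQ dQ] := quat_alg Q.
set tau := @invol_of F Q in iQ *; have lQ := invol_linear1 iQ.
split; first exact: tens_map_linear1.
have [p [qp sp]] : exists p, qpair p /\
    (~ alt tau 1 -> tau p.1 = p.1 /\ tau p.2 = p.2).
  case: (classic (alt tau 1)) => a1.
    by have [p qp] := quat_pair cQ char2 dQ; exists p; split=> // /(_ a1).
  by have [p [qp p1 p2]] := quat_fixed_pair iQ char2 cQ dQ a1; exists p.
have hr := tpure_semihom (alg_of Q) (alg_of X).
have hl := tpure_semihoml (alg_of Q) (alg_of X).
exists (map_pair (fun a => tpure a 1) p :: map (map_pair (fun b => tpure 1 b)) ps).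
split.
- split; last exact: (good_map hr).
    suff: good (map (map_pair (fun a => tpure a 1 : tens (alg_of Q) (alg_of X))) [:: p])
      by case.
    by apply: (good_map hl); split.
  by move=> _ /mapP[q _ ->]; split; rewrite /comm /= !tpureM !mul1r !mulr1.
- move=> x; have [y0 [y1 [y2 [y3 ->]]]] := tens_quat x (qpair_span char2 dQ qp).
  exists (tpure 1 y0), (tpure 1 y1), (tpure 1 y2), (tpure 1 y3).
  split; try exact: (gen_map hr).
  by rewrite /= !tpureM !mul1r !mulr1.
- have [fD fZ f1] := lQ; have [gD gZ g1] := lX.
  move=> a1 q; rewrite in_cons => /orP[/eqP->|/mapP[q' q'ps ->]] /=.
    rewrite !tens_map_tpure // g1.
    case: sp => [[y hy]|-> ->] //; apply: a1; exists (tpure y 1).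
    by rewrite tens_map_tpure // g1 -tpureDl -hy.
  rewrite !tens_map_tpure // f1.
  case: (sps _ _ q'ps) => [[y hy]|-> ->] //; apply: a1; exists (tpure 1 y).
  by rewrite tens_map_tpure // f1 -tpureDr -hy.
Qed.

End TensorGenerators.

(** * Reconstruction of a tensor product of quaternion algebras *)

(* The algebra with basis 1, u, w, uw and relations u^2 = b, w^2 = w + a,
   wu = u - uw. *)
Definition qalg (F : fieldType) (a b : F) : Type := (F^o * F^o * (F^o * F^o))%type.

Section QuaternionAlgebra.
Variables (F : fieldType) (a b : F).
Local Notation Q := (qalg a b).

HB.instance Definition _ := GRing.Lmodule.copy Q (F^o * F^o * (F^o * F^o))%type.

Definition qelt (x0 x1 x2 x3 : F) : Q := ((x0, x1), (x2, x3)).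

(** The signs are kept so that the algebra axioms hold over every field and can be left to [ring];
    they disappear once characteristic two is assumed. *)
Definition q_mul (x y : Q) : Q :=
  let: ((x0, x1), (x2, x3)) := x in let: ((y0, y1), (y2, y3)) := y in
  qelt (x0 * y0 + b * (x1 * y1) + a * (x2 * y2) + b * (x3 * y1) - a * b * (x3 * y3))
       (x0 * y1 + x1 * y0 + x2 * y1 - a * (x2 * y3) + a * (x3 * y2))
       (x0 * y2 + x2 * y0 + x2 * y2 + b * (x1 * y3) - b * (x3 * y1))
       (x0 * y3 + x3 * y0 + x1 * y2 - x2 * y1 + x3 * y2).

Definition q_one : Q := qelt 1 0 0 0.

Lemma q_ext (x y : Q) : x.1.1 = y.1.1 :> F -> x.1.2 = y.1.2 :> F ->
  x.2.1 = y.2.1 :> F -> x.2.2 = y.2.2 :> F -> x = y.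
Proof.
by case: x y => [[x0 x1] [x2 x3]] [[y0 y1] [y2 y3]] /= -> -> -> ->.
Qed.

Fact q_mulA : associative q_mul.
Proof.
move=> [[x0 x1] [x2 x3]] [[y0 y1] [y2 y3]] [[z0 z1] [z2 z3]].
by apply: q_ext => /=; ring.
Qed.
Fact q_mul1l : left_id q_one q_mul.
Proof. by move=> [[x0 x1] [x2 x3]]; apply: q_ext => /=; ring. Qed.
Fact q_mul1r : right_id q_one q_mul.
Proof. by move=> [[x0 x1] [x2 x3]]; apply: q_ext => /=; ring. Qed.
Fact q_mulDl : left_distributive q_mul +%R.
Proof.
move=> [[x0 x1] [x2 x3]] [[y0 y1] [y2 y3]] [[z0 z1] [z2 z3]].
by apply: q_ext => /=; ring.
Qed.
Fact q_mulDr : right_distributive q_mul +%R.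
Proof.
move=> [[x0 x1] [x2 x3]] [[y0 y1] [y2 y3]] [[z0 z1] [z2 z3]].
by apply: q_ext => /=; ring.
Qed.
Fact q_one_neq0 : q_one != 0.
Proof. by rewrite /q_one /qelt !xpair_eqE oner_eq0. Qed.

HB.instance Definition _ := GRing.Zmodule_isNzRing.Build Q
  q_mulA q_mul1l q_mul1r q_mulDl q_mulDr q_one_neq0.

Fact q_scaleAl (c : F) (x y : Q) : c *: (x * y : Q) = (c *: x : Q) * y :> Q.
Proof.
case: x y => [[x0 x1] [x2 x3]] [[y0 y1] [y2 y3]].
by apply: q_ext; rewrite /= /GRing.scale /=; ring.
Qed.
HB.instance Definition _ := GRing.Lmodule_isLalgebra.Build F Q q_scaleAl.

Fact q_scaleAr (c : F) (x y : Q) : c *: (x * y : Q) = x * (c *: y : Q) :> Q.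
Proof.
case: x y => [[x0 x1] [x2 x3]] [[y0 y1] [y2 y3]].
by apply: q_ext; rewrite /= /GRing.scale /=; ring.
Qed.
HB.instance Definition _ := GRing.Lalgebra_isAlgebra.Build F Q q_scaleAr.

HB.instance Definition _ := Vector.copy Q (F^o * F^o * (F^o * F^o))%type.
HB.instance Definition _ := Algebra_isFalgebra.Build F Q.

Lemma dim_qalg : \dim {:Q} = 4.
Proof. by rewrite dimvf. Qed.

End QuaternionAlgebra.

(** Brackets with u and w isolate the coefficients ([com1] to [com3]). They leave only the scalar
    coefficient of a central element, and they produce, inside the ideal generated by a nonzero
    element, a nonzero multiple of 1 or of the invertible element u. *)
Lemma csa_of_pair (F : fieldType) (A : falgType F) (p : A * A) :
  2%N \in [pchar F] -> qpair p ->
  (forall x : A, exists c0 c1 c2 c3 : F,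
     x = c0%:A + c1 *: p.1 + c2 *: p.2 + c3 *: (p.1 * p.2)) -> central_simple A.
Proof.
case: p => u w /= char2 qp sp; have [[b b0 /= hb] [a /= ha] /= hwu] := qp.
have com1 c0 c1 c2 c3 x : x = c0%:A + c1 *: u + c2 *: w + c3 *: (u * w) ->
    u * x + x * u = (c3 * b)%:A + c2 *: u.
  by move=> ->; nc2_by (eqD (eqD (eqL c3%:A hb) (eqL c2%:A hwu)) (eqL (c3 *: u) hwu)).
have com2 c0 c1 c2 c3 x : x = c0%:A + c1 *: u + c2 *: w + c3 *: (u * w) ->
    w * (u * x + x * u) + (u * x + x * u) * w = c2 *: u.
  by move=> /com1->; nc2_by (eqL c2%:A hwu).
have com3 c0 c1 x : x = c0%:A + c1 *: u -> w * x + x * w = c1 *: u.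
  by move=> ->; nc2_by (eqL c1%:A hwu).
have u0 c : c *: u = 0 -> c = 0.
  move=> cu; have := @qpair_free F A char2 (u, w) 0 c 0 0 qp.
  by rewrite cu !scale0r !addr0 => -[].
split=> [x cx|I idI].
  have [c0 [c1 [c2 [c3 hx]]]] := sp x.
  have c20 : c2 = 0.
    by apply: u0; rewrite -(com2 _ _ _ _ _ hx) cx (addxx char2) mulr0 mul0r addr0.
  have c30 : c3 = 0.
    move: (com1 _ _ _ _ _ hx); rewrite cx (addxx char2) c20 scale0r addr0 => /esym/eqP.
    by rewrite scaler_eq0 oner_eq0 orbF mulf_eq0 (negPf b0) orbF => /eqP.
  rewrite c20 c30 !scale0r !addr0 in hx.
  exists c0; rewrite hx (u0 c1) ?scale0r ?addr0 //.
  by rewrite -(com3 _ _ _ hx) cx (addxx char2).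
have [->|I0] := eqVneq I 0%VS; [by left|right].
suff I1 : 1 \in I.
  apply/eqP; rewrite eqEsubv subvf; apply/subvP => x _.
  by have [+ _] := idI x 1 I1; rewrite mulr1.
have Ic c : c%:A \in I -> c != 0 -> 1 \in I.
  by move=> cI c0; rewrite -[1]scale1r -(mulVf c0) -scalerA memvZ.
have Iu c : c *: u \in I -> c != 0 -> 1 \in I.
  move=> cI c0; apply: (Ic (c * b)); last by rewrite mulf_neq0.
  by rewrite -scalerA -hb scalerAl; have [] := idI u _ cI.
have Icom x y : x \in I -> y * x + x * y \in I.
  by move=> xI; have [? ?] := idI y x xI; apply: memvD.
have [x xI x0] : exists2 x, x \in I & x != 0.
  by exists (vpick I); rewrite ?memv_pick ?vpick0.
have [c0 [c1 [c2 [c3 hx]]]] := sp x.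
have x1I := Icom _ u xI.
have [c20|] := eqVneq c2 0; last first.
  by apply: Iu; rewrite -(com2 _ _ _ _ _ hx) Icom.
have [c30|c30] := eqVneq c3 0; last first.
  apply: (Ic (c3 * b)); last by rewrite mulf_neq0.
  by rewrite (com1 _ _ _ _ _ hx) c20 scale0r addr0 in x1I.
rewrite c20 c30 !scale0r !addr0 in hx.
have [c10|] := eqVneq c1 0; last first.
  by apply: Iu; rewrite -(com3 _ _ _ hx) Icom.
apply: (Ic c0); first by rewrite hx c10 scale0r addr0 in xI.
by apply: contraNneq x0 => c00; rewrite hx c00 c10 !scale0r addr0.
Qed.

Section QuaternionInvolution.
Variables (F : fieldType) (a b : F).
Hypotheses (char2 : 2%N \in [pchar F]) (b0 : b != 0).
Local Notation Q := (qalg a b).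

Definition q_gens : Q * Q := (qelt a b 0 1 0 0, qelt a b 0 0 1 0).

(** The involution that fixes both generators; it sends uw to wu = uw + u. *)
Definition q_inv (x : Q) : Q :=
  let: ((x0, x1), (x2, x3)) := x in qelt a b x0 (x1 + x3) x2 x3.

Let subrr2 (x y : F) : x - y = x + y.
Proof. by rewrite (oppr_pchar2 char2). Qed.

Lemma qelt_scale c x0 x1 x2 x3 :
  c *: qelt a b x0 x1 x2 x3 = qelt a b (c * x0) (c * x1) (c * x2) (c * x3).
Proof. by []. Qed.

Lemma qelt_add x0 x1 x2 x3 y0 y1 y2 y3 :
  qelt a b x0 x1 x2 x3 + qelt a b y0 y1 y2 y3 =
  qelt a b (x0 + y0) (x1 + y1) (x2 + y2) (x3 + y3).
Proof. by []. Qed.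

Lemma qelt_mul x0 x1 x2 x3 y0 y1 y2 y3 :
  qelt a b x0 x1 x2 x3 * qelt a b y0 y1 y2 y3 =
  qelt a b (x0 * y0 + b * (x1 * y1) + a * (x2 * y2) + b * (x3 * y1) - a * b * (x3 * y3))
       (x0 * y1 + x1 * y0 + x2 * y1 - a * (x2 * y3) + a * (x3 * y2))
       (x0 * y2 + x2 * y0 + x2 * y2 + b * (x1 * y3) - b * (x3 * y1))
       (x0 * y3 + x3 * y0 + x1 * y2 - x2 * y1 + x3 * y2).
Proof. by []. Qed.

Lemma q_one_elt : 1 = qelt a b 1 0 0 0. Proof. by []. Qed.

Lemma q_gens_pair : [/\ q_gens.1 * q_gens.1 = b%:A,
  q_gens.2 * q_gens.2 = q_gens.2 + a%:A & q_gens.2 * q_gens.1 = q_gens.1 * q_gens.2 + q_gens.1].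
Proof.
split; rewrite /q_gens /= ?q_one_elt ?qelt_mul ?qelt_scale ?qelt_add !subrr2;
  congr qelt; rewrite /=; sc2.
Qed.

Lemma q_gens_qpair : qpair q_gens.
Proof. by have [h1 h2 h3] := q_gens_pair; split=> //; [exists b|exists a]. Qed.

Lemma qelt_gens x0 x1 x2 x3 : qelt a b x0 x1 x2 x3 =
  x0%:A + x1 *: q_gens.1 + x2 *: q_gens.2 + x3 *: (q_gens.1 * q_gens.2).
Proof.
rewrite /q_gens /= q_one_elt ?qelt_mul ?qelt_scale ?qelt_add !subrr2;
  congr qelt; rewrite /=; sc2.
Qed.

Lemma q_span (x : Q) : exists c0 c1 c2 c3 : F,
  x = c0%:A + c1 *: q_gens.1 + c2 *: q_gens.2 + c3 *: (q_gens.1 * q_gens.2).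
Proof.
by case: x => [[x0 x1] [x2 x3]]; exists x0, x1, x2, x3; rewrite -qelt_gens.
Qed.

Lemma q_quaternion : quaternion_algebra (qalg a b).
Proof.
split; last by rewrite /has_degree dim_qalg.
exact: csa_of_pair char2 q_gens_qpair q_span.
Qed.

Lemma q_inv_first_kind : involution_first_kind q_inv.
Proof.
have qE (x : Q) : exists x0 x1 x2 x3, x = qelt a b x0 x1 x2 x3.
  by case: x => [[x0 x1] [x2 x3]]; exists x0, x1, x2, x3.
have invE x0 x1 x2 x3 : q_inv (qelt a b x0 x1 x2 x3) = qelt a b x0 (x1 + x3) x2 x3.
  by [].
split.
- move=> x y; have [x0 [x1 [x2 [x3 ->]]]] := qE x; have [y0 [y1 [y2 [y3 ->]]]] := qE y.
  by rewrite qelt_add !invE qelt_add addrACA.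
- move=> x y; have [x0 [x1 [x2 [x3 ->]]]] := qE x; have [y0 [y1 [y2 [y3 ->]]]] := qE y.
  rewrite !qelt_mul !invE !subrr2; congr qelt; rewrite /=; sc2.
- move=> x; have [x0 [x1 [x2 [x3 ->]]]] := qE x; rewrite !invE; congr qelt; rewrite /=; sc2.
- by move=> c; rewrite q_one_elt qelt_scale invE mulr0 addr0.
Qed.

Definition q_quaternion_invol : quaternion_invol F :=
  @QuaternionInvol F (@AlgInvol F (qalg a b) q_inv) q_quaternion q_inv_first_kind.

Section Hom.
Variables (A : algType F) (p : A * A).
Hypotheses (hb : p.1 * p.1 = b%:A) (ha : p.2 * p.2 = p.2 + a%:A)
  (hwu : p.2 * p.1 = p.1 * p.2 + p.1).

Definition q_hom (x : Q) : A :=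
  let: ((x0, x1), (x2, x3)) := x in
  (x0 : F)%:A + (x1 : F) *: p.1 + (x2 : F) *: p.2 + (x3 : F) *: (p.1 * p.2).

Lemma q_homE x0 x1 x2 x3 : q_hom (qelt a b x0 x1 x2 x3) =
  x0%:A + x1 *: p.1 + x2 *: p.2 + x3 *: (p.1 * p.2).
Proof. by []. Qed.

Lemma q_hom_semihom : semihom idfun q_hom.
Proof.
have qE (x : Q) : exists x0 x1 x2 x3, x = qelt a b x0 x1 x2 x3.
  by case: x => [[x0 x1] [x2 x3]]; exists x0, x1, x2, x3.
split.
- move=> x y; have [x0 [x1 [x2 [x3 ->]]]] := qE x; have [y0 [y1 [y2 [y3 ->]]]] := qE y.
  by rewrite qelt_add !q_homE; nc2.
- move=> x y; have [x0 [x1 [x2 [x3 ->]]]] := qE x; have [y0 [y1 [y2 [y3 ->]]]] := qE y.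
  rewrite qelt_mul !subrr2 !q_homE.
  have e1 : p.2 * (p.1 * p.2) = a *: p.1 by nc2_by (eqD (eqR p.2 hwu) (eqL p.1 ha)).
  have e2 : p.1 * p.2 * (p.1 * p.2) = (a * b)%:A by nc2_by (eqD (eqL p.1 e1) (eqL a%:A hb)).
  have e3 : p.1 * p.2 * p.2 = p.1 * p.2 + a *: p.1 by nc2_by (eqL p.1 ha).
  have e4 : p.1 * p.2 * p.1 = b *: p.2 + b%:A by nc2_by (eqD (eqL p.1 hwu) (eqD (eqR p.2 hb) hb)).
  have e5 : p.1 * (p.1 * p.2) = b *: p.2 by nc2_by (eqR p.2 hb).
  nc2_by (eqD (eqD (eqD (eqL (x2 * y3)%:A e1) (eqL (x3 * y3)%:A e2))
                   (eqD (eqL (x3 * y2)%:A e3) (eqL (x3 * y1)%:A e4)))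
              (eqD (eqD (eqL (x1 * y3)%:A e5) (eqL (x1 * y1)%:A hb))
                   (eqD (eqL (x2 * y2)%:A ha) (eqL (x2 * y1)%:A hwu)))).
- by rewrite q_one_elt q_homE scale1r !scale0r !addr0.
- move=> c x; have [x0 [x1 [x2 [x3 ->]]]] := qE x.
  by rewrite qelt_scale !q_homE /=; nc2.
Qed.

End Hom.
End QuaternionInvolution.

(** * Total decomposability and fixed generators *)

Section Decomposition.
Variables (F : fieldType) (A : falgType F) (sigma : A -> A).
Hypotheses (inv : involution_first_kind sigma) (char2 : 2%N \in [pchar F]).

Definition fixed (ps : seq (A * A)) :=
  forall p : A * A, p \in ps -> sigma p.1 = p.1 /\ sigma p.2 = p.2.

(** The subalgebra [gen ps] takes the place of A because the tail of a generating family does not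
    generate A. In the induction step, injectivity on the product is [quat_free] and the image is
    the normal form that defines [gen]. *)
Lemma tensor_of_generators (ps : seq (A * A)) : good ps -> fixed ps ->
  exists (Qs : seq (quaternion_invol F)) (h : alg_of (quaternion_tensor Qs) -> A),
  [/\ semihom idfun h, injective h, forall y, gen ps (h y),
      forall x, gen ps x -> exists y, h y = x &
      forall y, sigma (h y) = h (invol_of y)].
Proof.
have [sD sM sK sF] := inv.
elim: ps => [_ _|p ps IH [qp cp gps] fps].
  exists [::], (fun c : F^o => (c : F)%:A); split.
  - split=> [x y|x y||c x]; rewrite ?scalerDl ?scale1r //.
      by rewrite -scalerAl mul1r scalerA.
    by rewrite scalerA.
  - move=> c d /eqP; rewrite -subr_eq0 -scalerBl scaler_eq0 oner_eq0 orbF subr_eq0.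
    by move/eqP.
  - by move=> c; exists c.
  - by move=> _ [c ->]; exists c.
  - by move=> c; apply: sF.
have [|Qs [h [hh hI hg gh hs]]] := IH gps.
  by move=> q qs; apply: fps; rewrite in_cons qs orbT.
have [sp1 sp2] := fps p (mem_head _ _).
have [[b b0 hb] [a ha] hwu] := qp.
have [hD hM h1 hZ] := hh.
set Q := q_quaternion_invol a char2 b0.
pose g : qalg a b -> A := q_hom p.
have hg' : semihom idfun g by apply: q_hom_semihom.
have [gD gM g1 gZ] := hg'.
have hp1 y : comm (h y) p.1.
  by apply/commS/gen_comm; [|exact: hg] => q /cp[].
have hp2 y : comm (h y) p.2.
  by apply/commS/gen_comm; [|exact: hg] => q /cp[].
have gu : g (q_gens a b).1 = p.1.
  by rewrite /g /q_hom /= scale1r !scale0r !addr0 add0r.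
have gw : g (q_gens a b).2 = p.2.
  by rewrite /g /q_hom /= scale1r !scale0r !addr0 add0r.
clearbody g.
have ghC x y : comm (g x) (h y).
  have [c0 [c1 [c2 [c3 ->]]]] := @q_span F a b char2 x.
  rewrite !gD !gZ gM gu gw g1; apply: commS.
  do ?apply: commD; apply: commZ; [exact: comm1|exact: hp1|exact: hp2|].
  by apply: commM; [exact: hp1|exact: hp2].
exists (Q :: Qs), (tens_hom g h).
have th : semihom idfun (tens_hom g h) by apply: tens_hom_semihom.
have [tD tM t1 tZ] := th.
have tE y0 y1 y2 y3 : tens_hom g h (tpure 1 y0 + tpure (q_gens a b).1 y1 +
      tpure (q_gens a b).2 y2 + tpure ((q_gens a b).1 * (q_gens a b).2) y3) =
    h y0 + h y1 * p.1 + h y2 * p.2 + h y3 * (p.1 * p.2).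
  rewrite !tD !tens_hom_tpure // gM gu gw g1 mul1r.
  by rewrite -hp1 -hp2 -(commM (hp1 _) (hp2 _)).
split=> //.
- move=> x y /eqP; rewrite -subr_eq0 => /eqP xy; apply/eqP; rewrite -subr_eq0.
  have txy : tens_hom g h (x - y) = 0.
    by rewrite -scaleN1r tD tZ scaleN1r.
  have [y0 [y1 [y2 [y3 xyE]]]] := tens_quat (x - y) (@q_span F a b char2).
  rewrite xyE tE in txy.
  have h0 : h 0 = 0 by rewrite -(scale0r (1 : alg_of (quaternion_tensor Qs))) hZ scale0r.
  have [] := quat_free char2 qp (hp1 _) (hp1 _) (hp1 _) (hp1 _) 
    (hp2 _) (hp2 _) (hp2 _) (hp2 _) txy.
  have hI0 y' : h y' = 0 -> y' = 0 by rewrite -{1}h0; apply: hI.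
  by rewrite xyE => /hI0-> /hI0-> /hI0-> /hI0->; rewrite !tpure0 !addr0.
- move=> x; have [y0 [y1 [y2 [y3 ->]]]] := tens_quat x (@q_span F a b char2).
  by rewrite tE; exists (h y0), (h y1), (h y2), (h y3).
- move=> _ [x0 [x1 [x2 [x3 [/gh[y0 <-] /gh[y1 <-] /gh[y2 <-] /gh[y3 <-] ->]]]]].
  by rewrite -tE; eexists.
- have sg (qi : qalg a b -> qalg a b) : involution_first_kind qi ->
      qi (q_gens a b).1 = (q_gens a b).1 -> qi (q_gens a b).2 = (q_gens a b).2 ->
      forall x, sigma (g x) = g (qi x).
    move=> iQ qu qw x; have [iD iM _ iF] := iQ.
    have [c0 [c1 [c2 [c3 ->]]]] := @q_span F a b char2 x.
    rewrite !iD !gD !sD !(involZ iQ) !gZ !(involZ inv) iM !gM sM (invol1 iQ) g1 (invol1 inv).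
    by rewrite qu qw gu gw sp1 sp2.
  have iQ := @q_inv_first_kind F a b char2.
  have {}sg x : sigma (g x) = g (q_inv x).
    by apply: sg x => //; apply: q_ext => //=; rewrite addr0.
  have lX := (tensor_generators char2 Qs).1.
  move=> x; rewrite (tens_sum_pure x) /=.
  apply: (big_ind (fun x => sigma (tens_hom g h x) =
    tens_hom g h (tens_map (@q_inv F a b) (@invol_of F (quaternion_tensor Qs)) x))).
  + have [_ mZ _] := tens_map_linear1 (invol_linear1 iQ) lX.
    rewrite -(scale0r (1 : tens (qalg a b) (alg_of (quaternion_tensor Qs)))).
    by rewrite mZ tZ tZ !scale0r (invol0 inv).
  + have [mD _ _] := tens_map_linear1 (invol_linear1 iQ) lX.
    by move=> y z hy hz; rewrite mD !tD sD hy hz.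
  + move=> i _; rewrite (tens_map_tpure (invol_linear1 iQ) lX) !tens_hom_tpure //.
    by rewrite sM hs sg ghC.
Qed.

Lemma decomposable_of_generators (ps : seq (A * A)) :
  good ps -> (forall x, gen ps x) -> fixed ps -> totally_decomposable sigma.
Proof.
move=> gps full fps; have [Qs [h [hh hI _ gh hs]]] := tensor_of_generators gps fps.
have [hD hM h1 hZ] := hh.
exists Qs; set X := quaternion_tensor Qs in h hh hI gh hs hD hM h1 hZ *.
have ex x : exists y, h y == x by have [y <-] := gh x (full x); exists y.
pose f x := xchoose (ex x).
have fK x : h (f x) = x by apply/eqP/(xchooseP (ex x)).
have hK y : f (h y) = y by apply: hI; rewrite fK.
have fL : linear f by move=> c x y; apply: hI; rewrite hD hZ !fK.
have fM : monoid_morphism f.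
  by split=> [|x y]; apply: hI; rewrite ?hM !fK.
pose f' : {lrmorphism A -> alg_of X} := HB.pack f
  (GRing.isLinear.Build F A (alg_of X) *:%R f fL)
  (GRing.isMonoidMorphism.Build A (alg_of X) f fM).
exists f'; split; first by exists h.
by move=> x; apply: hI; rewrite -hs !fK.
Qed.

Lemma generators_of_decomposable : totally_decomposable sigma ->
  exists ps : seq (A * A),
    [/\ good ps, forall x, gen ps x & ~ alt sigma 1 -> fixed ps].
Proof.
case=> Qs [f [[g fK gK] fs]]; set X := quaternion_tensor Qs in f g fK gK fs.
have hg : semihom idfun g.
  by split=> *; apply: (can_inj fK); rewrite ?(linearD, linearZ, rmorphM, rmorph1) /= !gK
    ?rmorph1.
have gs y : sigma (g y) = g (invol_of y).
  by apply: (can_inj fK); rewrite fs !gK.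
have [_ [ps [gps full sps]]] := tensor_generators char2 Qs.
exists (map (map_pair g) ps); split.
- exact: (good_map hg).
- by move=> x; rewrite -[x]fK; apply: (gen_map hg).
move=> a1 p /mapP[q qps ->] /=; rewrite !gs.
case: (sps _ q qps) => [[y hy]|-> ->] //.
have [gD _ g1 _] := hg.
by apply: a1; exists (g y); rewrite gs -gD -g1 hy.
Qed.

End Decomposition.

(** * Separable extensions and linear independence of squares *)

Section Span.
Variables (F K : fieldType) (iota : {rmorphism F -> K}) (I : finType).
Implicit Types (D : {set I}) (d : I -> K).

Definition spanF D d (x : K) := exists f : I -> F, x = \sum_(i in D) iota (f i) * d i.

Definition indep D d := forall f : I -> F,
  \sum_(i in D) iota (f i) * d i = 0 -> forall i, i \in D -> f i = 0.

Lemma spanF0 D d : spanF D d 0.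
Proof. by exists (fun=> 0); rewrite big1 // => i _; rewrite rmorph0 mul0r. Qed.

Lemma spanFD D d x y : spanF D d x -> spanF D d y -> spanF D d (x + y).
Proof.
case=> f -> [g ->]; exists (fun i => f i + g i); rewrite -big_split.
by apply: eq_bigr => i _; rewrite rmorphD mulrDl.
Qed.

Lemma spanFZ D d c x : spanF D d x -> spanF D d (iota c * x).
Proof.
case=> f ->; exists (fun i => c * f i); rewrite mulr_sumr.
by apply: eq_bigr => i _; rewrite rmorphM mulrA.
Qed.

Lemma spanF_sum (J : finType) (P : pred J) D d (x : J -> K) :
  (forall j, P j -> spanF D d (x j)) -> spanF D d (\sum_(j | P j) x j).
Proof.
by move=> h; apply: big_ind => //; [apply: spanF0|move=> *; apply: spanFD].
Qed.

Lemma spanF_mem D d i : i \in D -> spanF D d (d i).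
Proof.
move=> iD; exists (fun j => (j == i)%:R); rewrite (bigD1 i) //= eqxx rmorph1 mul1r.
by rewrite big1 ?addr0 // => j /andP[_ /negPf->]; rewrite rmorph0 mul0r.
Qed.

Lemma spanF_dep D d (f : I -> F) i x :
  \sum_(i in D) iota (f i) * d i = 0 -> i \in D -> f i != 0 ->
  spanF D d x -> spanF (D :\ i) d x.
Proof.
move=> f0 iD fi [g ->]; exists (fun j => g j - g i / f i * f j).
transitivity (\sum_(j in D) iota (g j - g i / f i * f j) * d j).
  have -> : \sum_(j in D) iota (g j - g i / f i * f j) * d j =
      \sum_(j in D) iota (g j) * d j - iota (g i / f i) * \sum_(j in D) iota (f j) * d j.
    rewrite mulr_sumr -sumrB; apply: eq_bigr => j _.
    by rewrite rmorphB mulrBl [iota (_ * f j)]rmorphM mulrA.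
  by rewrite f0 mulr0 subr0.
by rewrite (big_setD1 i) //= divfK // subrr rmorph0 mul0r add0r.
Qed.

Hypothesis char2K : 2%N \in [pchar K].

Lemma sqr_sum (J : finType) (P : pred J) (x : J -> K) :
  (\sum_(j | P j) x j) ^+ 2 = \sum_(j | P j) x j ^+ 2.
Proof.
apply: (big_morph (fun x => x ^+ 2)); last by rewrite expr0n.
by move=> y z; rewrite sqrrD -mulr_natr (pcharf0 char2K) mulr0 addr0.
Qed.

Lemma spanF_sqr D d x : spanF D d x -> spanF D (fun i => d i ^+ 2) (x ^+ 2).
Proof.
case=> f ->; exists (fun i => f i ^+ 2); rewrite sqr_sum.
by apply: eq_bigr => i _; rewrite exprMn rmorphXn.
Qed.

(* The hypotheses on E say that it is stable under squaring and is spanned by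
   its squares; hence a spanning family of minimal size remains one, and thus
   remains independent, after squaring. *)
Lemma indep_of_span (E : K -> Prop) D d :
  (forall y, E y -> E (y ^+ 2)) ->
  (forall y, E y -> exists m (c : 'I_m -> F) (z : 'I_m -> K),
      (forall k, E (z k)) /\ y = \sum_k iota (c k) * z k ^+ 2) ->
  (forall y, E y <-> spanF D d y) ->
  exists D' d', [/\ indep D' d', indep D' (fun i => d' i ^+ 2) &
    forall y, E y -> spanF D' d' y].
Proof.
move=> E2 Es; have [n] := ubnP #|D|; elim: n D d => // n IH D d leD Ed.
have shrink d0 : (forall y, E y <-> spanF D d0 y) -> ~ indep D d0 ->
  exists D' d', [/\ indep D' d', indep D' (fun i => d' i ^+ 2) &
    forall y, E y -> spanF D' d' y].
  move=> Ed0 nd; have [f [f0 [i [iD fi]]]] : exists f : I -> F,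
      \sum_(i in D) iota (f i) * d0 i = 0 /\ exists i, i \in D /\ f i != 0.
    apply: NNPP => nf; apply: nd => f f0 i iD; apply/eqP/negPn/negP => fi.
    by apply: nf; exists f; split=> //; exists i.
  apply: (IH (D :\ i) d0) => [|y].
    by move: leD; rewrite (cardsD1 i) iD.
  split=> [/Ed0|[g ->]]; first exact: spanF_dep f0 iD fi.
  apply/Ed0/spanF_sum => j; rewrite in_setD1 => /andP[_ jD].
  exact/spanFZ/spanF_mem.
case: (classic (indep D d)) => [di|]; last exact: shrink.
case: (classic (indep D (fun i => d i ^+ 2))) => [d2i|].
  by exists D, d; split=> // y /Ed.
apply: shrink => y; split=> [/Es[m [c [z [Ez ->]]]]|[g ->]].
  by apply: spanF_sum => k _; apply/spanFZ/spanF_sqr/Ed.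
have [f sf] : exists f, \sum_(i in D) iota (g i) * d i ^+ 2 = f by eexists.
rewrite sf; apply/Ed; rewrite -sf; apply: spanF_sum => i iD.
by apply/spanFZ/Ed/E2/Ed/spanF_mem.
Qed.

End Span.

Section SeparableSpan.
Variables (F K : fieldType) (iota : {rmorphism F -> K}).
Hypothesis char2 : 2%N \in [pchar F].
Local Notation "p ^f" := (map_poly iota p).

(* In characteristic two p = E(X^2) + X O(X^2) and p' = O(X^2), so that
   y O(y^2) = E(y^2), and O(y^2) is invertible in F[y^2] because 1 is a
   combination of p and p'. *)
Lemma separable_poly_sqr (p : {poly F}) (y : K) :
  separable_poly p -> root p^f y -> exists r : {poly F}, y = (r^f).[y ^+ 2].
Proof.
move=> sep /rootP py.
have ev (q : {poly F}) : (q^f).[y] =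
    ((even_poly q)^f).[y ^+ 2] + y * ((odd_poly q)^f).[y ^+ 2].
  rewrite -{1}[q]poly_even_odd rmorphD rmorphM /= !map_comp_poly map_polyXn map_polyX.
  by rewrite hornerD hornerM !horner_comp hornerX hornerXn mulrC.
have dp : (p^`()^f).[y] = ((odd_poly p)^f).[y ^+ 2].
  rewrite -{1}[p]poly_even_odd derivD derivM !deriv_comp derivXn derivX mulr1 /=.
  have -> : 'X *+ 2 = 0 :> {poly F}.
    by rewrite -mulr_natr -polyC_natr (pcharf0 char2) mulr0.
  rewrite !mulr0 mul0r !add0r map_comp_poly map_polyXn horner_comp hornerXn.
  by [].
have cop : coprimep p p^`() by move: sep; rewrite unlock.
have [[A B] /= /eqp_size] := Bezout_coprimepP _ _ cop.
rewrite size_poly1 => /eqP/size_poly1P[c c0 AB].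
(* From c = B(y) O(y^2): multiply by y, split B into its even and odd parts, and replace y O(y^2) by
   - E(y^2). *)
exists (c^-1 *: ('X * odd_poly B * odd_poly p - even_poly B * even_poly p)).
have yE : ((even_poly p)^f).[y ^+ 2] = - (y * ((odd_poly p)^f).[y ^+ 2]).
  by apply/eqP; rewrite -addr_eq0 -ev py.
have cE : iota c = (B^f).[y] * ((odd_poly p)^f).[y ^+ 2].
  rewrite -dp -hornerM -rmorphM /=.
  have -> : B * p^`() = c%:P - A * p by rewrite -AB addrC addKr.
  by rewrite rmorphB rmorphM /= hornerD hornerN hornerM py mulr0 subr0 map_polyC hornerC.
rewrite map_polyZ rmorphB !rmorphM /= map_polyX hornerZ hornerD hornerN !hornerM hornerX.
rewrite yE fmorphV; apply: (mulfI (x := iota c)); first by rewrite fmorph_eq0.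
rewrite mulrA mulfV ?fmorph_eq0 // mul1r cE ev.
by ring.
Qed.

End SeparableSpan.

Section SeparableFamily.
Variables (F K : fieldType) (iota : {rmorphism F -> K}).
Hypothesis char2 : 2%N \in [pchar F].
Hypothesis sepK : separable_extension iota.

Definition mul_closed (I : finType) (d : I -> K) :=
  (forall i j, spanF iota setT d (d i * d j)) /\ spanF iota setT d 1.

Lemma mul_closed_extend (I : finType) (d : I -> K) (y : K) : mul_closed d ->
  exists (I' : finType) (d' : I' -> K), [/\ mul_closed d',
    forall x, spanF iota setT d x -> spanF iota setT d' x & spanF iota setT d' y].
Proof.
move=> [dM d1]; have [p [[mon /rootP py _] _]] := sepK y.
pose d' (i : I * 'I_(size p)) := d i.1 * y ^+ i.2.
(* Reduction modulo p expresses every power of y through those with exponent below [size p]. *)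
have powE k x : spanF iota setT d x -> spanF iota setT d' (x * y ^+ k).
  case=> f ->; rewrite mulr_suml; apply: spanF_sum => i _.
  rewrite -mulrA; apply: spanFZ.
  have -> : y ^+ k = \sum_(j < size p) iota ('X^k %% p)`_j * y ^+ j.
    transitivity ((map_poly iota ('X^k %% p)).[y]).
      transitivity ((map_poly iota 'X^k).[y]); first by rewrite map_polyXn hornerXn.
      rewrite {1}(divp_eq 'X^k p) rmorphD rmorphM /= hornerD hornerM py mulr0 add0r.
      by [].
    rewrite (@horner_coef_wide _ (size p)).
      by apply: eq_bigr => j _; rewrite coef_map.
    by rewrite size_map_poly ltnW // ltn_modp monic_neq0.
  rewrite mulr_sumr; apply: spanF_sum => j _; rewrite mulrCA; apply: spanFZ.
  exact: (@spanF_mem _ _ iota _ setT d' (i, j)).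
exists _, d'; split=> [|x dx|]; last by have := powE 1 1 d1; rewrite mul1r.
  split=> [i j|]; last by have := powE 0 1 d1; rewrite mulr1.
  by rewrite /d' mulrACA -exprD; apply: powE.
by have := powE 0 x dx; rewrite mulr1.
Qed.

Lemma mul_closed_family (xs : seq K) : exists (I : finType) (d : I -> K),
  mul_closed d /\ forall x, x \in xs -> spanF iota setT d x.
Proof.
elim: xs => [|x xs [I [d [cd dxs]]]].
  exists unit, (fun=> 1); split=> //.
  have s1 : spanF iota [set: unit] (fun=> 1) 1 by exact: (@spanF_mem _ _ iota unit setT (fun=> 1) tt (in_setT tt)).
  by split=> // i j; rewrite mulr1.
have [I' [d' [cd' dd' xd']]] := mul_closed_extend x cd.
exists I', d'; split=> // y; rewrite in_cons => /orP[/eqP->//|/dxs].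
exact: dd'.
Qed.

Lemma spanF_mul (I : finType) (d : I -> K) x y : mul_closed d ->
  spanF iota setT d x -> spanF iota setT d y -> spanF iota setT d (x * y).
Proof.
move=> [dM _] [f ->] [g ->]; rewrite mulr_suml; apply: spanF_sum => i _.
rewrite -mulrA; apply: spanFZ; rewrite mulr_sumr; apply: spanF_sum => j _.
by rewrite mulrCA; apply: spanFZ.
Qed.

(** As K may have infinite degree, one works in the F-span E of a finite family closed under
    products. By separability each y in E is a polynomial in y^2, that is, a combination of squares
    of powers of y, which lie in E; so [indep_of_span] applies to E. *)
Lemma separable_family (xs : seq K) :
  exists (I : finType) (D : {set I}) (d : I -> K),
  [/\ indep iota D d, indep iota D (fun i => d i ^+ 2) &
      forall x, x \in 1 :: xs -> spanF iota D d x].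
Proof.
have [I [d [cd dxs]]] := mul_closed_family (1 :: xs); exists I.
have char2K : 2%N \in [pchar K] by rewrite (fmorph_pchar iota).
have pow y k : spanF iota setT d y -> spanF iota setT d (y ^+ k).
  move=> dy; elim: k => [|k IH]; first by have [] := cd.
  by rewrite exprS; apply: spanF_mul.
have sqr y : spanF iota setT d y -> exists m (c : 'I_m -> F) (z : 'I_m -> K),
    (forall k, spanF iota setT d (z k)) /\ y = \sum_k iota (c k) * z k ^+ 2.
  move=> dy; have [p [[_ py _] sp]] := sepK y.
  have [r yr] := separable_poly_sqr char2 sp py.
  exists (size r), (fun k => r`_k), (fun k => y ^+ k); split=> [k|]; first exact: pow.
  rewrite {1}yr (@horner_coef_wide _ (size r)) ?size_map_poly //.
  by apply: eq_bigr => k _; rewrite coef_map exprAC.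
have [D [d' [i1 i2 sd]]] := indep_of_span char2K (fun y => pow y 2) sqr
  (fun=> iff_refl _).
by exists D, d'; split=> // x /dxs/sd.
Qed.

End SeparableFamily.

(** * Scalar extension *)

Section ScalarExtension.
Variables (F K : fieldType) (iota : {rmorphism F -> K}) (A : falgType F).
Local Notation AK := (scalar_ext iota A).
Local Notation e := (vbasis {:A}).

Definition ext_in (a : A) : AK := tpure a (1 : ext_alg iota).

Lemma tpure_ext_in a (c : K) : tpure a (c : ext_alg iota) = c *: ext_in a :> AK.
Proof. by rewrite /ext_in scale_tpure mulr1. Qed.

Lemma ext_in_semihom : semihom iota ext_in.
Proof.
split=> [x y|x y||c x]; first exact: tpureDl.
- have /= := @tpureM F A (ext_alg iota) x 1 y 1; rewrite mulr1 => h.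
  by rewrite /ext_in -h.
- by [].
- by rewrite /ext_in tpureZl -tpureZr -tpure_ext_in; congr tpure; apply: mulr1.
Qed.

Lemma ext_expand (x : AK) : x = \sum_(i < \dim {:A}) (x i : K) *: ext_in e`_i.
Proof.
rewrite {1}[x](@tens_sum_pure F A (ext_alg iota)).
by apply: eq_bigr => i _; rewrite tpure_ext_in.
Qed.

Lemma ext_in_full (ps : seq (A * A)) :
  (forall x, gen ps x) -> forall y, gen (map (map_pair ext_in) ps) y.
Proof.
move=> full y; rewrite (ext_expand y); apply: big_ind; first exact: gen0.
  exact: genD.
by move=> i _; apply: genZ; apply: (gen_map ext_in_semihom).
Qed.

Lemma invol_extZ (f : {linear A -> A}) c a :
  invol_ext f (c *: ext_in a) = c *: ext_in (f a).
Proof.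
rewrite -!tpure_ext_in /invol_ext.
exact: (tens_map_pure f (idfun : {linear ext_alg iota -> ext_alg iota})).
Qed.

Lemma invol_extD (f : A -> A) (x y : AK) :
  invol_ext f (x + y) = invol_ext f x + invol_ext f y.
Proof.
rewrite /invol_ext /tens_map -[RHS]big_split; apply: eq_bigr => i _ /=.
by rewrite ffunE tpureDr.
Qed.

Lemma invol_ext_sum (I : Type) (r : seq I) (P : pred I) (f : {linear A -> A})
    (c : I -> K) (a : I -> A) :
  invol_ext f (\sum_(i <- r | P i) c i *: ext_in (a i)) =
  \sum_(i <- r | P i) c i *: ext_in (f (a i)).
Proof.
rewrite (big_morph _ (invol_extD f) (_ : _ = 0)).
  by apply: eq_bigr => i _; apply: invol_extZ.
by rewrite -(scale0r (ext_in 0)) invol_extZ !scale0r.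
Qed.

Lemma ext_in_indep (I : finType) (D : {set I}) (d : I -> K) (a : I -> A) :
  indep iota D d -> \sum_(i in D) d i *: ext_in (a i) = 0 ->
  forall i, i \in D -> a i = 0.
Proof.
move=> dD s0 i iD; rewrite (coord_vbasis (memvf (a i))) big1 // => k _.
suff -> : coord e k (a i) = 0 by rewrite scale0r.
apply: (dD (fun i => coord e k (a i))) => //.
have addk : {morph (fun x : AK => x k : K) : x y / x + y} by move=> x y; rewrite ffunE.
have zerok : (0 : AK) k = 0 :> K by rewrite ffunE.
have := congr1 (fun x : AK => x k : K) s0; rewrite /= zerok => s0k.
rewrite -[RHS]s0k (big_morph _ addk zerok); apply: eq_bigr => l _.
by rewrite -tpure_ext_in ffunE.
Qed.

Lemma indep1 : indep iota [set: unit] (fun=> 1).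
Proof.
move=> f; rewrite (big_pred1 tt) => [|[]]; last by rewrite inE.
by rewrite mulr1 => /eqP; rewrite fmorph_eq0 => /eqP f0 [].
Qed.

Lemma ext_in_inj : injective ext_in.
Proof.
have [jD jM j1 jZ] := ext_in_semihom.
have j0 a : ext_in a = 0 -> a = 0.
  move=> ja; apply: (@ext_in_indep unit setT (fun=> 1) (fun=> a) indep1 _ tt) => //.
  by rewrite big1 // => _ _; rewrite ja scaler0.
move=> x y xy; apply/eqP; rewrite -subr_eq0; apply/eqP/j0.
by rewrite jD -scaleN1r jZ rmorphN1 scaleN1r xy subrr.
Qed.

Lemma ext_family (I : finType) (D : {set I}) (d : I -> K) (x : AK) :
  (forall i, spanF iota D d (x i)) ->
  exists a : I -> A, x = \sum_(i in D) d i *: ext_in (a i).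
Proof.
have [jD jM j1 jZ] := ext_in_semihom.
have js (J : finType) (f : J -> A) : ext_in (\sum_i f i) = \sum_i ext_in (f i).
  apply: (big_morph _ jD); apply: (addrI (ext_in 0)).
  by rewrite -jD !addr0.
move=> sp; have /fin_all_exists[f fE] := sp.
exists (fun i => \sum_k f k i *: e`_k); rewrite {1}[x]ext_expand.
under eq_bigr => k _ do rewrite fE scaler_suml.
rewrite exchange_big; apply: eq_bigr => i _ /=.
rewrite js scaler_sumr; apply: eq_bigr => k _.
by rewrite jZ scalerA mulrC.
Qed.

Definition ext_span (U : A -> Prop) (x : AK) :=
  exists (J : finType) (c : J -> K) (u : J -> A),
    (forall j, U (u j)) /\ x = \sum_j c j *: ext_in (u j).

(** For any linear f, [invol_ext f] is f tensored with the identity. For the projector T with kernel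
    U it annihilates the K-span of U, so the combination of the T(s_i) with coefficients d_i
    vanishes and each T(s_i) is zero. *)
Lemma ext_span_descent (U : {vspace A}) (I : finType) (D : {set I}) (d : I -> K)
    (s : I -> A) :
  indep iota D d -> ext_span (fun x => x \in U) (\sum_(i in D) d i *: ext_in (s i)) ->
  forall i, i \in D -> s i \in U.
Proof.
have [jD jM j1 jZ] := ext_in_semihom.
move=> dD [J [c [u [uU sE]]]] i iD.
pose T : 'End(A) := (\1 - projv U)%VF.
have TE x : T x = x - projv U x by rewrite add_lfunE id_lfunE opp_lfunE.
have TU x : x \in U -> T x = 0 by move=> xU; rewrite TE projv_id // subrr.
have Ts : T (s i) = 0.
  apply: (ext_in_indep (a := fun i => T (s i)) dD) iD.
  rewrite -invol_ext_sum sE invol_ext_sum big1 // => j _.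
  by rewrite /= TU // -(scale0r (0 : A)) jZ rmorph0 scale0r scaler0.
move/eqP: Ts; rewrite TE subr_eq0 => /eqP->.
exact: memv_proj.
Qed.

Variable sigma : A -> A.
Hypothesis inv : involution_first_kind sigma.

Lemma invol_ext_ext_in c a :
  invol_ext (iota := iota) sigma (c *: ext_in a) = c *: ext_in (sigma a).
Proof.
have [sD sM sK sF] := inv.
pose s' : {linear A -> A} := HB.pack sigma (GRing.isLinear.Build F A A *:%R sigma
  (fun c x y => etrans (sD _ _) (congr1 (fun z => z + _) (involZ inv c x)))).
exact: (invol_extZ s').
Qed.

Lemma invol_ext_first_kind : involution_first_kind (invol_ext (iota := iota) sigma).
Proof.
have [sD sM sK sF] := inv; have [jD jM j1 jZ] := ext_in_semihom.
have tD := invol_extD sigma; have tZ := invol_ext_ext_in.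
set tau := invol_ext sigma in tD tZ *; clearbody tau.
have t0 : tau 0 = 0 by apply: (addrI (tau 0)); rewrite -tD !addr0.
have ts (J : finType) (f : J -> AK) : tau (\sum_i f i) = \sum_i tau (f i).
  exact: (big_morph _ tD).
split=> // [x y|x|c].
- rewrite (ext_expand x) (ext_expand y) mulr_suml !ts mulr_sumr.
  apply: eq_bigr => i _; rewrite mulr_sumr ts mulr_suml; apply: eq_bigr => k _.
  by rewrite -scalerAl -scalerAr -jM scalerA !tZ sM jM -scalerAl -scalerAr scalerA mulrC.
- rewrite (ext_expand x) !ts; apply: eq_bigr => i _.
  by rewrite !tZ sK.
- by rewrite -j1 tZ (invol1 inv).
Qed.

Lemma alt_ext_span x : alt (invol_ext (iota := iota) sigma) x -> ext_span (alt sigma) x.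
Proof.
have [sD sM sK sF] := inv; have [jD jM j1 jZ] := ext_in_semihom.
have tD := invol_extD sigma; have tZ := invol_ext_ext_in.
set tau := invol_ext sigma in tD tZ *; clearbody tau.
have t0 : tau 0 = 0 by apply: (addrI (tau 0)); rewrite -tD !addr0.
have ts (J : finType) (f : J -> AK) : tau (\sum_i f i) = \sum_i tau (f i).
  exact: (big_morph _ tD).
move=> [y ->]; exists 'I_(\dim {:A}), (fun i => y i), (fun i : 'I__ => e`_i + sigma e`_i).
split=> [i|]; first by exists e`_i.
rewrite (ext_expand y) ts -[LHS]big_split; apply: eq_bigr => i _ /=.
by rewrite tZ jD scalerDr -ext_expand.
Qed.

Lemma ext_span_descent_pred (U : A -> Prop) (I : finType) (D : {set I}) (d : I -> K)
    (s : I -> A) :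
  U 0 -> (forall x y, U x -> U y -> U (x + y)) -> (forall c x, U x -> U (c *: x)) ->
  indep iota D d -> ext_span U (\sum_(i in D) d i *: ext_in (s i)) ->
  forall i, i \in D -> U (s i).
Proof.
move=> U0 UD UZ dD [J [c [u [uU sE]]]] i iD; have [V VU] := vspace_of_pred U0 UD UZ.
apply/VU; apply: (ext_span_descent dD) iD; exists J, c, u; split=> // k.
exact/VU.
Qed.

Lemma ext_spanD (U : A -> Prop) x y : ext_span U x -> ext_span U y -> ext_span U (x + y).
Proof.
move=> [I [c [u [uU ->]]]] [J [d [v [vU ->]]]].
exists (I + J)%type, (fun k => match k with inl i => c i | inr k' => d k' end),
  (fun k => match k with inl i => u i | inr k' => v k' end).
by rewrite big_sumType; split=> [[i|k]|].
Qed.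

Lemma ext_span1 (U : A -> Prop) c u : U u -> ext_span U (c *: ext_in u).
Proof.
move=> Uu; exists unit, (fun=> c), (fun=> u); split=> //.
by rewrite (big_pred1 tt) // => -[].
Qed.

Definition altF (x : A) := exists c : F, alt sigma (x + c%:A).

Lemma ext_alt_descent (I : finType) (D : {set I}) (d : I -> K) (s : I -> A) :
  indep iota D d ->
  alt (invol_ext (iota := iota) sigma) (\sum_(i in D) d i *: ext_in (s i)) ->
  forall i, i \in D -> alt sigma (s i).
Proof.
move=> dD /alt_ext_span; apply: ext_span_descent_pred => //.
- exact: (alt0 inv).
- by move=> *; apply: altD.
- by move=> *; apply: altZ.
Qed.

Lemma ext_alt_in a : alt (invol_ext (iota := iota) sigma) (ext_in a) -> alt sigma a.
Proof.
move=> aa; apply: (@ext_alt_descent unit setT (fun=> 1) (fun=> a) indep1 _ tt) => //.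
by rewrite (big_pred1 tt) ?scale1r // => -[]; rewrite inE.
Qed.

Lemma ext_scalar_in a (c : K) : ext_in a = c%:A -> exists c : F, a = c%:A.
Proof.
have [jD jM j1 jZ] := ext_in_semihom.
move=> ac; apply: (@ext_span_descent_pred (fun a => exists c : F, a = c%:A) unit setT
  (fun=> 1) (fun=> a) _ _ _ indep1 _ tt) => //.
- by exists 0; rewrite scale0r.
- by move=> _ _ [b ->] [b' ->]; exists (b + b'); rewrite scalerDl.
- by move=> b _ [b' ->]; exists (b * b'); rewrite scalerA.
rewrite (big_pred1 tt) => [|[]]; last by rewrite inE.
by rewrite scale1r ac -j1; apply: ext_span1; exists 1; rewrite scale1r.
Qed.

Lemma ext_altF_descent (I : finType) (D : {set I}) (d : I -> K) (s : I -> A) (c : K) :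
  2%N \in [pchar F] -> indep iota D d ->
  alt (invol_ext (iota := iota) sigma) (\sum_(i in D) d i *: ext_in (s i) + c%:A) ->
  forall i, i \in D -> altF (s i).
Proof.
have [jD jM j1 jZ] := ext_in_semihom.
move=> char2 dD /alt_ext_span ad; apply: (ext_span_descent_pred _ _ _ dD).
- by exists 0; rewrite scale0r addr0; apply: (alt0 inv).
- move=> x y [a ax] [b by']; exists (a + b).
  by rewrite scalerDl addrACA; apply: altD.
- by move=> a x [b bx]; exists (a * b); rewrite -scalerA -scalerDr; apply: altZ.
have -> : \sum_(i in D) d i *: ext_in (s i) =
    \sum_(i in D) d i *: ext_in (s i) + c%:A + (- c) *: ext_in 1.
  by rewrite j1 scaleNr addrK.
apply: ext_spanD; last first.
  by apply: ext_span1; exists 1; rewrite scale1r (addxx char2); apply: (alt0 inv).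
have [J [e [u [uU ->]]]] := ad; exists J, e, u; split=> // k.
by exists 0; rewrite scale0r addr0.
Qed.

Lemma ext_altF_in (a : A) (c : K) : 2%N \in [pchar F] ->
  alt (invol_ext (iota := iota) sigma) (ext_in a + c%:A) -> altF a.
Proof.
move=> char2 h.
apply: (@ext_altF_descent unit setT (fun=> 1) (fun=> a) c char2 indep1 _ tt) => //.
by rewrite (big_pred1 tt) ?scale1r // => -[]; rewrite inE.
Qed.

End ScalarExtension.

(** * The centralizer of the symmetric generators *)

Section FixedGenerators.
Variables (F : fieldType) (A : falgType F) (tau : A -> A).
Hypotheses (inv : involution_first_kind tau) (char2 : 2%N \in [pchar F]).
Implicit Types (ps : seq (A * A)) (x y z : A).

Lemma phi_comm2 ps x y : good ps ->
  phi (map fst ps) x -> phi (map fst ps) y -> comm x y.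
Proof.
move=> gps px py; apply: phi_comm py => _ /mapP[p pps ->]; apply: commS.
apply: phi_comm px => _ /mapP[q qps ->].
elim: ps gps pps qps => //= r ps IH [_ cr gps]; rewrite !in_cons.
case/orP=> [/eqP->|pps] /orP[/eqP->|qps] //; last exact: IH.
  by have [] := cr _ qps.
by apply: commS; have [] := cr _ pps.
Qed.

(** For the last property, u x1 = w(u x1) + (u x1)w has the form y + tau(y) with y = w u x1. Hence x
    and x0 agree modulo Alt, and only the scalar term of x remains in the end. *)
Lemma phi_props ps x : good ps -> fixed tau ps -> phi (map fst ps) x ->
  [/\ tau x = x, exists c : F, x * x = c%:A & altF tau x].
Proof.
have [tD tM _ tF] := inv.
elim: ps x => [|[u w] ps IH] x /=.
  move=> _ _ [c ->]; split=> //; first by exists (c * c); rewrite -scalerAl mul1r scalerA.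
  by exists c; rewrite (addxx char2); apply: alt0.
move=> [[[b b0 /= hb] [a /= ha] /= hwu] cp gps] fps [x0 [x1 [p0 p1 ->]]].
have fps' : fixed tau ps by move=> q qs; apply: fps; rewrite in_cons qs orbT.
have [s0 [c0 q0] [a0 al0]] := IH _ gps fps' p0.
have [s1 [c1 q1] _] := IH _ gps fps' p1.
have [/= sp1 sp2] := fps (u, w) (mem_head _ _).
have c01 := phi_comm2 gps p0 p1.
have cu z : phi (map fst ps) z -> comm z u.
  by move=> pz; apply/commS/(phi_comm _ pz) => _ /mapP[q /cp[? _ _ _] ->].
have cw z : phi (map fst ps) z -> comm z w.
  by move=> pz; apply/commS/(phi_comm _ pz) => _ /mapP[q /cp[_ _ ? _] ->].
split; first by rewrite tD tM s0 s1 sp1 (cu _ p1).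
  exists (c0 + b * c1); have [d0 d1] := (cu _ p0, cu _ p1).
  by nc2_by (eqD (eqD (eqD q0 (eqR x1 (eqL u d1))) (eqD (eqL b%:A q1) (eqM 1 (x1 * x1) hb)))
    (eqD (eqL u c01) (eqR x1 d0))).
exists a0; rewrite addrAC; apply: altD => //.
exists (w * (u * x1)); rewrite !tM s1 sp1 sp2.
by nc2_by (eqD (eqR x1 hwu) (eqD (eqR w (cu _ p1)) (eqL u (cw _ p1)))).
Qed.

Lemma alt_quadD x y : alt tau (tau (x + y) * (x + y) + (tau x * x + tau y * y)).
Proof.
have [tD tM tK _] := inv.
by exists (tau x * y); rewrite tM tK tD; nc2.
Qed.

Lemma alt_quad_sum (I : finType) (P : pred I) (x : I -> A) :
  alt tau (tau (\sum_(i | P i) x i) * (\sum_(i | P i) x i) +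
           \sum_(i | P i) tau (x i) * x i).
Proof.
apply: (big_ind2 (fun y q => alt tau (tau y * y + q))) => [|y1 q1 y2 q2 h1 h2|i _].
- by rewrite mulr0 addr0; apply: alt0.
- have -> : tau (y1 + y2) * (y1 + y2) + (q1 + q2) =
    (tau (y1 + y2) * (y1 + y2) + (tau y1 * y1 + tau y2 * y2)) +
    (tau y1 * y1 + q1) + (tau y2 * y2 + q2) by nc2.
  by do 2?[apply: altD => //]; apply: alt_quadD.
- by rewrite (addxx char2); apply: alt0.
Qed.

Variable ps : seq (A * A).
Hypotheses (gps : good ps) (full : forall x, gen ps x) (fps : fixed tau ps).

Definition cent x := forall p : A * A, p \in ps -> comm x p.1.

Lemma cent_phiP x : cent x -> phi (map fst ps) x.
Proof. exact: cent_phi. Qed.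

Lemma phi_cent x : phi (map fst ps) x -> cent x.
Proof.
move=> px p pps; apply: (phi_comm2 gps px).
by apply: phi_mem; apply: map_f.
Qed.

Lemma cent_comm x y : cent x -> cent y -> comm x y.
Proof. by move=> /cent_phiP cx /cent_phiP; apply: phi_comm2. Qed.

Lemma centP x : cent x -> [/\ tau x = x, exists c : F, x * x = c%:A & altF tau x].
Proof. by move/cent_phiP; apply: phi_props. Qed.

Lemma centM x y : cent x -> cent y -> cent (x * y).
Proof. by move=> cx cy p pps; apply: commS; apply: commM; apply: commS; [apply: cx|apply: cy]. Qed.

Lemma centD x y : cent x -> cent y -> cent (x + y).
Proof. by move=> cx cy p pps; apply: commS; apply: commD; apply: commS; [apply: cx|apply: cy]. Qed.

Lemma cent_scalar c : cent c%:A.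
Proof. by move=> p _; apply/commS/commA. Qed.

Hypothesis ort : ~ alt tau 1.

(* For an adjoint involution on End(V) with bilinear form B, this is the
   right ideal of the maps with values in {v | B(v, v) = 0}. *)
Definition null x := alt tau (tau x * x).

Lemma nullD x y : null x -> null y -> null (x + y).
Proof.
move=> nx ny.
have : alt tau (tau (x + y) * (x + y) + (tau x * x + tau y * y) + (tau x * x + tau y * y)).
  by apply: altD; [exact: inv|exact: alt_quadD|apply: altD].
by congr alt; nc2.
Qed.

Lemma nullZ c x : null x -> null (c *: x).
Proof.
by move=> nx; rewrite /null (involZ inv) -scalerAl -scalerAr scalerA; apply: altZ.
Qed.

Lemma nullMr x y : null x -> null (x * y).
Proof.
have [_ tM _ _] := inv => nx.
by rewrite /null tM mulrA -[tau y * tau x * x]mulrA; apply: alt_conj.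
Qed.

Lemma nullMl p x : p \in ps -> null x -> null (p.1 * x).
Proof.
have [_ tM _ _] := inv => pps nx; have [sp _] := fps pps.
have [_ [c hc] _] := centP (phi_cent (phi_mem (map_f fst pps))).
rewrite /null tM sp.
have -> : tau x * p.1 * (p.1 * x) = c *: (tau x * x).
  by rewrite -mulrA [p.1 * (p.1 * x)]mulrA hc mulr_algl -scalerAr.
exact: altZ.
Qed.

Lemma null_cent_sqr x : cent x -> null x -> x * x = 0.
Proof.
move=> cx; have [sx [c hc] _] := centP cx; rewrite /null sx hc.
by move/(alt_scalar inv ort) => ->; rewrite scale0r.
Qed.

(** By [gen_reduce], with Z the right annihilator of z, only the null elements of the centralizer
    Phi matter. Such an element is symmetric, so its square is a scalar in Alt, that is, zero. *)
Lemma null_kill z : (forall y, cent y -> y * y = 0 -> z * y = 0) ->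
  forall x, null x -> z * x = 0.
Proof.
move=> zN; apply: (@gen_reduce F A char2 ps null (fun x => z * x = 0)) => //.
- exact: nullD.
- exact: nullZ.
- by move=> p x pps nx; split; [apply: nullMl|apply: nullMr|apply: nullMr].
- by move=> x y zx zy; rewrite mulrDr zx zy addr0.
- by move=> c x zx; rewrite -scalerAr zx scaler0.
- by move=> p x _ zx; rewrite mulrA zx mul0r.
by move=> x nx cx; apply: zN => //; apply: null_cent_sqr.
Qed.

(** As long as some x in Phi with x^2 = 0 has yx nonzero, y is replaced by yx. The right ideal yA
    then shrinks strictly: y = yxb would give xy = y x^2 b = 0. *)
Lemma nilpotent_socle y : cent y -> y != 0 -> y * y = 0 ->
  exists z, [/\ cent z, z != 0, z * z = 0 &
    forall x, cent x -> x * x = 0 -> z * x = 0].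
Proof.
have [n] := ubnP (\dim (limg (amull y))); elim: n y => // n IH y ley cy y0 yy.
case: (classic (forall x, cent x -> x * x = 0 -> y * x = 0)) => [h|]; first by exists y.
move=> nx; have [x [cx xx yx]] : exists x, [/\ cent x, x * x = 0 & y * x != 0].
  apply: NNPP => h; apply: nx => x cx xx; apply/eqP/negPn/negP => yx.
  by apply: h; exists x.
have cxy := cent_comm cx cy.
apply: (IH (y * x)) => //; last 1 first.
- by rewrite -mulrA [x * _]mulrA cxy -[y * x * x]mulrA xx !mulr0.
- move: ley; rewrite ltnS; apply: leq_trans; rewrite ltn_neqAle.
  have sub : (limg (amull (y * x)%R) <= limg (amull y))%VS.
    apply/subvP => _ /memv_imgP[b _ ->]; apply/memv_imgP; exists (x * b); rewrite ?memvf //.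
    by rewrite !lfunE /= mulrA.
  rewrite (dimvS sub) andbT (dimv_leqif_sup sub); apply/negP => /subvP/(_ y).
  case/(_ _)/memv_imgP; first by apply/memv_imgP; exists 1; rewrite ?memvf // lfunE /= mulr1.
  move=> b _; rewrite lfunE /= => hy; case/eqP: yx.
  by rewrite -cxy hy !mulrA cxy -[y * x * x]mulrA xx mulr0 mul0r.
- exact: centM.
Qed.

End FixedGenerators.

(** * Construction of the generators *)

Section Construction.
Variables (F : fieldType) (A : falgType F) (sigma : A -> A) (S : A -> Prop).
Hypotheses (char2 : 2%N \in [pchar F]) (inv : involution_first_kind sigma).
Hypotheses (ort : ~ alt sigma 1) (aniso : forall x, sigma x * x = 0 -> x = 0).
Hypothesis S_sym : forall a, S a -> sigma a = a.
Hypothesis S_sqr : forall a, S a -> exists c : F, a * a = c%:A.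
Hypothesis S_altF : forall a, S a -> altF sigma a.
Hypothesis S_comm : forall a b, S a -> S b -> comm a b.
Hypothesis SD : forall a b, S a -> S b -> S (a + b).
Hypothesis SM : forall a b, S a -> S b -> S (a * b).
Hypothesis S_scalar : forall c : F, S c%:A.
Hypothesis S_cent : forall a, (forall s, S s -> comm a s) -> S a.
(** The constants in S of the inner derivations stabilizing S are the scalars; [tower_closed]
    extends this from F to the subfields F[vs]. *)
Hypothesis S_derivation : forall v, S v -> (forall c : F, v <> c%:A) ->
  exists y, (forall s, S s -> S (y * s + s * y)) /\ y * v + v * y <> 0.
Implicit Types (x y z v w s t : A) (vs : seq A).

Definition br x y := x * y + y * x.

Lemma brM y s t : br y (s * t) = br y s * t + s * br y t.
Proof. by rewrite /br; nc2. Qed.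

Lemma br_br y z t : br (br y z) t = br y (br z t) + br z (br y t).
Proof. by rewrite /br; nc2. Qed.

Lemma br_sqr y t : br (y * y) t = br y (br y t).
Proof. by rewrite /br; nc2. Qed.

Lemma brDr y s t : br y (s + t) = br y s + br y t.
Proof. by rewrite /br; nc2. Qed.

Lemma brDl y z t : br (y + z) t = br y t + br z t.
Proof. by rewrite /br; nc2. Qed.

Lemma br0 y : br y 0 = 0.
Proof. by rewrite /br mulr0 mul0r addr0. Qed.

Lemma br_comm y t : br y t = 0 <-> comm y t.
Proof. by rewrite /br /comm; split=> h; nc2_by h. Qed.

Lemma brMl s y t : comm s t -> br (s * y) t = s * br y t.
Proof. by rewrite /br => h; nc2_by (eqR y h). Qed.

Lemma SZ c a : S a -> S (c *: a).
Proof. by rewrite -mulr_algl; apply: SM. Qed.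

Lemma S_zero : S 0.
Proof. by rewrite -(scale0r (1 : A)); apply: S_scalar. Qed.

Lemma S_sqr_neq0 a : S a -> a != 0 -> exists2 c : F, c != 0 & a * a = c%:A.
Proof.
move=> Sa a0; have [c hc] := S_sqr Sa; exists c => //.
apply: contraNneq a0 => c0; apply/eqP/aniso.
by rewrite S_sym // hc c0 scale0r.
Qed.

Lemma S_inv a : S a -> a != 0 -> exists2 b, S b & b * a = 1.
Proof.
move=> Sa a0; have [c c0 hc] := S_sqr_neq0 Sa a0; exists (c^-1 *: a); first exact: SZ.
by rewrite -scalerAl hc scalerA mulVf // scale1r.
Qed.

Lemma phi_S vs x : (forall v, v \in vs -> S v) -> phi vs x -> S x.
Proof.
elim: vs x => [|v vs IH] x Sv /=; first by case=> c ->.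
case=> [x0 [x1 [p0 p1 ->]]].
have IH' y : phi vs y -> S y.
  by apply: IH => w wvs; apply: Sv; rewrite in_cons wvs orbT.
apply: SD; first exact: IH'.
by apply: SM; [apply: Sv; rewrite mem_head|apply: IH'].
Qed.

Definition normalizes y := forall s, S s -> S (br y s).

Definition kills y vs := forall v, v \in vs -> br y v = 0.

(** A strictly increasing chain of subfields of S, each quadratic over the next smaller one: the
    elements are 2-independent over F. *)
Fixpoint tower vs : Prop :=
  if vs is v :: vs' then ~ phi vs' v /\ tower vs' else True.

Lemma normD y z : normalizes y -> normalizes z -> normalizes (y + z).
Proof. by move=> ny nz s Ss; rewrite brDl; apply: SD; [apply: ny|apply: nz]. Qed.

Lemma normMl s y : S s -> normalizes y -> normalizes (s * y).
Proof.
by move=> Ss ny t St; rewrite brMl; [apply: SM => //; apply: ny|apply: S_comm].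
Qed.

Lemma killsD y z vs : kills y vs -> kills z vs -> kills (y + z) vs.
Proof. by move=> ky kz v vvs; rewrite brDl ky // kz // addr0. Qed.

Lemma killsMl s y vs : (forall v, v \in vs -> S v) -> S s -> kills y vs -> kills (s * y) vs.
Proof.
by move=> Sv Ss ky v vvs; rewrite brMl ?ky ?mulr0 //; apply: S_comm => //; apply: Sv.
Qed.

Lemma normalize v vs x : (forall u, u \in v :: vs -> S u) -> v != 0 ->
  normalizes x -> kills x vs -> br x v <> 0 ->
  exists e, [/\ normalizes e, kills e vs & br e v = v].
Proof.
move=> Svs v0 nx kx xv.
have Sv : S v by apply: Svs; rewrite mem_head.
have Svs' u : u \in vs -> S u by move=> uvs; apply: Svs; rewrite in_cons uvs orbT.
have [t St tx] := S_inv (nx _ Sv) (introN eqP xv).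
exists (v * t * x); split.
- by apply: normMl => //; apply: SM.
- by apply: killsMl => //; apply: SM.
- by rewrite brMl -?mulrA ?tx ?mulr1 //; apply: S_comm => //; apply: SM.
Qed.

(* The analogue for derivations of the Galois correspondence.  If e(v) = v and
   all y in question satisfy y(v0) = y(v) l, then applying this to [y, e] and
   to e^2 gives y(l) = 0; now l and v0 + v l lie in F[vs]. *)
Lemma tower_closed vs v0 : (forall v, v \in vs -> S v) -> tower vs -> S v0 ->
  (forall y, normalizes y -> kills y vs -> br y v0 = 0) -> phi vs v0.
Proof.
elim: vs v0 => [|v vs IH] v0 /=.
  move=> _ _ Sv0 k0; apply: NNPP => nv0.
  have [|y [ny yv0]] := S_derivation Sv0; first by move=> c h; apply: nv0; exists c.
  by apply: yv0; apply: k0.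
move=> Svs [nv tvs] Sv0 k0.
have Sv : S v by apply: Svs; rewrite mem_head.
have Svs' u : u \in vs -> S u by move=> uvs; apply: Svs; rewrite in_cons uvs orbT.
have v_neq0 : v != 0 by apply/eqP => h; apply: nv; rewrite h; apply: phi0.
have [x [nx kx xv]] : exists x, [/\ normalizes x, kills x vs & br x v <> 0].
  apply: NNPP => h; apply: nv; apply: IH => // y ny ky.
  by apply: NNPP => yv; apply: h; exists y.
have [e [ne ke ev]] := normalize Svs v_neq0 nx kx xv.
have [v' Sv' v'v] := S_inv Sv v_neq0.
have vv' : v * v' = 1 by rewrite (S_comm Sv Sv').
pose l := v' * br e v0.
have Sl : S l by apply: SM => //; apply: ne.
have ev0 : br e v0 = v * l by rewrite /l mulrA vv' mul1r.
clearbody l.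
(* The derivation y + re with r = y(v)/v kills v as well as [vs], hence it kills v0. *)
have yv0 y : normalizes y -> kills y vs -> br y v0 = br y v * l.
  move=> ny ky; pose r := br y v * v'.
  have Sr : S r by apply: SM => //; apply: ny.
  have : br (y + r * e) v0 = 0.
    apply: k0; first by apply: normD => //; apply: normMl.
    move=> u; rewrite in_cons => /orP[/eqP->|].
      rewrite brDl brMl; last exact: S_comm.
      by rewrite ev /r -mulrA v'v mulr1 (addxx char2).
    by apply: killsD => //; apply: killsMl.
  rewrite brDl brMl; last exact: S_comm.
  by rewrite ev0 /r -mulrA [v' * (v * l)]mulrA v'v mul1r => h; nc2_by h.
have cancel z : v * z = 0 -> z = 0.
  by move=> h; rewrite -[z]mul1r -v'v -mulrA h mulr0.
have el : br e l = 0.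
  apply: cancel; have := yv0 (e * e).
  rewrite !br_sqr ev0 ev ev brM ev => h.
  have : v * l + v * br e l = v * l.
    apply: h; first by move=> s Ss; rewrite br_sqr; apply/ne/ne.
    by move=> u uvs; rewrite br_sqr (ke u uvs) br0.
  by move=> {}h; nc2_by h.
have yl y : normalizes y -> kills y vs -> br y l = 0.
  move=> ny ky; apply: cancel; have := yv0 (br y e).
  rewrite !br_br ev0 (yv0 y ny ky) ev !brM el mulr0 addr0 => h.
  have h' : br y v * l + v * br y l + br e (br y v) * l = (br y v + br e (br y v)) * l.
    apply: h; first by move=> s Ss; rewrite br_br; apply: SD; [apply/ny/ne|apply/ne/ny].
    by move=> u uvs; rewrite br_br (ke u uvs) (ky u uvs) !br0 addr0.
  by nc2_by h'.
exists (v0 + v * l), l; split; last by nc2.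
  apply: IH => //; first by apply: SD => //; apply: SM.
  by move=> y ny ky; rewrite brDr brM yl // yv0 // mulr0 addr0 (addxx char2).
exact: IH.
Qed.

(** [tower_closed] gives a derivation e that kills the tail and fixes v. A derivation dual to an
    element of the tail becomes zero at v after adding a multiple of e, which does not change it on
    the tail. *)
Lemma tower_dual vs v0 : (forall v, v \in vs -> S v) -> tower vs -> v0 \in vs ->
  exists w, normalizes w /\ forall v, v \in vs -> br w v = if v == v0 then v else 0.
Proof.
elim: vs v0 => //= v vs IH v0 Svs [nv tvs] v0vs.
have Sv : S v by apply: Svs; rewrite mem_head.
have Svs' u : u \in vs -> S u by move=> uvs; apply: Svs; rewrite in_cons uvs orbT.
have v_neq0 : v != 0 by apply/eqP => h; apply: nv; rewrite h; apply: phi0.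
have vvs : v \notin vs by apply/negP => /phi_mem.
have [x [nx kx xv]] : exists x, [/\ normalizes x, kills x vs & br x v <> 0].
  apply: NNPP => h; apply: nv; apply: tower_closed => // y ny ky.
  by apply: NNPP => yv; apply: h; exists y.
have [e [ne ke ev]] := normalize Svs v_neq0 nx kx xv.
have [v' Sv' v'v] := S_inv Sv v_neq0.
move: v0vs; rewrite in_cons => /orP[/eqP->|v0vs].
  exists e; split=> // u; rewrite in_cons => /orP[/eqP->|uvs]; first by rewrite eqxx.
  by rewrite ke //; case: eqP => // uv; rewrite uv (negPf vvs) in uvs.
have [w [nw hw]] := IH v0 Svs' tvs v0vs.
have Sr : S (br w v * v') by apply: SM => //; apply: nw.
exists (w + br w v * v' * e); split; first by apply: normD => //; apply: normMl.
move=> u; rewrite in_cons => /orP[/eqP->|uvs].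
  have /negPf -> : v != v0 by apply: contraNneq vvs => ->.
  rewrite brDl brMl ?ev; last exact: S_comm.
  by rewrite -mulrA v'v mulr1 (addxx char2).
rewrite brDl brMl; last by apply: S_comm => //; apply: Svs'.
by rewrite (ke u uvs) mulr0 addr0 hw.
Qed.

(** For the form xy modulo Alt, each v is orthogonal to the whole subfield generated by the elements
    after it. *)
Fixpoint pure vs : Prop :=
  if vs is v :: vs' then
    [/\ forall y, phi vs' y -> alt sigma (v * y), ~ phi vs' v & pure vs']
  else True.

Lemma pure_tower vs : pure vs -> tower vs.
Proof. by elim: vs => //= v vs IH [_ nv pvs]; split=> //; apply: IH. Qed.

Lemma phiM vs x y : (forall v, v \in vs -> S v) -> phi vs x -> phi vs y -> phi vs (x * y).
Proof.
elim: vs x y => [|v vs IH] x y Svs /=.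
  by case=> c -> [d ->]; exists (c * d); rewrite -scalerAl mul1r scalerA.
case=> [x0 [x1 [p0 p1 ->]]] [y0 [y1 [q0 q1 ->]]].
have Sv : S v by apply: Svs; rewrite mem_head.
have Svs' u : u \in vs -> S u by move=> uvs; apply: Svs; rewrite in_cons uvs orbT.
have IH' a b := IH a b Svs'.
have [c hc] := S_sqr Sv.
exists (x0 * y0 + c *: (x1 * y1)), (x0 * y1 + x1 * y0); split.
- by apply: phiD; [apply: IH'|apply: phiZ; apply: IH'].
- by apply: phiD; apply: IH'.
have [c0 c1] := (S_comm (phi_S Svs' p0) Sv, S_comm (phi_S Svs' p1) Sv).
by nc2_by (eqD (eqD (eqR y1 c0) (eqM v y1 c1)) (eqM 1 (x1 * y1) hc)).
Qed.

(* Orthogonal projection for the form (x, y) |-> xy modulo Alt, with values in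
   (F + Alt) / Alt = F. *)
Lemma pure_projection vs s : (forall v, v \in vs -> S v) -> pure vs -> S s ->
  exists y, phi vs y /\ forall z, phi vs z -> alt sigma ((s + y) * z).
Proof.
elim: vs s => [|v vs IH] s Svs /=.
  move=> _ Ss; have [c hc] := S_altF Ss; exists c%:A; split; first by exists c.
  by move=> _ [d ->]; rewrite mulr_algr; apply: altZ.
move=> [av nv pvs] Ss.
have Sv : S v by apply: Svs; rewrite mem_head.
have Svs' u : u \in vs -> S u by move=> uvs; apply: Svs; rewrite in_cons uvs orbT.
have v_neq0 : v != 0 by apply/eqP => h; apply: nv; rewrite h; apply: phi0.
have [c c0 hc] := S_sqr_neq0 Sv v_neq0.
have [y0 [p0 a0]] := IH s Svs' pvs Ss.
have [y1 [p1 a1]] := IH (v * s) Svs' pvs (SM Sv Ss).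
(* F[v, vs] is the orthogonal sum of F[vs] and v F[vs]. As v^2 = c, the component of s in the second
   summand is c^-1 v times the projection to F[vs] of the product of v and s. *)
exists (y0 + v * (c^-1 *: y1)); split.
  by exists y0, (c^-1 *: y1); split=> //; apply: phiZ.
move=> _ [z0 [z1 [q0 q1 ->]]].
have -> : (s + (y0 + v * (c^-1 *: y1))) * (z0 + v * z1) =
    (s + y0) * z0 + c^-1 *: (v * (y1 * z0)) + (v * s + y1) * z1 + v * (y0 * z1).
  have [e0 e1 e2] := And3 (S_comm Ss Sv) (S_comm (phi_S Svs' p0) Sv) (S_comm (phi_S Svs' p1) Sv).
  have e3 : c^-1 *: (c *: (y1 * z1)) = y1 * z1 by rewrite scalerA mulVf // scale1r.
  by nc2_by (eqD (eqD (eqD (eqR z1 e0) (eqR z1 e1)) (eqL c^-1%:A (eqM v z1 e2)))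
    (eqD (eqL c^-1%:A (eqR (y1 * z1) hc)) e3)).
have aM a b : phi vs a -> phi vs b -> alt sigma (v * (a * b)).
  by move=> pa pb; apply: av; apply: phiM.
by do 3?[apply: altD => //]; [apply: a0|apply: altZ => //; apply: aM|apply: a1|apply: aM].
Qed.

Lemma span_phi vs x : x \in <<vs>>%VS -> phi vs x.
Proof.
elim: vs x => [|u vs IH] x; first by rewrite span_nil memv0 => /eqP->; apply: phi0.
rewrite span_cons => /memv_addP[_ /vlineP[c ->] [y /IH py ->]].
exists y, c%:A; split=> //; first exact: phi_scalar.
by rewrite mulr_algr addrC.
Qed.

(** Gram-Schmidt: an element of S outside F[vs] is made orthogonal to F[vs] by [pure_projection] and
    added to [vs]. The family stays linearly independent, which bounds its length. *)
Lemma pure_basis : exists vs,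
  [/\ forall v, v \in vs -> S v, pure vs & forall s, S s -> phi vs s].
Proof.
have grow n vs : (\dim {:A} <= size vs + n)%N -> free vs ->
    (forall v, v \in vs -> S v) -> pure vs -> exists vs,
    [/\ forall v, v \in vs -> S v, pure vs & forall s, S s -> phi vs s].
  elim: n vs => [|n IH] vs dvs fvs Svs pvs;
      case: (classic (forall s, S s -> phi vs s)) => [?|ns]; try by exists vs.
  - case: ns => s _; apply: span_phi.
    suff -> : <<vs>>%VS = fullv by rewrite memvf.
    apply/eqP; rewrite eqEdim subvf (eqnP fvs).
    by rewrite addn0 in dvs.
  have [s [Ss ps]] : exists s, S s /\ ~ phi vs s.
    by apply: NNPP => h; apply: ns => s Ss; apply: NNPP => ps; apply: h; exists s.
  have [y [py ay]] := pure_projection Svs pvs Ss.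
  have nsy : ~ phi vs (s + y).
    move=> psy; apply: ps; have -> : s = (s + y) + y by nc2.
    exact: phiD.
  apply: (IH (s + y :: vs)).
  - by rewrite /= addSnnS.
  - by rewrite free_cons fvs andbT; apply/negP => /span_phi.
  - move=> v; rewrite in_cons => /orP[/eqP->|/Svs//].
    by apply: SD => //; apply: phi_S py.
  - by split.
by apply: (grow (\dim {:A}) [::]) => //; apply: nil_free.
Qed.

(** [w, -] kills 1 and maps each product of the v to a multiple of itself, and all nontrivial
    products lie in Alt. *)
Lemma pure_br_alt vs w :
  (forall v, v \in vs -> br w v = v \/ br w v = 0) -> pure vs ->
  forall s, phi vs s -> phi vs (br w s) /\ alt sigma (br w s).
Proof.
elim: vs => [|v vs IH] /=.
  move=> _ _ _ [c ->]; have -> : br w c%:A = 0 by rewrite /br; nc2.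
  by split; [apply: (phi0 [::])|apply: alt0].
move=> hw [av nv pvs] _ [s0 [s1 [p0 p1 ->]]].
have hw' u : u \in vs -> br w u = u \/ br w u = 0.
  by move=> uvs; apply: hw; rewrite in_cons uvs orbT.
have [[q0 a0] [q1 a1]] := (IH hw' pvs _ p0, IH hw' pvs _ p1).
rewrite brDr brM.
have [->|->] := hw v (mem_head _ _).
  split; last by apply: altD => //; apply: altD => //; apply: av.
  by exists (br w s0), (s1 + br w s1); split=> //; [apply: phiD|rewrite [v * (s1 + _)]mulrDr].
rewrite mul0r add0r; split; last by apply: altD => //; apply: av.
by exists (br w s0), (br w s1).
Qed.

Lemma generators_exist : exists ps : seq (A * A),
  [/\ good ps, forall x, gen ps x & fixed sigma ps].
Proof.
have [sD sM sK sF] := inv.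
have [V [SV pV VS]] := pure_basis.
have tV := pure_tower pV.
have neV v : v \in V -> v != 0.
  elim: V tV {SV pV VS} => //= u us IH [nu tu]; rewrite in_cons => /orP[/eqP->|/IH//].
    by apply/eqP => h; apply: nu; rewrite h; apply: phi0.
  by apply.
have uV : uniq V.
  elim: V tV {SV pV VS neV} => //= u us IH [nu /IH->]; rewrite andbT.
  by apply/negP => /phi_mem.
have centV x : (forall v, v \in V -> br x v = 0) -> S x.
  move=> cx; apply: S_cent => s /VS; apply: phi_comm => v vV.
  exact/br_comm/cx.
pose rel w v0 := forall v, v \in V -> br w v = if v == v0 then v else 0.
have relS w s v0 : S s -> rel w v0 -> rel (w + s) v0.
  move=> Ss rw v vV; rewrite brDl rw //.
  by have /br_comm -> := S_comm Ss (SV v vV); rewrite addr0.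
have rel_br w w' v v' : rel w v -> rel w' v' -> S (br w w').
  move=> rw rw'; apply: centV => u uinV; rewrite br_br (rw' u uinV) (rw u uinV).
  case: ifP => e'; case: ifP => e; rewrite ?br0 ?(rw u uinV) ?(rw' u uinV) ?e ?e';
  by rewrite ?addr0 ?(addxx char2).
have rel_sqr w v : rel w v -> rel (w * w) v.
  by move=> rw u uinV; rewrite br_sqr (rw u uinV); case: ifP => e; rewrite ?br0 ?(rw u uinV) ?e.
(* Both w and sigma(w) act in the same way on V, so d = w + sigma(w) lies in S. Then d^2 = [w, d] +
   (wd + sigma(wd)) is in Alt, by the choice of V, and it is a scalar; so d^2 = 0, and d = 0 by
   anisotropy. *)
have fixw w v0 : rel w v0 -> sigma w = w.
  move=> rw; pose d := w + sigma w.
  have Sd : S d.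
    apply: centV => v vV; rewrite brDl rw //.
    have -> : br (sigma w) v = sigma (br w v).
      by rewrite /br sD !sM (S_sym (SV v vV)) addrC.
    by rewrite rw //; case: ifP => _; rewrite ?(S_sym (SV v vV)) ?(invol0 inv) (addxx char2).
  have sd : sigma d = d by apply: S_sym.
  have [c dd] := S_sqr Sd.
  have ad : alt sigma (d * d).
    have [|_ a1] := @pure_br_alt V w _ pV d (VS _ Sd).
      by move=> v vV; rewrite rw //; case: ifP; [left|right].
    have -> : d * d = br w d + (w * d + sigma (w * d)).
      rewrite sM sd /br; have e : d = w + sigma w by [].
      by nc2_by (eqL d e).
    by apply: altD => //; exists (w * d).
  have d0 : d = 0.
    apply: aniso; rewrite sd dd; rewrite dd in ad.
    by rewrite (alt_scalar inv ort ad) scale0r.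
  have e : d = w + sigma w by [].
  by nc2_by (eqD d0 e).
have [ps [mps rps cps sps]] : exists ps : seq (A * A), [/\ map fst ps = V,
    forall p : A * A, p \in ps -> rel p.2 p.1,
    forall p q : A * A, p \in ps -> q \in ps -> comm p.2 q.2 &
    forall p : A * A, p \in ps -> exists a : F, p.2 * p.2 = p.2 + a%:A].
  have sub : {subset V <= V} by [].
  elim: {1 3}V sub => [|v U IH] sub; first by exists [::].
  have [|ps [mps rps cps sps]] := IH; first by move=> u uU; apply: sub; rewrite in_cons uU orbT.
  have vV : v \in V by apply: sub; rewrite mem_head.
  have [w0 [_ rw0]] := tower_dual SV tV vV.
  have [s [Ss cs]] : exists s, S s /\ forall q : A * A, q \in ps -> comm q.2 (w0 + s).
    have sub' : {subset ps <= ps} by [].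
    elim: {1 3}ps sub' => [|q qs IHq] sub'.
      by exists 0; split=> //; apply: S_zero.
    have [|s [Ss cs]] := IHq; first by move=> u uU; apply: sub'; rewrite in_cons uU orbT.
    have qps : q \in ps by apply: sub'; rewrite mem_head.
    have rw1 := relS _ _ _ Ss rw0.
    have Sb := rel_br _ _ _ _ (rps _ qps) rw1.
    (* As q.2^2 = q.2 + a, the derivation [q.2, -] is idempotent, so adding [q.2, w] to w makes it
       commute with q.2. The added term lies in S, and it commutes with the r.2 treated before,
       since these commute with q.2 and w. *)
    exists (s + br q.2 (w0 + s)); split; first exact: SD.
    move=> r; rewrite in_cons addrA => /orP[/eqP->|rqs].
      have [a ha] := sps _ qps.
      apply/br_comm; rewrite (brDr _ (w0 + s)) -br_sqr ha brDl.
      have -> : br a%:A (w0 + s) = 0 by apply/br_comm/commS/commA.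
      by rewrite addr0 (addxx char2).
    have rps' : r \in ps by apply: sub'; rewrite in_cons rqs orbT.
    have [c1 c2] := (cs _ rqs, cps _ _ rps' qps).
    by apply: commD => //; rewrite /br; apply: commD; apply: commM.
  have rw1 := relS _ _ _ Ss rw0.
  pose w1 := w0 + s.
  have cw1 q : q \in ps -> comm q.2 (w1 * w1) by move=> qps; apply: commM; apply: cs.
  (* w1^2 + w1 commutes with V, so it lies in S and only its square is known to be a scalar. For
     w1^2 in place of w1 this square is the required expression: (w1^2)^2 + w1^2 = (w1^2 + w1)^2. *)
  exists ((v, w1 * w1) :: ps); split.
  - by rewrite /= mps.
  - by move=> p; rewrite in_cons => /orP[/eqP->|/rps//]; apply: rel_sqr.
  - move=> p q; rewrite !in_cons => /orP[/eqP->|pps] /orP[/eqP->|qps] //=.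
    + exact/commS/cw1.
    + exact: cw1.
    + exact: cps.
  move=> p; rewrite in_cons => /orP[/eqP->|/sps//] /=.
  have Sa : S (w1 * w1 + w1).
    apply: centV => u uinV; rewrite brDl (rel_sqr _ _ rw1) // rw1 //.
    exact: (addxx char2).
  have [c hc] := S_sqr Sa; exists c.
  by nc2_by hc.
have memV p : p \in ps -> p.1 \in V by move=> pps; rewrite -mps; apply: map_f.
have gps : good ps.
  have upsV : uniq (map fst ps) by rewrite mps.
  have sub : {subset ps <= ps} by [].
  elim: {1 3 4}ps sub upsV => [|[v w] qs IH] //= sub /andP[vqs uqs].
  have pps : (v, w) \in ps by apply: sub; rewrite mem_head.
  have /= vV := memV _ pps; have /= rw := rps _ pps.
  have sub' q : q \in qs -> q \in ps by move=> qqs; apply: sub; rewrite in_cons qqs orbT.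
  split; last by apply: IH.
    split=> /=; [exact: S_sqr_neq0 (SV _ vV) (neV _ vV)|exact: (sps _ pps)|].
    by have := rw _ vV; rewrite eqxx /br => h; nc2_by h.
  move=> q qqs; have qps := sub' _ qqs.
  have vq : v != q.1 by apply: contraNneq vqs => ->; apply: map_f.
  split=> /=; first by apply: S_comm; apply: SV => //; apply: memV.
  - by apply/commS/br_comm; rewrite (rps _ qps) // (negPf vq).
  - by apply/br_comm; rewrite rw ?memV // eq_sym (negPf vq).
  - exact: (cps _ _ pps qps).
exists ps; split=> //; last first.
  by move=> p pps; split; [apply: S_sym; apply: SV; apply: memV|apply: fixw (rps _ pps)].
(* The centralizer of V is S, which is F[V]. *)
apply: (gen_full_mul char2 gps) => x cx; apply: phi_gen => //; rewrite mps.
apply/VS/centV => v; rewrite -mps => /mapP[p pps ->].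
exact/br_comm/cx.
Qed.

End Construction.

(** On Phi, [w, x0 + u x1] = u x1 and u is invertible, so commuting with each w removes the
    corresponding u from x. *)
Lemma phi_center (F : fieldType) (A : falgType F) (ps : seq (A * A)) (x : A) :
  2%N \in [pchar F] -> good ps -> phi (map fst ps) x ->
  (forall p : A * A, p \in ps -> comm x p.2) -> exists c : F, x = c%:A.
Proof.
move=> char2; elim: ps x => [|[u w] ps IH] x //=.
move=> [[[b b0 /= hb] [a /= ha] /= hwu] cp gps] [x0 [x1 [p0 p1 xE]]] cx.
have cw z : phi (map fst ps) z -> comm z w.
  by move=> pz; apply/commS/(phi_comm _ pz) => _ /mapP[q /cp[_ _ ? _] ->].
have h := cx _ (mem_head _ _); rewrite /= xE /comm in h.
have e : u * x1 = 0.
  by nc2_by (eqD (eqD h (cw _ p0)) (eqD (eqL u (cw _ p1)) (eqR x1 hwu))).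
have x10 : x1 = 0.
  have /eqP : b *: x1 = 0 by nc2_by (eqD (eqL u e) (eqR x1 hb)).
  by rewrite scaler_eq0 (negPf b0) => /eqP.
have xx0 : x = x0 by rewrite xE x10 mulr0 addr0.
rewrite xx0 in cx *; apply: (IH x0 gps p0) => p pps.
by apply: cx; rewrite in_cons pps orbT.
Qed.

Lemma good_bracket (F : fieldType) (A : falgType F) (ps : seq (A * A)) (p q : A * A) :
  2%N \in [pchar F] -> good ps -> p \in ps -> q \in ps ->
  exists c : F, p.2 * q.1 + q.1 * p.2 = c *: q.1.
Proof.
move=> char2; elim: ps => //= r ps IH [[_ _ hr] cr gps]; rewrite !in_cons.
case/orP=> [/eqP->|pps] /orP[/eqP->|qps]; last exact: IH.
- by case: r hr {cr} => u w /= hr; exists 1; rewrite scale1r; nc2_by hr.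
- by exists 0; have [_ _ -> _] := cr _ qps; rewrite scale0r (addxx char2).
- by exists 0; have [_ -> _ _] := cr _ pps; rewrite scale0r (addxx char2).
Qed.

(** * Descent of the centralizer along a separable extension *)

Section Descent.
Variables (F K : fieldType) (iota : {rmorphism F -> K}).
Variables (A : falgType F) (B : falgType K) (j : A -> B).
Variables (sigma : A -> A) (tau : B -> B).
Hypotheses (char2F : 2%N \in [pchar F]) (char2 : 2%N \in [pchar K]).
Hypotheses (hj : semihom iota j) (inv : involution_first_kind sigma).
Hypotheses (invB : involution_first_kind tau) (jtau : forall a, tau (j a) = j (sigma a)).
Hypothesis jI : injective j.
Hypothesis j_indep : forall (I : finType) (D : {set I}) (d : I -> K) (a : I -> A),
  indep iota D d -> \sum_(i in D) d i *: j (a i) = 0 -> forall i, i \in D -> a i = 0.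
Hypothesis j_family : forall x : B,
  exists (I : finType) (D : {set I}) (d : I -> K) (a : I -> A),
  [/\ indep iota D d, indep iota D (fun i => d i ^+ 2) &
      x = \sum_(i in D) d i *: j (a i)].
Hypothesis j_alt : forall (I : finType) (D : {set I}) (d : I -> K) (s : I -> A),
  indep iota D d -> alt tau (\sum_(i in D) d i *: j (s i)) ->
  forall i, i \in D -> alt sigma (s i).
Hypothesis j_altF : forall (I : finType) (D : {set I}) (d : I -> K) (s : I -> A) (c : K),
  indep iota D d -> alt tau (\sum_(i in D) d i *: j (s i) + c%:A) ->
  forall i, i \in D -> altF sigma (s i).
Hypothesis j_altF1 : forall a (c : K), alt tau (j a + c%:A) -> altF sigma a.
Hypothesis j_scalar : forall a (c : K), j a = c%:A -> exists c : F, a = c%:A.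
Variable qs : seq (B * B).
Hypotheses (gqs : good qs) (full : forall x, gen qs x) (fqs : fixed tau qs).
Hypothesis ortB : ~ alt tau 1.
Hypothesis aniso : forall x, sigma x * x = 0 -> x = 0.

Local Notation cent := (cent qs).

Let jD x y : j (x + y) = j x + j y. Proof. by have [h _ _ _] := hj. Qed.
Let jM x y : j (x * y) = j x * j y. Proof. by have [_ h _ _] := hj. Qed.
Let j1 : j 1 = 1. Proof. by have [_ _ h _] := hj. Qed.
Let jZ c x : j (c *: x) = iota c *: j x. Proof. by have [_ _ _ h] := hj. Qed.
Let jN x : j (- x) = - j x. Proof. by rewrite -scaleN1r jZ rmorphN1 scaleN1r. Qed.
Let tD x y : tau (x + y) = tau x + tau y. Proof. by have [h _ _ _] := invB. Qed.
Let tM x y : tau (x * y) = tau y * tau x. Proof. by have [_ h _ _] := invB. Qed.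
Let tK x : tau (tau x) = x. Proof. by have [_ _ h _] := invB. Qed.

Lemma alt_ext a : alt sigma a -> alt tau (j a).
Proof. by move=> [y ->]; exists (j y); rewrite jD jtau. Qed.

Lemma quad_family (I : finType) (D : {set I}) (d : I -> K) (a : I -> A) x :
  x = \sum_(i in D) d i *: j (a i) ->
  alt tau (\sum_(i in D) d i ^+ 2 *: j (sigma (a i) * a i) + tau x * x).
Proof.
move=> ->; have := alt_quad_sum invB char2 (mem D) (fun i => d i *: j (a i)).
rewrite addrC; congr (alt tau (_ + _)); apply: eq_bigr => i _.
by rewrite (involZ invB) jtau -scalerAl -scalerAr scalerA jM expr2.
Qed.

Lemma tau_family (I : finType) (D : {set I}) (d : I -> K) (a : I -> A) :
  tau (\sum_(i in D) d i *: j (a i)) = \sum_(i in D) d i *: j (sigma (a i)).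
Proof.
rewrite (big_morph tau tD (invol0 invB)).
by apply: eq_bigr => i _; rewrite (involZ invB) jtau.
Qed.

(** Write the z of [nilpotent_socle] with components a_i. Since z^2 = 0 and the d_i^2 are
    independent, each sigma(a_i) a_i is in Alt, so j(a_i) is null and z j(a_i) = 0. As z is
    symmetric, this product has the components sigma(a_k) a_i; the one with k = i vanishes, and
    anisotropy gives a_i = 0. *)
Lemma cent_reduced y : cent y -> y * y = 0 -> y = 0.
Proof.
move=> cy yy; apply/eqP/negPn/negP => y0.
have [z [cz z0 zz zN]] := nilpotent_socle char2 gqs full cy y0 yy.
have zK := null_kill invB char2 gqs full fqs ortB zN.
have [I [D [d [a [iD iD2 zE]]]]] := j_family z.
have [sz _ _] := centP invB char2 gqs full fqs cz.
have an i : i \in D -> alt sigma (sigma (a i) * a i).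
  apply: (j_alt (s := fun i => sigma (a i) * a i) iD2).
  by have := quad_family zE; rewrite sz zz addr0.
have nj i : i \in D -> z * j (a i) = 0.
  by move=> iD'; apply: zK; rewrite /null jtau -jM; apply/alt_ext/an.
case/eqP: z0; rewrite zE big1 // => i iD'.
have ai : sigma (a i) * a i = 0.
  apply: (j_indep (a := fun k => sigma (a k) * a i) iD _ iD').
  rewrite -[RHS](nj i iD') -sz zE tau_family mulr_suml; apply: eq_bigr => k _.
  by rewrite jM scalerAl.
by rewrite (aniso ai) -(scale0r (0 : A)) jZ rmorph0 scale0r scaler0.
Qed.

Lemma null_eq0 x : null tau x -> x = 0.
Proof.
move=> nx; rewrite -[x]mul1r.
apply: (null_kill invB char2 gqs full fqs ortB) nx => y cy yy.
by rewrite mul1r; apply: cent_reduced.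
Qed.

(* x -> sigma(x) x is additive modulo Alt, so xu + ux is null. *)
Lemma altF_cent x : altF tau (tau x * x) -> cent x.
Proof.
move=> [c ac] [u w] pps /=; have [/= su sw] := fqs pps.
have [_ [k /= hk] _] := centP invB char2 gqs full fqs
  (phi_cent gqs (phi_mem (map_f fst pps))).
have : null tau (x * u + u * x).
  rewrite /null tD !tM su.
  (* Three elements of Alt: with q = tau(x) x + c and u^2 = k, a conjugate of q, a sum y + tau(y),
     and kq. The two scalars ck cancel. *)
  have -> : (u * tau x + tau x * u) * (x * u + u * x) =
      tau u * (tau x * x + c%:A) * u + (u * tau x * u * x + tau (u * tau x * u * x))
      + k *: (tau x * x + c%:A).
    rewrite !tM tK su.
    by nc2_by (eqD (eqL c%:A hk) (eqM (tau x) x hk)).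
  apply: altD => //; first apply: altD => //.
  - exact: alt_conj.
  - by eexists.
  - exact: altZ.
move/null_eq0 => h; rewrite /comm.
by nc2_by h.
Qed.

(** The intersection of A with Phi, since Phi is its own centralizer. *)
Definition S (a : A) := cent (j a).

(** Here tau(x) x = x^2 is a scalar, so independence of the d_i^2 puts each sigma(a_i) a_i in F +
    Alt, and [altF_cent] places the components themselves in Phi. *)
Lemma cent_family x : cent x -> exists (I : finType) (D : {set I}) (d : I -> K) (a : I -> A),
  [/\ indep iota D d, forall i, i \in D -> S (a i) & x = \sum_(i in D) d i *: j (a i)].
Proof.
move=> cx; have [I [D [d [a [iD iD2 xE]]]]] := j_family x.
exists I, D, d, a; split=> // i iD'.
have [sx [k xx] _] := centP invB char2 gqs full fqs cx.
have [c ac] : altF sigma (sigma (a i) * a i).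
  apply: (j_altF (s := fun i => sigma (a i) * a i) (c := k) iD2) iD'.
  by have := quad_family xE; rewrite sx xx.
apply: altF_cent; exists (iota c).
by rewrite jtau -jM -j1 -jZ -jD; apply: alt_ext.
Qed.

Lemma S_sym a : S a -> sigma a = a.
Proof. by move=> /(centP invB char2 gqs full fqs)[sa _ _]; apply: jI; rewrite -jtau. Qed.

Lemma S_sqr a : S a -> exists c : F, a * a = c%:A.
Proof.
move=> /(centP invB char2 gqs full fqs)[_ [c hc] _].
by apply: (j_scalar (c := c)); rewrite jM.
Qed.

Lemma S_altF a : S a -> altF sigma a.
Proof. by move=> /(centP invB char2 gqs full fqs)[_ _ [c hc]]; apply: j_altF1 hc. Qed.

Lemma S_comm a b : S a -> S b -> comm a b.
Proof.
by move=> ca cb; apply: jI; rewrite !jM; apply: (cent_comm char2 gqs full).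
Qed.

Lemma SD a b : S a -> S b -> S (a + b).
Proof. by rewrite /S jD; apply: centD. Qed.

Lemma SM a b : S a -> S b -> S (a * b).
Proof. by rewrite /S jM; apply: centM. Qed.

Lemma S_scalar c : S c%:A.
Proof. by rewrite /S jZ j1; apply: cent_scalar. Qed.

Lemma j_comm (I : finType) (D : {set I}) (d : I -> K) (a : I -> A) b :
  indep iota D d ->
  comm (\sum_(i in D) d i *: j (a i)) (j b) <-> forall i, i \in D -> comm (a i) b.
Proof.
move=> iD.
have br : (\sum_(i in D) d i *: j (a i)) * j b - j b * (\sum_(i in D) d i *: j (a i)) =
    \sum_(i in D) d i *: j (a i * b - b * a i).
  rewrite mulr_suml mulr_sumr -sumrB; apply: eq_bigr => i _.
  by rewrite jD jN !jM scalerBr scalerAl scalerAr.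
split=> [c i iD'|c].
  apply/eqP; rewrite -subr_eq0; apply/eqP.
  apply: (j_indep (a := fun i => a i * b - b * a i) iD) iD'.
  by rewrite -br c subrr.
apply/eqP; rewrite -subr_eq0 br big1 // => i /c ->.
by rewrite subrr -(scale0r (0 : A)) jZ rmorph0 scale0r scaler0.
Qed.

Lemma S_cent a : (forall s, S s -> comm a s) -> S a.
Proof.
move=> ca p pps; have cp := phi_cent gqs (phi_mem (map_f fst pps)).
have [I [D [d [b [iD Sb ->]]]]] := cent_family cp.
by apply: commS; apply/j_comm => // i /Sb/ca/commS.
Qed.

(** By [phi_center], v fails to commute with some [p.2], hence with some component a_k of it. As
    [p.2, -] stabilizes Phi, [p.2, s] commutes with S for every s in S; so do its components
    [a_i, s], and these lie in S by [S_cent]. *)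
Lemma S_derivation v : S v -> (forall c, v <> c%:A) ->
  exists y, (forall s, S s -> S (y * s + s * y)) /\ y * v + v * y <> 0.
Proof.
move=> Sv vc.
have [p [pps pv]] : exists p : B * B, p \in qs /\ ~ comm (j v) p.2.
  apply: NNPP => np.
  have [|c jv] := phi_center char2 gqs (cent_phiP char2 gqs full Sv).
    by move=> p pps; apply: NNPP => h; apply: np; exists p.
  by have [c' vE] := j_scalar jv; apply: (vc c').
have norm x : cent x -> cent (p.2 * x + x * p.2).
  move=> cx [u w] qqs; have /= cu := cx _ qqs.
  suff [c hc] : exists c : K, p.2 * u + u * p.2 = c *: u.
    case: p pps pv hc => u' w' /= _ _ hc; rewrite /comm.
    by nc2_by (eqD (eqD (eqR x hc) (eqL x hc)) (eqD (eqD (eqL w' cu) (eqR w' cu)) (eqL c%:A cu))).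
  exact: (good_bracket char2 gqs pps qqs).
have [I [D [d [a [iD _ pE]]]]] := j_family p.2.
have [k [kD kv]] : exists k, k \in D /\ ~ comm (a k) v.
  apply: NNPP => nk; apply: pv; apply: commS; rewrite pE; apply/j_comm => // k kD.
  by apply: NNPP => h; apply: nk; exists k.
exists (a k); split; last by move=> h; apply: kv; rewrite /comm; nc2_by h.
move=> s Ss; apply: S_cent => s' Ss'.
have : comm (p.2 * j s + j s * p.2) (j s').
  by apply: (cent_comm char2 gqs full) => //; apply: norm.
have -> : p.2 * j s + j s * p.2 = \sum_(i in D) d i *: j (a i * s + s * a i).
  rewrite pE mulr_suml mulr_sumr -big_split; apply: eq_bigr => i _ /=.
  by rewrite jD !jM scalerDr scalerAl scalerAr.
by move/j_comm => /(_ iD k kD).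
Qed.

Lemma generators_descend : ~ alt sigma 1 -> exists ps : seq (A * A),
  [/\ good ps, forall x, gen ps x & fixed sigma ps].
Proof.
move=> ort; apply: (@generators_exist F A sigma S) => //.
- exact: S_sym.
- exact: S_sqr.
- exact: S_altF.
- exact: S_comm.
- exact: SD.
- exact: SM.
- exact: S_scalar.
- exact: S_cent.
- exact: S_derivation.
Qed.

End Descent.

(** * Splitting, and the alternating form of a symplectic involution *)

Lemma split_extension1 (K : fieldType) (a : K) :
  exists (L : fieldType) (k : {rmorphism K -> L}) (t : L), t * t = t + k a.
Proof.
pose p : {poly K} := 'X^2 - 'X - a%:P.
have sp : size p = 3.
  by rewrite /p -addrA -opprD size_polyDl size_polyXn // size_polyN size_XaddC.
have pE (L : fieldType) (k : {rmorphism K -> L}) t :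
    root (map_poly k p) t -> t * t = t + k a.
  rewrite /root !rmorphB /= map_polyXn map_polyX map_polyC !hornerE -expr2.
  by rewrite -addrA -opprD subr_eq0 => /eqP.
case: (classic (exists x, root p x)) => [[x px]|nr].
  by exists K, idfun, x; apply: (pE K idfun); rewrite map_poly_id.
have irr : irreducible_poly p.
  apply: cubic_irreducible => [|x]; first by rewrite sp.
  by apply/negP => px; apply: nr; exists x.
have [L _ [z zp _]] := irredp_FAdjoin irr.
by exists L, (in_alg L), z; apply: pE.
Qed.

Lemma split_extension (K : fieldType) (s : seq K) :
  exists (L : fieldType) (k : {rmorphism K -> L}),
    forall a, a \in s -> exists t : L, t * t = t + k a.
Proof.
elim: s => [|a s [L [k ks]]]; first by exists K, idfun.
have [M [l [t ht]]] := split_extension1 (k a).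
exists M, (l \o k : {rmorphism K -> M}) => b; rewrite in_cons => /orP[/eqP->|/ks[t' ht']].
  by exists t.
by exists (l t'); rewrite -rmorphM ht' rmorphD.
Qed.

Section ScalarTower.
Variables (F K L : fieldType) (iota : {rmorphism F -> K}) (k : {rmorphism K -> L}).
Variable A : falgType F.
Local Notation AK := (scalar_ext iota A).
Local Notation kiota := (k \o iota : {rmorphism F -> L}).
Local Notation AL := (scalar_ext kiota A).

Definition ext_map (x : AK) : AL :=
  \sum_(i < \dim {:A}) k (x i : K) *: ext_in kiota (vbasis {:A})`_i.

Lemma ext_mapD x y : ext_map (x + y) = ext_map x + ext_map y.
Proof.
rewrite -big_split; apply: eq_bigr => i _ /=.
by rewrite ffunE rmorphD scalerDl.
Qed.

Lemma ext_map_in c a : ext_map (c *: ext_in iota a) = k c *: ext_in kiota a.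
Proof.
have [jD jM j1 jZ] := ext_in_semihom kiota A.
have js (J : finType) (f : J -> A) : ext_in kiota (\sum_i f i) = \sum_i ext_in kiota (f i).
  apply: (big_morph _ jD); apply: (addrI (ext_in kiota 0)).
  by rewrite -jD !addr0.
rewrite [in RHS](coord_vbasis (memvf a)) js scaler_sumr; apply: eq_bigr => i _.
have cE : (c *: ext_in iota a : AK) i = c * iota (coord (vbasis {:A}) i a) :> K.
  by rewrite -tpure_ext_in ffunE; apply: mulrC.
by rewrite jZ scalerA /= -rmorphM cE.
Qed.

Lemma ext_map_semihom : semihom k ext_map.
Proof.
have [jD jM j1 jZ] := ext_in_semihom kiota A.
have [iD iM i1 iZ] := ext_in_semihom iota A.
have m0 : ext_map 0 = 0 by apply: (addrI (ext_map 0)); rewrite -ext_mapD !addr0.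
have ms (J : finType) (f : J -> AK) : ext_map (\sum_i f i) = \sum_i ext_map (f i).
  exact: (big_morph _ ext_mapD).
have mE := ext_map_in; have mD := ext_mapD; move: (ext_map) m0 ms mE mD => m m0 ms mE mD.
split=> // [x y||c x].
- rewrite (ext_expand x) (ext_expand y) mulr_suml !ms mulr_suml; apply: eq_bigr => i _.
  rewrite !mulr_sumr ms; apply: eq_bigr => l _.
  by rewrite -scalerAl -scalerAr -iM scalerA !mE jM -scalerAl -scalerAr scalerA -rmorphM.
- by rewrite -i1 -[ext_in iota 1]scale1r mE rmorph1 scale1r.
- rewrite (ext_expand x) scaler_sumr !ms scaler_sumr; apply: eq_bigr => i _.
  by rewrite scalerA !mE rmorphM scalerA.
Qed.

Lemma ext_map_full (ps : seq (AK * AK)) :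
  (forall x, gen ps x) -> forall y, gen (map (map_pair ext_map) ps) y.
Proof.
move=> full y; rewrite (ext_expand y); apply: big_ind; first exact: gen0.
  exact: genD.
move=> i _; apply: genZ; rewrite -[ext_in _ _]scale1r -(rmorph1 k) -ext_map_in.
exact: (gen_map ext_map_semihom).
Qed.

End ScalarTower.

(** * Matrix units from split quaternion pairs *)

Section MatrixUnits.
Variables (F : fieldType) (A : algType F).
Hypothesis char2 : 2%N \in [pchar F].

Definition split_pair (p : A * A) :=
  exists a t : F, p.2 * p.2 = p.2 + a%:A /\ t * t = t + a.

(** If t^2 = t + a, then W = w + t and Z = 1 + W are orthogonal idempotents that u interchanges, so
    a split pair gives 2 by 2 matrix units. Their products with the commuting matrix units of the
    other pairs are again matrix units, indexed by [bool * T]. *)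
Lemma matrix_units (ps : seq (A * A)) :
  good ps -> (forall p : A * A, p \in ps -> split_pair p) ->
  exists (T : finType) (t0 : T) (E : T -> T -> A),
  [/\ forall s t s' t', E s t * E s' t' = if t == s' then E s t' else 0,
      \sum_s E s s = 1, forall s t, gen ps (E s t) &
      forall x, gen ps x -> exists c : T -> T -> F, x = \sum_s \sum_t c s t *: E s t].
Proof.
elim: ps => [_ _|[u w] ps IH [[[b b0 /= hb] _ /= hwu] cp gps] sps].
  exists unit, tt, (fun _ _ => 1); split.
  - by move=> [] [] [] []; rewrite mulr1.
  - by rewrite (big_pred1 tt) // => -[].
  - by move=> _ _; exists 1; rewrite scale1r.
  move=> x [c ->]; exists (fun _ _ => c).
  by rewrite (big_pred1 tt) => [|[]] //; rewrite (big_pred1 tt) => [|[]].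
have [|T [t0 [E [EM E1 Eg Es]]]] := IH gps.
  by move=> p pps; apply: sps; rewrite in_cons pps orbT.
have [a [t [/= ha ht]]] := sps (u, w) (mem_head _ _).
have cu x : gen ps x -> comm x u.
  by move=> gx; apply: commS; apply: gen_comm gx => q /cp[].
have cw x : gen ps x -> comm x w.
  by move=> gx; apply: commS; apply: gen_comm gx => q /cp[].
have htA : (t * t)%:A = t%:A + a%:A :> A by rewrite ht scalerDl.
pose W := w + t%:A; pose Z := 1 + W.
pose e (x y : bool) : A :=
  if x then if y then W else b^-1 *: (u * Z) else if y then u * W else Z.
have WW : W * W = W by rewrite /W; nc2_by (eqD ha htA).
have Wu : W * u = u * Z by rewrite /Z /W; nc2_by hwu.
have Zu : Z * u = u * W by rewrite /Z /W; nc2_by hwu.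
have WZ : W * Z = 0 by rewrite /Z mulrDr mulr1 WW (addxx char2).
have ZW : Z * W = 0 by rewrite /Z mulrDl mul1r WW (addxx char2).
have ZZ : Z * Z = Z by rewrite {1}/Z mulrDl WZ mul1r addr0.
have bb x : b^-1 *: (b *: x) = x by rewrite scalerA mulVf // scale1r.
have bu x : u * (u * x) = b *: x by rewrite mulrA hb mulr_algl.
have asc (x y z : A) : x * y = z -> forall v, x * (y * v) = z * v.
  by move=> <- v; rewrite mulrA.
have eM x y x' y' : e x y * e x' y' = if y == x' then e x y' else 0.
  have rules := (WW, Wu, Zu, WZ, ZW, ZZ, bu, asc _ _ _ WW, asc _ _ _ Wu, asc _ _ _ Zu,
    asc _ _ _ WZ, asc _ _ _ ZW, asc _ _ _ ZZ).
  case: x y x' y' => [] [] [] []; rewrite /e /= -?scalerAl -?scalerAr -?mulrA;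
    by do ?[rewrite rules -?mulrA]; rewrite ?mul0r ?mulr0 ?scaler0 -?scalerAr ?bb.
have eS x y : exists p0 p1 p2 p3 : F,
    e x y = p0%:A + p1 *: u + p2 *: w + p3 *: (u * w).
  case: x y => [] []; rewrite /e /Z /W.
  - by exists t, 0, 1, 0; nc2.
  - by exists 0, (b^-1 * (1 + t)), 0, b^-1; nc2.
  - by exists 0, t, 0, 1; nc2.
  - by exists (1 + t), 0, 1, 0; nc2.
pose E' (p q : bool * T) := e p.1 q.1 * E p.2 q.2.
pose sp z := exists c : bool * T -> bool * T -> F, z = \sum_p \sum_q c p q *: E' p q.
have spD y z : sp y -> sp z -> sp (y + z).
  case=> c -> [d ->]; exists (fun p q => c p q + d p q).
  rewrite -big_split; apply: eq_bigr => p _; rewrite -big_split; apply: eq_bigr => q _.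
  by rewrite scalerDl.
have spM (d : bool -> bool -> F) y z : y = \sum_x \sum_y d x y *: e x y -> gen ps z ->
    comm z y -> sp (z * y).
  move=> yE gz ->; have [c ->] := Es z gz; rewrite yE.
  exists (fun p q => d p.1 q.1 * c p.2 q.2).
  rewrite -(pair_bigA _ (fun x s => \sum_q (d x q.1 * c s q.2) *: E' (x, s) q)) /=.
  rewrite mulr_suml; apply: eq_bigr => x _; rewrite mulr_sumr; apply: eq_bigr => r _.
  rewrite -(pair_bigA _ (fun x' s => (d x x' * c r s) *: E' (x, r) (x', s))) /=.
  rewrite mulr_suml; apply: eq_bigr => x' _; rewrite mulr_sumr; apply: eq_bigr => r' _.
  by rewrite -scalerAl -scalerAr scalerA.
have sp2 (d : bool -> bool -> F) : \sum_x \sum_y d x y *: e x y =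
    d true true *: W + d true false *: (b^-1 *: (u * Z)) +
    (d false true *: (u * W) + d false false *: Z).
  by rewrite !big_bool.
exists (bool * T)%type, (true, t0), E'; split.
- move=> [x r] [y r'] [x' s] [y' s']; rewrite /E' /= xpair_eqE.
  have cE : comm (E r r') (e x' y').
    have [p0 [p1 [p2 [p3 ->]]]] := eS x' y'.
    have [c1 c2] := (cu _ (Eg r r'), cw _ (Eg r r')).
    by do ?apply: commD; apply: commZ; [exact: comm1|..|apply: commM].
  rewrite mulrA -[e x y * _ * _]mulrA cE mulrA eM -mulrA EM.
  by case: eqP => _; case: eqP => _; rewrite ?mulr0 ?mul0r.
- rewrite -(pair_bigA _ (fun x s => e x x * E s s)) big_bool /= -!mulr_sumr E1 !mulr1.
  by rewrite /Z; nc2.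
- move=> [x r] [y r']; rewrite /E' /=.
  have [p0 [p1 [p2 [p3 ->]]]] := eS x y; set z := E r r'.
  have gz : gen ps z by apply: Eg.
  exists (p0 *: z), (p1 *: z), (p2 *: z), (p3 *: z); split; try exact: genZ.
  have [c1 c2] := (cu _ gz, cw _ gz); have c3 := commM c1 c2.
  by nc2_by (eqD (eqD (eqL p1%:A c1) (eqL p2%:A c2)) (eqL p3%:A c3)).
move=> x [x0 [x1 [x2 [x3 [g0 g1 g2 g3 ->]]]]].
have [[c1 c2] c3] := (cu _ g1, cw _ g2, commM (cu _ g3) (cw _ g3)).
have bZ x' : b *: (b^-1 *: x') = x' by rewrite scalerA mulfV // scale1r.
(* The coefficients below come from 1 = W + Z, u = uW + uZ, w = (1 + t)W + tZ and uw = (1 + t)uW + t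
   uZ, where uZ is b times a matrix unit. *)
apply: (spD); first (apply: (spD); first apply: spD).
- rewrite -[x0]mulr1; apply: (spM (fun x y => (x == y)%:R)) => //; last exact: comm1.
  by rewrite sp2 /= !scale0r !scale1r /Z; nc2.
- apply: (spM (fun x y => if y then (if x then 0 else 1) else (if x then b else 0))) => //.
  by rewrite sp2 bZ !scale0r /Z; nc2.
- apply: (spM (fun x y => if x == y then (if x then 1 + t else t) else 0)) => //.
  by rewrite sp2 /= !scale0r /Z /W; nc2.
apply: (spM (fun x y => if y then (if x then 0 else 1 + t) else (if x then t * b else 0))) => //.
by rewrite sp2 -scalerA bZ !scale0r /Z /W; nc2.
Qed.

End MatrixUnits.

Lemma matrix_iso (F : fieldType) (A : falgType F) (T : finType) (t0 : T) (E : T -> T -> A) :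
  (forall s t s' t', E s t * E s' t' = if t == s' then E s t' else 0) ->
  \sum_s E s s = 1 ->
  (forall x, exists c : T -> T -> F, x = \sum_s \sum_t c s t *: E s t) ->
  exists (m : nat) (phi : {lrmorphism A -> 'M[F]_m.+1}), bijective phi.
Proof.
move=> EM E1 Es.
have [m [f [g fK gK]]] : exists m (f : 'I_m.+1 -> T), bijective f.
  have cT : #|T| = #|T|.-1.+1 by rewrite prednK //; apply/card_gt0P; exists t0.
  exists #|T|.-1, (fun i => enum_val (cast_ord (esym cT) i)).
  exists (fun t => cast_ord cT (enum_rank t)) => [i|t].
    by rewrite enum_valK cast_ordKV.
  by rewrite cast_ordK enum_rankK.
have fB : {on [pred _ | true], bijective f} by exists g => x _.
pose psi (X : 'M[F]_m.+1) : A := \sum_i \sum_j X i j *: E (f i) (f j).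
have psiD X Y : psi (X + Y) = psi X + psi Y.
  rewrite -big_split; apply: eq_bigr => i _; rewrite -big_split; apply: eq_bigr => j _ /=.
  by rewrite mxE scalerDl.
have psiZ c X : psi (c *: X) = c *: psi X.
  rewrite scaler_sumr; apply: eq_bigr => i _; rewrite scaler_sumr; apply: eq_bigr => j _ /=.
  by rewrite mxE scalerA.
have psi1 : psi 1 = 1.
  rewrite -E1 (reindex f) //; apply: eq_bigr => i _; rewrite (bigD1 i) //= big1.
    by rewrite mxE eqxx scale1r addr0.
  by move=> k /negPf ki; rewrite mxE eq_sym ki scale0r.
have psiM X Y : psi (X * Y) = psi X * psi Y.
  rewrite mulr_suml; apply: eq_bigr => i _.
  under eq_bigr => l _ do rewrite mxE scaler_suml.
  rewrite exchange_big mulr_suml /=; apply: eq_bigr => j _.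
  rewrite [RHS]mulr_sumr [RHS](bigD1 j) //= [X in _ = _ + X]big1 ?addr0.
    rewrite [RHS]mulr_sumr; apply: eq_bigr => l _.
    by rewrite -scalerAl -scalerAr EM eqxx scalerA.
  move=> k /negPf kj; rewrite mulr_sumr big1 // => l _.
  by rewrite -scalerAl -scalerAr EM (inj_eq (can_inj fK)) eq_sym kj !scaler0.
have psi_coef X i j : E (f 0) (f i) * psi X * E (f j) (f 0) = X i j *: E (f 0) (f 0).
  rewrite mulr_sumr mulr_suml (bigD1 i) //= [X in _ + X]big1 ?addr0.
    rewrite mulr_sumr mulr_suml (bigD1 j) //= [X in _ + X]big1 ?addr0.
      by rewrite -scalerAr -scalerAl !EM eqxx EM eqxx.
    move=> k /negPf kj; rewrite -scalerAr -scalerAl EM eqxx EM.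
    by rewrite (inj_eq (can_inj fK)) kj scaler0.
  move=> k /negPf ki; rewrite mulr_sumr mulr_suml big1 // => l _.
  by rewrite -scalerAr EM (inj_eq (can_inj fK)) eq_sym ki scaler0 mul0r.
have E00 : E (f 0) (f 0) != 0.
  apply/eqP => E0; have /eqP[] := oner_neq0 A; rewrite -E1 big1 // => s _.
  have -> : E s s = E s (f 0) * E (f 0) (f 0) * E (f 0) s by rewrite !EM !eqxx EM eqxx.
  by rewrite E0 mulr0 mul0r.
have psiI : injective psi.
  move=> X Y XY; apply/matrixP => i j; apply/eqP; rewrite -subr_eq0.
  have := psi_coef X i j; rewrite XY psi_coef => /eqP.
  by rewrite eq_sym -subr_eq0 -scalerBl scaler_eq0 (negPf E00) orbF.
have ex x : exists X, psi X == x.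
  have [c ->] := Es x; exists (\matrix_(i, j) c (f i) (f j)); apply/eqP.
  rewrite [RHS](reindex f) //; apply: eq_bigr => i _; rewrite [RHS](reindex f) //.
  by apply: eq_bigr => j _; rewrite mxE.
pose phi x := xchoose (ex x).
have phiK x : psi (phi x) = x by apply/eqP/(xchooseP (ex x)).
have phiL : linear phi by move=> c x y; apply: psiI; rewrite psiD psiZ !phiK.
have phiM : monoid_morphism phi.
  by split=> [|x y]; apply: psiI; rewrite ?psiM ?psi1 !phiK.
pose phi' : {lrmorphism A -> 'M[F]_m.+1} := HB.pack phi
  (GRing.isLinear.Build F A 'M[F]_m.+1 *:%R phi phiL)
  (GRing.isMonoidMorphism.Build A 'M[F]_m.+1 phi phiM).
by exists m, phi', psi => [x|X]; [apply: phiK|apply: psiI; apply: phiK].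
Qed.

(** * Involutions of matrix algebras and bilinear forms *)

Section AdjointForm.
Variables (L : fieldType) (m : nat).
Local Notation M := 'M[L]_m.+1.
Variable tau : M -> M.
Hypotheses (char2 : 2%N \in [pchar L]) (inv : involution_first_kind tau).

Definition adjoint_form (b : M) := forall X : M, X^T *m b = b *m tau X.

(** The left kernel of b is stable under all matrices; elementary ones carry a nonzero v in it to
    every basis row vector, so all rows of b would vanish. *)
Lemma adjoint_form_unit b : b != 0 -> adjoint_form b -> b \in unitmx.
Proof.
move=> b0 hb; rewrite unitmxE unitfE; apply/det0P => -[v v0 vb].
have [i vi] : exists i, v 0 i != 0.
  apply/existsP; rewrite -negb_forall; apply: contra v0 => /forallP v0.
  by apply/eqP/rowP => i; rewrite mxE; apply/eqP.
case/eqP: b0; apply/row_matrixP => l; rewrite row0.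
have := congr1 (fun Y => v *m Y) (hb (delta_mx l i)).
rewrite /= mulmxA (mulmxA v b) vb mul0mx trmx_delta.
have -> : v *m delta_mx i l = v 0 i *: delta_mx 0 l.
  apply/rowP => k; rewrite !mxE (bigD1 i) //= big1 => [|r /negPf ri]; rewrite !mxE.
    by rewrite eqxx addr0.
  by rewrite ri mulr0.
rewrite -scalemxAl -rowE => /eqP; rewrite scaler_eq0 (negPf vi) => /eqP.
by [].
Qed.

(** An explicit substitute for the Skolem-Noether theorem. The E_{i0} span a left ideal isomorphic
    to the column vectors, which tau turns into a right ideal; b collects the s-th rows of the
    tau(E_{i0}). Applying tau to X E_{i0}, the sum of the X_{ri} E_{r0}, gives adjointness. *)
Lemma adjoint_form_exists : exists b, b != 0 /\ adjoint_form b.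
Proof.
have [tD tM tK tF] := inv.
have ts (I : finType) (f : I -> M) : tau (\sum_i f i) = \sum_i tau (f i).
  exact: (big_morph _ tD (invol0 inv)).
have d0 : tau (delta_mx 0 0) != 0.
  apply/eqP => h; have /eqP := tK (delta_mx 0 0); rewrite h (invol0 inv) => /eqP/matrixP/(_ 0 0).
  by rewrite !mxE eqxx => /esym/eqP; rewrite oner_eq0.
have [s [k sk]] : exists s k, tau (delta_mx 0 0) s k != 0.
  apply: NNPP => h; case/eqP: d0; apply/matrixP => s k; rewrite mxE; apply/eqP/negPn/negP => sk.
  by apply: h; exists s, k.
pose b : M := \matrix_(i, k) tau (delta_mx i 0) s k.
exists b; split.
  by apply: contraNneq sk => b0; have /matrixP/(_ 0 k) := b0; rewrite !mxE => ->.
move=> X; apply/matrixP => i l.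
have -> : (b *m tau X) i l = tau (X * delta_mx i 0) s l.
  by rewrite tM !mxE; apply: eq_bigr => r _; rewrite !mxE.
have -> : X * delta_mx i 0 = \sum_r X r i *: delta_mx r 0.
  apply/matrixP => r c; rewrite mxE summxE (bigD1 i) //= big1 => [|q /negPf qi].
    rewrite (bigD1 r) //= big1 => [|q /negPf qr]; rewrite !mxE ?eqxx ?addr0 //.
    by rewrite eq_sym qr mulr0.
  by rewrite !mxE qi mulr0.
rewrite ts summxE mxE; apply: eq_bigr => r _.
by rewrite (involZ inv) !mxE.
Qed.

Lemma mx11_tr (x : 'M[L]_1) : x^T = x.
Proof. by apply/matrixP => i k; rewrite !ord1 mxE. Qed.

Lemma addmm (n p : nat) (x : 'M[L]_(n, p)) : x + x = 0.
Proof. exact: addxx. Qed.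

(** As tau is an involution, b^T is an adjoint form along with b, hence so is b + b^T, which is
    alternating and serves if it is nonzero. If b is symmetric, 1 = y + tau(y) splits u^T b u into
    two 1 by 1 matrices that are transposes of each other, and these cancel. *)
Lemma alternating_adjoint_form : alt tau 1 ->
  exists b, [/\ b \in unitmx, adjoint_form b & forall u : 'cV[L]_m.+1, u^T *m b *m u = 0].
Proof.
have [tD tM tK tF] := inv; move=> [y y1].
have [b [b0 hb]] := adjoint_form_exists.
have [bs|bs] := eqVneq (b + b^T) 0.
  exists b; split=> //; first exact: adjoint_form_unit.
  move=> u.
  have bT : b^T = b.
    by apply: (addrI b); rewrite bs addmm.
  have -> : u^T *m b *m u = u^T *m b *m (y + tau y) *m u by rewrite -y1 mulmx1.
  rewrite mulmxDr mulmxDl -[u^T *m b *m tau y]mulmxA -hb.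
  have -> : u^T *m (y^T *m b) *m u = (u^T *m b *m y *m u)^T.
    by rewrite !trmx_mul trmxK bT !mulmxA.
  by rewrite mx11_tr addmm.
have hc : adjoint_form (b + b^T).
  move=> X; rewrite mulmxDr mulmxDl hb; congr (_ + _).
  have := congr1 trmx (hb (tau X)); rewrite tK !trmx_mul trmxK.
  by [].
exists (b + b^T); split=> //; first exact: adjoint_form_unit.
move=> u; rewrite mulmxDr mulmxDl.
have -> : u^T *m b^T *m u = (u^T *m b *m u)^T by rewrite !trmx_mul trmxK mulmxA.
by rewrite mx11_tr addmm.
Qed.

End AdjointForm.

(** The definition of symplectic leaves the splitting field free: here it is an extension L of K in
    which t^2 = t + a is solvable for every relation w^2 = w + a of the pairs. These then give
    matrix units of A_L, and 1 in Alt carries over to the transported involution. *)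
Lemma symplectic_of_generators (F K : fieldType) (iota : {rmorphism F -> K})
    (A : falgType F) (sigma : A -> A) (ps : seq (scalar_ext iota A * scalar_ext iota A)) :
  2%N \in [pchar F] -> involution_first_kind sigma -> good ps -> (forall x, gen ps x) ->
  alt sigma 1 -> symplectic_invol sigma.
Proof.
move=> char2F inv gps full [y y1].
have [c cP] : exists c : scalar_ext iota A * scalar_ext iota A -> K,
    forall p, p \in ps -> p.2 * p.2 = p.2 + (c p)%:A.
  elim: ps gps {full} => [|p ps IH] /=; first by exists (fun=> 0).
  move=> [[_ [a ha] _] _ /IH[c cP]].
  exists (fun q => if q == p then a else c q) => q; rewrite in_cons.
  by case: eqP => [->|_] //= /cP.
have [L [k kP]] := split_extension (map c ps).
pose kiota := (k \o iota : {rmorphism F -> L}).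
have hm := ext_map_semihom iota k A; have [mD mM m1 mZ] := hm.
have gqs := good_map hm gps; have fqs := @ext_map_full F K L iota k A ps full.
set qs := map _ _ in gqs fqs.
have char2L : 2%N \in [pchar L] by rewrite (fmorph_pchar kiota).
have [|T [t0 [E [EM E1 _ Es]]]] := matrix_units char2L gqs.
  move=> _ /mapP[p pps ->]; have [t ht] := kP _ (map_f c pps).
  by exists (k (c p)), t; rewrite /= -mM (cP p pps) mD mZ m1.
have [m [phi phiB]] := matrix_iso t0 EM E1 (fun x => Es x (fqs x)).
have invL := invol_ext_first_kind kiota inv.
have [psi phiK psiK] := phiB.
set tauL := invol_ext sigma in invL.
have [tD tM tK tF] := invL.
have invM : involution_first_kind (fun X => phi (tauL (psi X))).
  have psi_hom : [/\ forall X Y, psi (X + Y) = psi X + psi Y,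
      forall X Y, psi (X * Y) = psi X * psi Y & forall a : L, psi a%:A = a%:A].
    split=> [X Y|X Y|a]; apply: (can_inj phiK).
    - by rewrite rmorphD /= !psiK.
    - by rewrite rmorphM /= !psiK.
    - by rewrite linearZ /= rmorph1 psiK.
  have [sD sM sZ] := psi_hom.
  split=> [X Y|X Y|X|a].
  - by rewrite sD tD rmorphD.
  - by rewrite sM tM rmorphM.
  - by rewrite phiK tK psiK.
  - by rewrite sZ tF linearZ /= rmorph1.
have a1 : alt (fun X => phi (tauL (psi X))) 1.
  exists (phi (ext_in kiota y)); rewrite phiK -rmorphD -(rmorph1 phi); congr (phi _).
  have [jD _ j1 _] := ext_in_semihom kiota A.
  rewrite -j1 y1 jD; congr (_ + _).
  by rewrite /tauL -[ext_in kiota y]scale1r (invol_ext_ext_in kiota inv) scale1r.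
have [b [bu bA balt]] := alternating_adjoint_form char2L invM a1.
exists L, kiota, m, phi, b; split=> // x u v.
by rewrite trmx_mul -!mulmxA (mulmxA _ b v) bA phiK !mulmxA.
Qed.

Theorem theorem4p4 (F K : fieldType) (iota : {rmorphism F -> K})
    (A : falgType F) (sigma : A -> A) (n : nat)
    (char2 : 2%N \in [pchar F])
    (sepK : separable_extension iota)
    (csaA : central_simple A)
    (degA : has_degree A (2 ^ n))
    (ortho : orthogonal_invol sigma)
    (aniso : anisotropic_invol sigma) :
  totally_decomposable sigma <->
  totally_decomposable (invol_ext (iota := iota) sigma).
Proof.
have [inv nsym] := ortho.
have char2K : 2%N \in [pchar K] by rewrite (fmorph_pchar iota).
have invK := invol_ext_first_kind iota inv.
have jtau a : invol_ext sigma (ext_in iota a) = ext_in iota (sigma a).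
  by rewrite -[ext_in iota a]scale1r (invol_ext_ext_in iota inv) scale1r.
split=> [/(generators_of_decomposable char2)[ps [gps full fps]]|].
  have ort : ~ alt sigma 1.
    move=> a1; apply: nsym.
    (* The generators are already defined over F, which is viewed as an extension of itself. *)
    pose id' : {rmorphism F -> F} := idfun.
    apply: (@symplectic_of_generators F F id' A sigma (map (map_pair (@ext_in F F id' A)) ps)) => //.
      exact: (good_map (ext_in_semihom id' A)).
    exact: ext_in_full.
  have hj := ext_in_semihom iota A.
  have gK := good_map hj gps; have fK := @ext_in_full F K iota A ps full.
  apply: (decomposable_of_generators invK char2K gK fK).
  move=> _ /mapP[p pps ->] /=; have [p1 p2] := fps ort p pps.
  by rewrite !jtau p1 p2.
move=> /(generators_of_decomposable char2K)[qs [gqs full fqs]].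
have ort : ~ alt sigma 1.
  by move=> a1; apply: nsym; apply: (symplectic_of_generators char2 inv gqs full a1).
have [jD jM j1 jZ] := ext_in_semihom iota A.
have ortK : ~ alt (invol_ext (iota := iota) sigma) 1.
  by rewrite -j1 => /(ext_alt_in inv).
have [ps [gps fullA fps]] : exists ps : seq (A * A),
    [/\ good ps, forall x, gen ps x & fixed sigma ps].
  apply: (@generators_descend F K iota A (scalar_ext iota A) (@ext_in F K iota A) sigma
    (invol_ext (iota := iota) sigma)) => //.
  - exact: ext_in_inj.
  - exact: ext_in_indep.
  - move=> x; have [I [D [d [iD iD2 sp]]]] := separable_family char2 sepK (codom x).
    have [|a xE] := @ext_family F K iota A I D d x.
      by move=> i; apply: sp; rewrite in_cons codom_f orbT.
    by exists I, D, d, a.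
  - exact: (ext_alt_descent inv).
  - by move=> I D d s c; apply: (ext_altF_descent inv).
  - by move=> a c; apply: (ext_altF_in inv).
  - exact: ext_scalar_in.
  - exact: gqs.
  - exact: (fqs ortK).
  by move=> x xx; apply: NNPP => x0; apply: aniso; exists x; split=> //; apply/eqP.
exact: (decomposable_of_generators inv char2 gps fullA fps).
Qed.
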